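(* Let $X=(X_t)_{t\ge 0}$ be a real-valued Lévy process with $X_0=0$ a.s., and for $t\ge 0$ let $A_t=\int_0^t\mathbf 1\{X_s>0\}\,ds$ be its positive sojourn time up until time $t$. Then for all $q,\lambda>0$ $$G(q,\lambda):=\mathbb E\left[\int_0^\infty e^{-qt}\exp(-\lambda A_t)\,dt\right]=q^{-1}\exp\left(-\int_0^\infty e^{-qt}t^{-1}\,\mathbb P\{X_t>0\}\,(1-e^{-\lambda t})\,dt\right),$$ and the Laplace transform $\lambda\mapsto\mathbb E[\exp(-\lambda A_t)]$ of $A_t$ is uniquely determined by this identity (for $q,\lambda>0$).
   Context: A real-valued process $X=(X_t)_{t\ge0}$ is a Lévy process issued from the origin if its paths are almost surely right-continuous with left limits, $X_0=0$ a.s., and for $0\le s\le t$ the increment $X_t-X_s$ is equal in distribution to $X_{t-s}$ and independent of $(X_u,u\le s)$. *)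

(* Defs.v *)
From HB Require Import structures.
From mathcomp Require Import all_boot all_order all_algebra.
From mathcomp Require Import all_classical all_reals all_analysis.

Set Implicit Arguments.
Unset Strict Implicit.
Unset Printing Implicit Defensive.

Import Order.TTheory GRing.Theory Num.Theory.
Import numFieldNormedType.Exports.

Local Open Scope classical_set_scope.
Local Open Scope ring_scope.
Local Open Scope ereal_scope.

(* Time is indexed by the whole of R for convenience: every definition below
   only looks at the values of a process at times t >= 0. *)

Definition cadlag (R : realType) (f : R -> R) : Prop :=
  (forall t : R, (0 <= t)%R -> f s @[s --> t^'+] --> f t) /\
  (forall t : R, (0 < t)%R -> cvg (f s @[s --> t^'-])).

Definition independent_systems (d : measure_display) (T : measurableType d)
    (R : realType) (P : probability T R) (F G : set (set T)) : Prop :=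
  forall A B : set T, F A -> G B -> P (A `&` B) = P A * P B.

(* The sigma-algebra sigma(X_u, 0 <= u <= s). *)
Definition past (d : measure_display) (T : measurableType d) (R : realType)
    (P : probability T R) (X : R -> {RV P >-> R}) (s : R) : set (set T) :=
  <<s \bigcup_(u in `[0%R, s]) g_sigma_algebra_preimage (X u) >>.

Record levy_process (d : measure_display) (T : measurableType d) (R : realType)
    (P : probability T R) (X : R -> {RV P >-> R}) : Prop := LevyProcess {
  levy_cadlag : {ae P, forall w, cadlag (fun t => X t w)} ;
  levy_start : {ae P, forall w, X 0%R w = 0%R} ;
  levy_stationary : forall s t : R, (0 <= s)%R -> (s <= t)%R ->
    forall B : set R, measurable B ->
      P ((fun w => X t w - X s w)%R @^-1` B) = distribution P (X (t - s)%R) B ;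
  levy_independent : forall s t : R, (0 <= s)%R -> (s <= t)%R ->
    independent_systems P
      (g_sigma_algebra_preimage (fun w => X t w - X s w)%R) (past X s)
}.

(* The integral lies in [0, t], so no information is lost by taking its real
   value. *)
Definition positive_sojourn (d : measure_display) (T : measurableType d)
    (R : realType) (P : probability T R) (X : R -> {RV P >-> R}) (t : R) (w : T)
    : R :=
  (\int[lebesgue_measure]_(s in `[0, t]) \1_[set u | (0 < X u w)%R] s)%R.

(* Likewise the pathwise time integral lies in [0, 1 / q] for q, lambda > 0. *)
Definition sojourn_double_laplace (d : measure_display) (T : measurableType d)
    (R : realType) (P : probability T R) (X : R -> {RV P >-> R}) (q lambda : R)
    : \bar R :=
  'E_P[fun w => (\int[lebesgue_measure]_(t in `[0, +oo[)
         (expR (- (q * t)) * expR (- (lambda * positive_sojourn X t w))))%R].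

(* The integral and the exponential are taken in the extended reals, so that
   convergence of the exponent is not presupposed. *)
Definition positivity_formula (d : measure_display) (T : measurableType d)
    (R : realType) (P : probability T R) (X : R -> {RV P >-> R}) (q lambda : R)
    : \bar R :=
  (q^-1)%:E *
  expeR (- \int[lebesgue_measure]_(t in `]0%R, +oo[)
             ((expR (- (q * t)) * t^-1)%:E * P [set w | (0 < X t w)%R]
              * (1 - expR (- (lambda * t)))%:E)).

(* A candidate L t lambda for the Laplace transform of the time-t marginal.
   Integrating against exp(- q t) cannot see null sets of times, so candidates
   are required to be right-continuous in t >= 0, as the true Laplace transform
   of the positive sojourn time is. *)
Definition solves_identity (d : measure_display) (T : measurableType d)
    (R : realType) (P : probability T R) (X : R -> {RV P >-> R})
    (L : R -> R -> R) : Prop :=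
  forall lambda : R, (0 < lambda)%R ->
    (forall t : R, (0 <= t)%R -> L u lambda @[u --> t^'+] --> L t lambda) /\
    (forall q : R, (0 < q)%R ->
      lebesgue_measure.-integrable `[0%R, +oo[
        (fun t => (expR (- (q * t)) * L t lambda)%:E) /\
      \int[lebesgue_measure]_(t in `[0%R, +oo[)
        (expR (- (q * t)) * L t lambda)%:E = positivity_formula X q lambda).

(* Main.v *)
Require Import Defs.
From HB Require Import structures.
From mathcomp Require Import all_boot all_order all_algebra.
From mathcomp Require Import all_classical all_reals all_analysis.
From mathcomp Require Import measurable_realfun ring lra.

Set Implicit Arguments.
Unset Strict Implicit.
Unset Printing Implicit Defensive.

Import Order.TTheory GRing.Theory Num.Theory.
Import numFieldNormedType.Exports.
Import HBNNSimple.

Local Open Scope classical_set_scope.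
Local Open Scope ring_scope.

(** Fix [q, lambda > 0] and put [p = q + lambda], [r = lambda / p < 1]. Let
    [H t] be the time spent in the half line [x <= 0] up to time [t]. Almost
    surely [A t = t - H t], so that [exp (- q t - lambda A t)] equals
    [exp (- p t) exp (lambda H t)] and [G (q, lambda) = p^-1 V 1], where
    [V f = E (exp (lambda H tau) f (X tau))] for an exponential time [tau] of
    rate [p], independent of the process ([discounted]).

    From continuous to discrete time. The absolutely continuous function [H]
    satisfies [exp (lambda H t) = 1 + lambda int_0^t 1{X s <= 0} exp (lambda H
    s) ds] ([integral_exponential]). Inserting this in [V f], the lack of memory
    of [tau] and the Markov property at time [s] ([renewal]) give
    [V f = rho f + r V g], where [rho] is the law of [X tau] and
    [g x = 1{x <= 0} int f (x + y) rho (dy)] ([feynman_kac]). As [r < 1] this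
    can be iterated from [f = 1]: if [S] is the random walk with step law [rho],
    [V 1 = sum_n r^n P (S_1 <= 0, ..., S_n <= 0)] ([discounted_series]).

    Spitzer's identity. Let [a_n = P (S_1 <= 0, ..., S_n <= 0)]. Then
    [n a_n = sum_(k < n) P (S_(k+1) <= 0) a_(n-k-1)]. The proof is Baxter's:
    in a commutative ring with an additive projection whose image and whose
    kernel are closed under products, the logarithmic derivative of a
    factorisation of [1 - r mu] splits into its two components ([spitzer]). The
    ring is that of finite signed measures on the line under convolution, and
    the projection is the restriction to [x <= 0]. The recursion says that
    [sum_n a_n r^n = exp (sum_(n > 0) r^n P (S_n <= 0) / n)]
    ([exponential_formula]).

    The exponent. [S_n] has the law of the process at an independent gamma time
    ([step_power]), and summing the gamma densities against [r^n / n] gives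
    [sum_(n > 0) r^n P (S_n \in B) / n = int_0^oo exp (- q t) t^-1
    (1 - exp (- lambda t)) P (X t \in B) dt] ([exponent_series]). For the whole
    line the left-hand side is [log (p / q)], hence
    [p^-1 V 1 = p^-1 exp (log (p / q) - exponent of {x > 0})], which is the
    formula ([discounted_formula]).

    Uniqueness. For fixed [lambda], a solution and [t |-> E exp (- lambda A t)]
    are right-continuous functions with the same Laplace transform in [t].
    Testing the difference against [exp (- exp (n (x - t)))], a limit of
    combinations of exponentials that tends to the indicator of [t > x] off the
    point [x], shows that its integrals over all intervals vanish ([laplace_unique]).

    The paths are only right-continuous off a null set; there the process is
    replaced by [0] ([version]). Right continuity makes it jointly measurable
    ([right_continuous_joint]), and the same argument carried out inside the
    past at time [s] shows that [H s] depends on the past only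
    ([adapted_weight]). *)

(** * Formal power series *)

(** Power series as coefficient sequences over any commutative ring: in
    Spitzer's identity the coefficients are measures. *)
Definition fps (A : comPzRingType) : Type := nat -> A.

Section fps_ring.
Variable A : comPzRingType.

HB.instance Definition _ := GRing.Zmodule.on (fps A).

Definition fps_one : fps A := fun n => (n == 0)%:R.
Definition fps_mul (x y : fps A) : fps A :=
  fun n => \sum_(i < n.+1) x i * y (n - i)%N.

Lemma fps_mulE_poly (x y : fps A) n :
  fps_mul x y n = \sum_(i < n.+1) x (n - i)%N * y i.
Proof.
rewrite /fps_mul (reindex_inj rev_ord_inj)/=; apply: eq_bigr => i _.
by rewrite !subSS subKn// -ltnS.
Qed.

Lemma fps_mulC : commutative fps_mul.
Proof.
move=> x y; apply/funext => n; rewrite fps_mulE_poly.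
by apply: eq_bigr => i _; rewrite mulrC.
Qed.

Lemma fps_mulA : associative fps_mul.
Proof.
move=> x y z; apply/funext => n.
transitivity (\sum_(i < n.+1) \sum_(j < n.+1 | (i <= j)%N)
   x i * (y (j - i)%N * z (n - j)%N)).
  apply: eq_bigr => i _; rewrite mulr_sumr.
  rewrite -(big_mkord xpredT (fun k => x i * (y k * z (n - i - k)%N))).
  rewrite -(big_mkord (fun j => (i <= j)%N)
     (fun j => x i * (y (j - i)%N * z (n - j)%N))) /=.
  rewrite [RHS](big_cat_nat (n := i)) //=; last exact: ltnW.
  rewrite [X in _ = X + _]big_nat_cond [X in _ = X + _]big1 ?add0r; last first.
    by move=> j /andP[/andP[_ ji] ij]; move: ij; rewrite leqNgt ji.
  have := @big_addn _ 0 +%R 0 n.+1 i (fun j => i <= j)%N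
     (fun j => x i * (y (j - i)%N * z (n - j)%N)).
  rewrite add0n => ->; rewrite subSn; last by rewrite -ltnS.
  rewrite !big_mkord [in RHS]big_mkcond/=; apply: eq_bigr => k _.
  by rewrite leq_addl addnK addnC subnDA.
rewrite (exchange_big_dep xpredT)//=; apply: eq_bigr => j _.
rewrite mulr_suml.
rewrite -(big_mkord xpredT (fun i => x i * y (j - i)%N * z (n - j)%N)).
rewrite -(big_mkord (fun i => i <= j)%N
  (fun i => x i * (y (j - i)%N * z (n - j)%N))).
rewrite [LHS](big_cat_nat (n := j.+1)) //=.
rewrite [X in _ + X]big_nat_cond [X in _ + X]big1 ?addr0; last first.
  by move=> i /andP[/andP[ji _] ij]; move: ij; rewrite leqNgt ji.
rewrite big_nat_cond [in RHS]big_nat_cond; apply: eq_big => i.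
  by rewrite andbT ltnS andbb.
by rewrite mulrA.
Qed.

Lemma fps_mul1 : left_id fps_one fps_mul.
Proof.
move=> x; apply/funext => n; rewrite /fps_mul big_ord_recl/= subn0 mul1r big1 ?addr0//.
by move=> i _; rewrite mul0r.
Qed.

Lemma fps_mulDl : left_distributive fps_mul +%R.
Proof.
move=> x y z; apply/funext => n; rewrite [RHS]/GRing.add/= -big_split/=.
by apply: eq_bigr => i _; rewrite mulrDl.
Qed.

HB.instance Definition _ := GRing.Zmodule_isComPzRing.Build (fps A)
  fps_mulA fps_mulC fps_mul1 fps_mulDl.

(** The derivation [r d/dr]; unlike [d/dr] it does not shift the coefficients, so
    [n a_n] is read off directly. *)
Definition fps_euler (x : fps A) : fps A := fun n => x n *+ n.

Lemma fps_coefD (x y : fps A) n : (x + y) n = x n + y n. Proof. by []. Qed.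
Lemma fps_coefN (x : fps A) n : (- x) n = - x n. Proof. by []. Qed.
Lemma fps_coefM (x y : fps A) n : (x * y) n = \sum_(i < n.+1) x i * y (n - i)%N.
Proof. by []. Qed.
Lemma fps_coef1 n : (1 : fps A) n = (n == 0)%:R. Proof. by []. Qed.

Lemma fps_eulerD x y : fps_euler (x + y) = fps_euler x + fps_euler y.
Proof. by apply/funext => n; rewrite fps_coefD /fps_euler -mulrnDl. Qed.

Lemma fps_eulerN x : fps_euler (- x) = - fps_euler x.
Proof. by apply/funext => n; rewrite fps_coefN /fps_euler mulNrn. Qed.

Lemma fps_euler1 : fps_euler 1 = 0.
Proof. by apply/funext => -[|n]; rewrite /fps_euler ?mulr0n// fps_coef1 mul0rn. Qed.

Lemma fps_eulerM x y : fps_euler (x * y) = fps_euler x * y + x * fps_euler y.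
Proof.
apply/funext => n; rewrite fps_coefD !fps_coefM /fps_euler -big_split/= -sumrMnl.
apply: eq_bigr => -[i /= ilt] _.
by rewrite mulrnAl mulrnAr -mulrnDr subnKC// -ltnS.
Qed.

(** Makes infinite sums of powers of [x] finite in each degree, as in the geometric
    series of [fps_inv] and the exponential series of [fps_exp]. *)
Lemma fps_expn_low (x : fps A) m n : x 0%N = 0 -> (n < m)%N -> (x ^+ m) n = 0.
Proof.
move=> x0; elim: m n => [//|m ih] n nm; rewrite exprS fps_coefM big1// => -[[|i]/= ilt] _.
  by rewrite x0 mul0r.
rewrite ih ?mulr0//; have := ltn_ord (Ordinal ilt); move=> /= ilt'.
by rewrite ltn_subLR// addSn; apply: (leq_trans nm); rewrite ltnS leq_addl.
Qed.

Lemma fps_inv (x : fps A) : x 0%N = 1 -> exists y, x * y = 1.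
Proof.
move=> x0.
have u0 : (1 - x) 0%N = 0 by rewrite fps_coefD fps_coefN x0 fps_coef1 subrr.
pose s m := \sum_(j < m) (1 - x) ^+ j.
have sS m n : (n < m)%N -> s m n = s n.+1 n.
  move=> nm; rewrite -(subnKC nm) /s; elim: (m - n.+1)%N => [|k ih].
    by rewrite addn0.
  by rewrite addnS big_ord_recr/= fps_coefD ih fps_expn_low ?addr0// leq_addr.
exists (fun n => s n.+1 n); apply/funext => n.
transitivity ((x * s n.+1) n).
  rewrite !fps_coefM; apply: eq_bigr => i _; congr (_ * _).
  by rewrite [RHS]sS// ltnS leq_subr.
have -> : x * s n.+1 = 1 - (1 - x) ^+ n.+1.
  by rewrite -[RHS]opprB subrX1 -mulNr; congr (_ * _); rewrite opprB subKr.
by rewrite fps_coefD fps_coefN fps_expn_low// subr0.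
Qed.

End fps_ring.

(** * Spitzer's identity for a projection in a commutative ring *)

Section spitzer.
Variables (A : comPzRingType) (N : {additive A -> A}).
Hypothesis N1 : N 1 = 1.
Hypothesis NN : forall a, N (N a) = N a.
Hypothesis N_mul : forall a b, N a = a -> N b = b -> N (a * b) = a * b.
Hypothesis N0_mul : forall a b, N a = 0 -> N b = 0 -> N (a * b) = 0.

(** Solving [z x = y] degree by degree expresses [z n] by products of coefficients
    that lie in the image of [N], a subring. The next lemma is the same for the
    kernel, which is closed under products but does not contain [1]; this is why
    the constant coefficient of [x] is exempted there. *)
Lemma fps_N_quotient (x y z : fps A) : x 0%N = 1 -> z * x = y ->
  (forall n, N (x n) = x n) -> (forall n, N (y n) = y n) ->
  forall n, N (z n) = z n.
Proof.
move=> x0 zxy Nx Ny n; elim/ltn_ind: n => n ih.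
have -> : z n = y n - \sum_(i < n) z i * x (n - i)%N.
  by rewrite -zxy fps_coefM big_ord_recr/= subnn x0 mulr1 addrAC subrr add0r.
rewrite raddfB/= Ny raddf_sum; congr (_ - _); apply: eq_bigr => i _.
by rewrite N_mul// ih.
Qed.

Lemma fps_N0_quotient (x y z : fps A) : x 0%N = 1 -> z * x = y ->
  (forall n, N (x n.+1) = 0) -> (forall n, N (y n) = 0) ->
  forall n, N (z n) = 0.
Proof.
move=> x0 zxy Nx Ny n; elim/ltn_ind: n => n ih.
have -> : z n = y n - \sum_(i < n) z i * x (n - i)%N.
  by rewrite -zxy fps_coefM big_ord_recr/= subnn x0 mulr1 addrAC subrr add0r.
rewrite raddfB/= Ny raddf_sum big1 ?subr0// => i _.
by rewrite N0_mul ?ih// -(prednK (n := n - i)) ?subn_gt0.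
Qed.

(** When [N] is the restriction of measures to a set and [mu] a step law, this is
    the law of a random walk after [n] steps, on the event that it has stayed in
    that set. *)
Fixpoint killed (mu : A) n : A := if n is m.+1 then N (killed mu m * mu) else 1.

(** Baxter's form of Spitzer's identity. With [p = sum_n r^n killed n], the defining
    recursion says that [p (1 - r mu)] is [1] plus terms killed by [N], and [p]
    has coefficients fixed by [N]. Comparing logarithmic derivatives avoids the
    logarithm itself, which would require dividing by integers. *)
Theorem spitzer (mu : A) n :
  killed mu n *+ n = \sum_(k < n) N (mu ^+ k.+1) * killed mu (n - k.+1)%N.
Proof.
pose p : fps A := killed mu.
pose rmu : fps A := fun n => if n == 1 then mu else 0.
have p0 : p 0%N = 1 by [].
have coef_rmu (x : fps A) m : (x * rmu) m.+1 = x m * mu.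
  rewrite fps_coefM big_ord_recr/= subnn /rmu/= mulr0 addr0 big_ord_recr/=.
  rewrite subSnn eqxx big1 ?add0r// => i _.
  by rewrite gtn_eqF ?mulr0// subSn ?ltnS ?subn_gt0// ltnW.
have coef_rmu0 (x : fps A) : (x * rmu) 0%N = 0.
  by rewrite fps_coefM big_ord1 subn0 mulr0.
(* u = p (1 - r mu) factors 1 - r mu = u / p: the coefficients of p lie in the
   image of N, those of u - 1 in its kernel *)
pose u : fps A := p * (1 - rmu).
have u0 : u 0%N = 1.
  by rewrite /u mulrBr mulr1 fps_coefD fps_coefN coef_rmu0 subr0.
have Nu m : N (u m.+1) = 0.
  rewrite /u mulrBr mulr1 fps_coefD fps_coefN coef_rmu raddfB/= NN.
  by rewrite subrr.
have Np m : N (p m) = p m by case: m => [|m]; rewrite /p/= ?N1 ?NN.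
have [G GE] : exists G, (1 - rmu) * G = 1.
  by apply: fps_inv; rewrite fps_coefD fps_coefN /rmu/= subr0.
have [k kE] := fps_inv u0; have [h hE] := fps_inv p0.
pose a := fps_euler p * h; pose b := fps_euler u * k.
have Na m : N (a m) = a m.
  apply: (@fps_N_quotient p (fps_euler p)) => //.
    by rewrite /a -mulrA (mulrC h) hE mulr1.
  by move=> i; rewrite /fps_euler raddfMn/= Np.
have Nb m : N (b m) = 0.
  apply: (@fps_N0_quotient u (fps_euler u)) => //.
    by rewrite /b -mulrA (mulrC k) kE mulr1.
  by case=> [|i]; rewrite /fps_euler raddfMn/= ?Nu ?mul0rn.
(* a = p'/p and b = u'/u for the Euler operator, and b = a - r mu / (1 - r mu);
   applying N kills b and leaves a = N (r mu / (1 - r mu)) *)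
have abE : b = a - G * fps_euler rmu.
  have -> : G * fps_euler rmu = fps_euler rmu * G by rewrite mulrC.
  have uE : fps_euler u = fps_euler p * (1 - rmu) - p * fps_euler rmu.
    by rewrite /u fps_eulerM fps_eulerD fps_eulerN fps_euler1 add0r mulrN.
  have kp : k = h * G.
    have : u * (h * G) = 1.
      rewrite /u mulrACA hE mul1r GE//.
    by move=> E; rewrite -[LHS]mulr1 -E mulrA (mulrC k) kE mul1r.
  rewrite /b uE kp mulrBl mulrACA GE mulr1; congr (_ - _).
  by rewrite mulrACA hE mul1r.
have Grmu m : (G * fps_euler rmu) m.+1 = mu ^+ m.+1.
  have -> : fps_euler rmu = rmu.
    by apply/funext => -[|[|i]]; rewrite /fps_euler /rmu//= ?mulr0n ?mul0rn.
  rewrite coef_rmu exprSr; congr (_ * _).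
  elim: m => [|m ih].
    have := congr1 (fun f : fps A => f 0%N) GE.
    by rewrite /= mulrC mulrBr mulr1 fps_coefD fps_coefN coef_rmu0 subr0.
  have := congr1 (fun f : fps A => f m.+1) GE.
  rewrite /= mulrC mulrBr mulr1 fps_coefD fps_coefN coef_rmu ih.
  by rewrite exprSr fps_coef1/= => /subr0_eq.
have aE m : a m.+1 = N (mu ^+ m.+1).
  have := Nb m.+1; rewrite abE fps_coefD fps_coefN raddfB/= Na Grmu.
  by move/subr0_eq.
have -> : killed mu n *+ n = (a * p) n.
  by rewrite /a -mulrA (mulrC h) hE mulr1.
rewrite fps_coefM big_ord_recl/= [a 0%N](_ : _ = 0) ?mul0r ?add0r.
  by apply: eq_bigr => i _; rewrite aE.
by rewrite /a fps_coefM big_ord1 /fps_euler mulr0n mul0r.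
Qed.
End spitzer.

(** * Bounded measurable functions and finite measures *)

Section bounded_measurable.
Context d (T : measurableType d) (R : realType).
Implicit Types f g : T -> R.

Definition bounded_measurable f :=
  measurable_fun setT f /\ exists M, forall x, `|f x| <= M.

Lemma bm_cst c : bounded_measurable (cst c).
Proof. by split => //; exists `|c|. Qed.

Lemma bmD f g : bounded_measurable f -> bounded_measurable g ->
  bounded_measurable (f \+ g).
Proof.
move=> [mf [a fa]] [mg [b gb]]; split; first exact: measurable_funD.
by exists (a + b) => x; rewrite (le_trans (ler_normD _ _))// lerD.
Qed.

Lemma bmM f g : bounded_measurable f -> bounded_measurable g ->
  bounded_measurable (f \* g).
Proof.
move=> [mf [a fa]] [mg [b gb]]; split; first exact: measurable_funM.
by exists (a * b) => x; rewrite normrM ler_pM.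
Qed.

Lemma bm_indic (A : set T) : measurable A -> bounded_measurable (\1_A).
Proof.
move=> mA; split => //; exists 1 => x; rewrite indicE.
by case: (x \in A); rewrite ?normr1 ?normr0.
Qed.

Lemma bm_integrable (mu : {finite_measure set T -> \bar R}) f :
  bounded_measurable f -> mu.-integrable setT (EFin \o f).
Proof.
move=> [mf [M fM]]; apply: measurable_bounded_integrable => //.
  by rewrite fin_num_fun_lty//; exact: fin_num_measure.
exists M; split; first by rewrite num_real.
by move=> y My x _; exact: le_trans (fM x) (ltW My).
Qed.

Lemma bm_normr_Rintegral_le (mu : {finite_measure set T -> \bar R}) f M :
  measurable_fun setT f -> (forall x, `|f x| <= M) ->
  `|\int[mu]_x f x| <= M * fine (mu setT).
Proof.
move=> mf fM; have intf : mu.-integrable setT (EFin \o f).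
  by apply: bm_integrable; split => //; exists M.
apply: le_trans (le_normr_Rintegral _ intf) _ => //.
rewrite -Rintegral_cst//; apply: le_Rintegral => //.
  exact: integrable_norm.
by apply: bm_integrable; exact: bm_cst.
Qed.

Lemma EFin_bm_Rintegral (m : {finite_measure set T -> \bar R}) g :
  bounded_measurable g -> (\int[m]_x g x)%:E = (\int[m]_x (g x)%:E)%E.
Proof. by move=> bg; rewrite fineK// integrable_fin_num//; exact: bm_integrable. Qed.
End bounded_measurable.

Lemma bm_comp d1 (T1 : measurableType d1) d2 (T2 : measurableType d2)
    (R : realType) (f : T2 -> R) (h : T1 -> T2) :
  measurable_fun setT h -> bounded_measurable f -> bounded_measurable (f \o h).
Proof.
by move=> mh [mf [M fM]]; split; [exact: measurableT_comp|exists M => x; exact: fM].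
Qed.

(** Finite measures stand for both probabilities and the components of signed
    measures; on them bounded functions are integrable, so iterated integrals of
    bounded functions may be taken in the reals and in any order. *)
Section finite_product.
Context d1 (T1 : measurableType d1) d2 (T2 : measurableType d2) (R : realType).
Variables (mu : {finite_measure set T1 -> \bar R}).
Variables (nu : {finite_measure set T2 -> \bar R}).

Let fin_num_product : fin_num_fun (mu \x nu)%E.
Proof.
move=> A mA; rewrite ge0_fin_numE ?measure_ge0//.
apply: (@le_lt_trans _ _ ((mu \x nu)%E setT)).
  by apply: le_measure; rewrite ?inE.
rewrite -setXTT product_measure1E// lte_mul_pinfty// ?fin_num_measure//.
by rewrite fin_num_fun_lty//; exact: fin_num_measure.
Qed.

Definition finite_product : {finite_measure set (T1 * T2)%type -> \bar R} :=
  HB.pack (product_measure1 mu nu)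
    (Measure_isFinite.Build _ _ _ (product_measure1 mu nu) fin_num_product).
End finite_product.

Section bm_sections.
Context d1 (T1 : measurableType d1) d2 (T2 : measurableType d2) (R : realType).
Variables (mu : {finite_measure set T1 -> \bar R}).
Variables (nu : {finite_measure set T2 -> \bar R}).
Variable f : T1 * T2 -> R.
Hypothesis bf : bounded_measurable f.

Lemma bm_section1 y : bounded_measurable (fun x => f (x, y)).
Proof. by have := bm_comp (@pair2_measurable _ _ _ _ y) bf. Qed.

Lemma bm_section2 x : bounded_measurable (fun y => f (x, y)).
Proof. by have := bm_comp (@pair1_measurable _ _ _ _ x) bf. Qed.

Lemma bm_Rintegral2 : bounded_measurable (fun x => \int[nu]_y f (x, y)).
Proof.
have [mf [M fM]] := bf; split; last first.
  exists (M * fine (nu setT)) => x; apply: bm_normr_Rintegral_le => //.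
  by have [] := bm_section2 x.
have := measurable_fubini_F (bm_integrable (finite_product mu nu) bf).
by move=> mF; apply: measurableT_comp mF.
Qed.

Lemma bm_Rintegral1 : bounded_measurable (fun y => \int[mu]_x f (x, y)).
Proof.
have [mf [M fM]] := bf; split; last first.
  exists (M * fine (mu setT)) => y; apply: bm_normr_Rintegral_le => //.
  by have [] := bm_section1 y.
have := measurable_fubini_G (bm_integrable (finite_product mu nu) bf).
by move=> mF; apply: measurableT_comp mF.
Qed.

Lemma bm_fubini : \int[mu]_x \int[nu]_y f (x, y) = \int[nu]_y \int[mu]_x f (x, y).
Proof.
apply: EFin_inj; rewrite !EFin_bm_Rintegral; [|exact: bm_Rintegral1|exact: bm_Rintegral2].
under eq_integral do (rewrite EFin_bm_Rintegral; last exact: bm_section2).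
under [RHS]eq_integral do (rewrite EFin_bm_Rintegral; last exact: bm_section1).
exact: (Fubini (bm_integrable (finite_product mu nu) bf)).
Qed.

Lemma bm_product : \int[(mu \x nu)%E]_z f z = \int[mu]_x \int[nu]_y f (x, y).
Proof.
apply: EFin_inj; rewrite (EFin_bm_Rintegral (finite_product mu nu))// EFin_bm_Rintegral; last first.
  exact: bm_Rintegral2.
under [RHS]eq_integral do (rewrite EFin_bm_Rintegral; last exact: bm_section2).
exact/esym/(integral12_prod_meas1 (bm_integrable (finite_product mu nu) bf)).
Qed.

End bm_sections.

Lemma finite_pushforward d1 (T1 : measurableType d1) d2 (T2 : measurableType d2)
    (R : realType) (mu : {finite_measure set T1 -> \bar R}) (phi : T1 -> T2) :
  measurable_fun setT phi -> exists rho : {finite_measure set T2 -> \bar R},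
  forall f : T2 -> R, bounded_measurable f ->
  \int[rho]_x f x = \int[mu]_x f (phi x).
Proof.
move=> mphi.
pose rho0 : {measure set T2 -> \bar R} := pushforward mu phi.
pose rho := rho0 mphi.
have frho : fin_num_fun rho.
  by move=> A mA; apply: fin_num_measure; rewrite -[X in measurable X]setTI; exact: (mphi measurableT).
pose rho' : {finite_measure set T2 -> \bar R} :=
  HB.pack (Measure.sort rho) (Measure_isFinite.Build _ _ _ rho frho).
exists rho' => f bf.
rewrite /Rintegral; congr fine.
rewrite [LHS](@integral_pushforward _ _ _ _ _ _ mphi)//.
- by case: bf => mf _; exact/measurable_EFinP.
- exact: bm_integrable (bm_comp mphi bf).
Qed.

Section convolution.
Variable R : realType.
Let finmeas := {finite_measure set (measurableTypeR R) -> \bar R}.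

Let add2 (z : measurableTypeR R * measurableTypeR R) : measurableTypeR R := z.1 + z.2.
Let madd2 : measurable_fun setT add2.
Proof. exact: measurable_funD. Qed.

Lemma bm_addx (f : measurableTypeR R -> R) : bounded_measurable f ->
  bounded_measurable (fun z : measurableTypeR R * measurableTypeR R => f (z.1 + z.2)).
Proof. exact: (bm_comp madd2). Qed.

(** The convolution is the image of the product measure under addition; it is only
    used through the integrals of bounded functions, which is what is recorded. *)
Lemma convolution_ex (mu nu : finmeas) : exists rho : finmeas,
  forall f : measurableTypeR R -> R, bounded_measurable f ->
  \int[rho]_x f x = \int[mu]_x \int[nu]_y f (x + y).
Proof.
have [rho rhoE] := finite_pushforward (finite_product mu nu) madd2.
exists rho => f bf; rewrite rhoE//.
exact: (bm_product mu nu (bm_addx bf)).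
Qed.
End convolution.

(** * The convolution ring of finite signed measures on the line *)

Section signed_functionals.
Variable R : realType.
Notation Rm := (measurableTypeR R).
Let finmeas := {finite_measure set Rm -> \bar R}.
Implicit Types (f g : Rm -> R) (s t : seq (R * finmeas)).

(** A signed measure is represented by its integrals of bounded measurable
    functions, that is, by a functional on all functions that is a finite linear
    combination of integrals on the bounded measurable ones. The value [0]
    elsewhere makes two signed measures with the same integrals equal
    ([smeas_ext]), so that they form a ring for Leibniz equality. *)
Definition combination s f : R :=
  if `[< bounded_measurable f >] then \sum_(c <- s) c.1 * \int[c.2]_x f x else 0.

Record signed_measure := SignedMeasure {
  smeas_val :> (Rm -> R) -> R ;
  smeas_combination : exists s, smeas_val = combination s }.
Implicit Types m n : signed_measure.

Lemma smeas_ext m n : (forall f, bounded_measurable f -> m f = n f) -> m = n.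
Proof.
case: m n => [m pm] [n pn] /= mn.
suff E : m = n by subst m; rewrite (Prop_irrelevance pm pn).
have [s ms] := pm; have [t nt] := pn; apply/funext => f; have [bf|bf] := pselect (bounded_measurable f); first exact: mn.
by rewrite ms nt /combination (asboolF bf).
Qed.

Lemma combinationE s f : bounded_measurable f ->
  combination s f = \sum_(c <- s) c.1 * \int[c.2]_x f x.
Proof. by move=> bf; rewrite /combination asboolT. Qed.

Lemma smeasD m f g : bounded_measurable f -> bounded_measurable g ->
  m (f \+ g) = m f + m g.
Proof.
move=> bf bg; have [s ->] := smeas_combination m.
rewrite !combinationE//; last exact: bmD.
rewrite -big_split/=; apply: eq_bigr => c _; rewrite -mulrDr.
by rewrite RintegralD//; exact: bm_integrable.
Qed.

Lemma smeasZ m k f : bounded_measurable f -> m (fun x => k * f x) = k * m f.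
Proof.
move=> bf; have [s ->] := smeas_combination m.
have bkf : bounded_measurable (fun x => k * f x) by exact: bmM (bm_cst _ k) bf.
rewrite !combinationE// mulr_sumr; apply: eq_bigr => c _.
by rewrite RintegralZl//; [rewrite mulrCA|exact: bm_integrable].
Qed.

Lemma smeas_cst m k : m (cst k) = k * m (cst 1).
Proof.
rewrite -smeasZ; last exact: bm_cst.
by congr (smeas_val m); apply/funext => x; rewrite mulr1.
Qed.

Lemma smeas_bm2 m (f : Rm * Rm -> R) : bounded_measurable f ->
  bounded_measurable (fun x => m (fun y => f (x, y))).
Proof.
move=> bf; have [s ->] := smeas_combination m.
under eq_fun do (rewrite combinationE; last exact: bm_section2).
elim: s => [|c s ih].
  by under eq_fun do rewrite big_nil; exact: bm_cst.
under eq_fun do rewrite big_cons; apply: bmD ih; apply: bmM; first exact: bm_cst.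
exact: (bm_Rintegral2 c.2 c.2 bf).
Qed.

Lemma Rintegral_combination (r : seq (R * finmeas)) (c : finmeas)
    (g : finmeas -> Rm -> R) : (forall e, bounded_measurable (g e)) ->
  \int[c]_x (\sum_(e <- r) e.1 * g e.2 x) = \sum_(e <- r) e.1 * \int[c]_x g e.2 x.
Proof.
move=> bg; have H : bounded_measurable (fun x => \sum_(e <- r) e.1 * g e.2 x) /\
  \int[c]_x (\sum_(e <- r) e.1 * g e.2 x) = \sum_(e <- r) e.1 * \int[c]_x g e.2 x.
  elim: r => [|e r [ih1 ih2]].
    split; first by under eq_fun do rewrite big_nil; exact: bm_cst.
    under eq_Rintegral do rewrite big_nil; rewrite big_nil.
    by rewrite Rintegral_cst// mul0r.
  have be : bounded_measurable (fun x => e.1 * g e.2 x).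
    exact: bmM (bm_cst _ _) (bg _).
  split; first by under eq_fun do rewrite big_cons; exact: bmD.
  under eq_Rintegral do rewrite big_cons; rewrite big_cons RintegralD//.
  - by rewrite ih2 RintegralZl//; exact: bm_integrable.
  - exact: (bm_integrable c be).
  - exact: (bm_integrable c ih1).
by case: H.
Qed.

(** Fubini's theorem extends by bilinearity from finite measures to signed ones; it
    is the commutativity of convolution. *)
Lemma smeas_fubini m n (f : Rm * Rm -> R) : bounded_measurable f ->
  m (fun x => n (fun y => f (x, y))) = n (fun y => m (fun x => f (x, y))).
Proof.
move=> bf; have swapm : measurable_fun [set: Rm * Rm] (fun z => (z.2, z.1)).
  by apply: measurable_fun_pair; [exact: measurable_snd|exact: measurable_fst].
have b1 := smeas_bm2 n bf; have b2 := smeas_bm2 m (bm_comp swapm bf).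
have [s ms] := smeas_combination m; have [t nt] := smeas_combination n.
move: b1 b2; rewrite ms nt => b1 b2; rewrite !combinationE//.
under eq_bigr => c _.
  under eq_Rintegral do (rewrite combinationE; last exact: bm_section2).
  over.
under [RHS]eq_bigr => c _.
  under eq_Rintegral do (rewrite combinationE; last exact: bm_section1).
  over.
under eq_bigr => c _.
  rewrite (Rintegral_combination t c.2 (g := fun e x => \int[e]_y f (x, y))); last first.
    by move=> e; exact: (bm_Rintegral2 c.2 e bf).
  rewrite mulr_sumr; over.
rewrite exchange_big/=; apply: eq_bigr => e _.
rewrite (Rintegral_combination s e.2 (g := fun c y => \int[c]_x f (x, y))); last first.
  by move=> c; exact: (bm_Rintegral1 c e.2 bf).
rewrite mulr_sumr; apply: eq_bigr => c _.
by rewrite mulrCA (bm_fubini c.2 e.2 bf).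
Qed.

Lemma smeas_add_subproof m n : exists s, (fun f => m f + n f) = combination s.
Proof.
have [s ->] := smeas_combination m; have [t ->] := smeas_combination n.
exists (s ++ t); apply/funext => f.
by rewrite /= /combination; case: asboolP => _; rewrite ?addr0// big_cat.
Qed.
Definition smeas_add m n := SignedMeasure (smeas_add_subproof m n).

Lemma smeas_opp_subproof m : exists s, (fun f => - m f) = combination s.
Proof.
have [s ->] := smeas_combination m; exists [seq (- c.1, c.2) | c <- s]; apply/funext => f.
rewrite /= /combination; case: asboolP => _; rewrite ?oppr0// big_map -sumrN.
by apply: eq_bigr => c _; rewrite mulNr.
Qed.
Definition smeas_opp m := SignedMeasure (smeas_opp_subproof m).

Lemma smeas_zero_subproof : exists s, (fun=> 0) = combination s.
Proof. by exists [::]; apply/funext => f; rewrite /combination big_nil if_same. Qed.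
Definition smeas_zero := SignedMeasure smeas_zero_subproof.

Lemma smeas_measure_subproof (k : R) (mu : finmeas) :
  exists s, (fun f => if `[< bounded_measurable f >] then k * \int[mu]_x f x else 0)
    = combination s.
Proof.
exists [:: (k, mu)]; apply/funext => f.
by rewrite /combination; case: asboolP => // _; rewrite big_seq1.
Qed.
Definition smeas_measure k mu := SignedMeasure (smeas_measure_subproof k mu).

Lemma smeas_measureE k mu f : bounded_measurable f ->
  smeas_measure k mu f = k * \int[mu]_x f x.
Proof. by move=> bf; rewrite /= asboolT. Qed.

Definition smeas_one := smeas_measure 1 (\d_(0 : Rm)).

Lemma smeas_oneE f : bounded_measurable f -> smeas_one f = f 0.
Proof.
move=> bf; rewrite /smeas_one smeas_measureE// mul1r /Rintegral integral_dirac//.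
  by rewrite diracT mul1e.
by case: bf => mf _; exact/measurable_EFinP.
Qed.

Lemma smeas_mul_subproof m n : exists s,
  (fun f => if `[< bounded_measurable f >] then m (fun x => n (fun y => f (x + y))) else 0)
  = combination s.
Proof.
have [s ms] := smeas_combination m; have [t nt] := smeas_combination n.
pose conv (c e : finmeas) := sval (cid (convolution_ex c e)).
exists [seq (c.1 * e.1, conv c.2 e.2) | c <- s, e <- t].
apply/funext => f; rewrite /combination; case: asboolP => // bf.
have bfa := bm_addx bf.
rewrite big_allpairs_dep/= ms combinationE; last exact: (smeas_bm2 n bfa).
apply: eq_bigr => c _.
under eq_Rintegral do (rewrite nt combinationE; last exact: (bm_section2 bfa)).
under [RHS]eq_bigr do rewrite -mulrA.
rewrite -mulr_sumr; congr (_ * _).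
rewrite (Rintegral_combination t c.2 (g := fun e x => \int[e]_y f (x + y))).
  apply: eq_bigr => e _; congr (_ * _).
  by rewrite /conv; case: cid => rho /= ->.
by move=> e; exact: (bm_Rintegral2 c.2 e bfa).
Qed.
Definition smeas_mul m n := SignedMeasure (smeas_mul_subproof m n).

Lemma smeas_mulE m n f : bounded_measurable f ->
  smeas_mul m n f = m (fun x => n (fun y => f (x + y))).
Proof. by move=> bf; rewrite /= asboolT. Qed.

Lemma bm_shift (x : Rm) f : bounded_measurable f ->
  bounded_measurable (fun y : Rm => f (x + y)).
Proof. by move/bm_addx => bfa; exact: (bm_section2 bfa). Qed.

Lemma smeas_bm_shift m f : bounded_measurable f ->
  bounded_measurable (fun x : Rm => m (fun y => f (x + y))).
Proof. by move/bm_addx => bfa; exact: (smeas_bm2 m bfa). Qed.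

Lemma smeas_mulC : commutative smeas_mul.
Proof.
move=> m n; apply: smeas_ext => f bf; rewrite !smeas_mulE//.
rewrite (smeas_fubini m n (bm_addx bf)); congr (smeas_val n).
by apply/funext => x; congr (smeas_val m); apply/funext => y; rewrite addrC.
Qed.

Lemma smeas_mulA : associative smeas_mul.
Proof.
move=> m n p; apply: smeas_ext => f bf; rewrite !smeas_mulE//; last exact: smeas_bm_shift.
congr (smeas_val m); apply/funext => x; rewrite smeas_mulE; last exact: bm_shift.
congr (smeas_val n); apply/funext => y; congr (smeas_val p).
by apply/funext => z; rewrite addrA.
Qed.

Lemma smeas_mul1 : left_id smeas_one smeas_mul.
Proof.
move=> m; apply: smeas_ext => f bf; rewrite smeas_mulE// smeas_oneE; last exact: smeas_bm_shift.
by congr (smeas_val m); apply/funext => x; rewrite add0r.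
Qed.

Lemma smeas_mulDl : left_distributive smeas_mul smeas_add.
Proof. by move=> m n p; apply: smeas_ext => f bf; rewrite /= !asboolT. Qed.

Lemma smeas_addA : associative smeas_add.
Proof. by move=> m n p; apply: smeas_ext => f _; exact: addrA. Qed.
Lemma smeas_addC : commutative smeas_add.
Proof. by move=> m n; apply: smeas_ext => f _; exact: addrC. Qed.
Lemma smeas_add0 : left_id smeas_zero smeas_add.
Proof. by move=> m; apply: smeas_ext => f _; exact: add0r. Qed.
Lemma smeas_addN : left_inverse smeas_zero smeas_opp smeas_add.
Proof. by move=> m; apply: smeas_ext => f _; exact: addNr. Qed.

HB.instance Definition _ := gen_eqMixin signed_measure.
HB.instance Definition _ := gen_choiceMixin signed_measure.
HB.instance Definition _ := GRing.isZmodule.Build signed_measure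
  smeas_addA smeas_addC smeas_add0 smeas_addN.
HB.instance Definition _ := GRing.Zmodule_isComPzRing.Build signed_measure
  smeas_mulA smeas_mulC smeas_mul1 smeas_mulDl.

Let nonpos : set Rm := [set x | x <= 0].
Let mnonpos : measurable nonpos.
Proof. by rewrite (_ : nonpos = `]-oo, 0]%classic) //; apply/seteqP; split=> x; rewrite /= in_itv. Qed.

Lemma Rintegral_mrestr (mu : finmeas) f : bounded_measurable f ->
  \int[mrestr mu mnonpos]_x f x = \int[mu]_x (f \* \1_nonpos) x.
Proof.
move=> bf; rewrite /Rintegral; congr fine.
rewrite (negligible_integral (measurableC mnonpos) measurableT); first last.
- by rewrite /mrestr; transitivity (mu set0); [congr (mu _); rewrite setICl|rewrite measure0].
- exact: (bm_integrable (mrestr mu mnonpos)).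
rewrite setTD setCK (eq_measure_integral mu); last first.
  by move=> A mA An; rewrite /= /mrestr setIidl.
rewrite integral_mkcond; apply: eq_integral => x _.
by rewrite /= patchE indicE; case: ifPn => xA; rewrite ?mulr1 ?mulr0.
Qed.

(** Restriction to [x <= 0]. It is an admissible projection for Spitzer's identity
    because both [x <= 0] and its complement [x > 0] are closed under addition:
    measures carried by either half line form a set closed under convolution
    ([smeas_restr_mul], [smeas_restr0_mul]). *)
Lemma smeas_restr_subproof m : exists s,
  (fun f => if `[< bounded_measurable f >] then m (f \* \1_nonpos) else 0)
  = combination s.
Proof.
have [s ms] := smeas_combination m.
exists [seq (c.1, [the finmeas of mrestr c.2 mnonpos]) | c : R * finmeas <- s].
apply/funext => f; rewrite /combination; case: asboolP => // bf.
rewrite ms combinationE; last exact: bmM (bm_indic _ mnonpos).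
rewrite big_map; apply: eq_bigr => c _; congr (_ * _) => /=.
by rewrite -Rintegral_mrestr.
Qed.
Definition smeas_restr m := SignedMeasure (smeas_restr_subproof m).

Lemma smeas_restrE m f : bounded_measurable f ->
  smeas_restr m f = m (f \* \1_nonpos).
Proof. by move=> bf; rewrite /= asboolT. Qed.

Lemma bm_nonpos f : bounded_measurable f -> bounded_measurable (f \* \1_nonpos).
Proof. by move=> bf; exact: bmM (bm_indic _ mnonpos). Qed.

Lemma smeas_restr_is_zmod_morphism : zmod_morphism smeas_restr.
Proof.
move=> m n; apply: smeas_ext => f bf.
have addE (a b : signed_measure) g : (a - b) g = a g - b g by [].
by rewrite addE !smeas_restrE.
Qed.
HB.instance Definition _ := GRing.isZmodMorphism.Build _ _ smeas_restr
  smeas_restr_is_zmod_morphism.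

Lemma smeas_restr1 : smeas_restr 1 = 1.
Proof.
apply: smeas_ext => f bf; rewrite smeas_restrE//.
have oneE : (1 : signed_measure) = smeas_one by [].
rewrite oneE !smeas_oneE//; last exact: bm_nonpos.
by rewrite /= indicE mem_set ?mulr1//= /nonpos/=.
Qed.

Lemma smeas_restr_idem m : smeas_restr (smeas_restr m) = smeas_restr m.
Proof.
apply: smeas_ext => f bf; rewrite !smeas_restrE//; last exact: bm_nonpos.
congr (smeas_val m); apply/funext => x /=; rewrite indicE.
by case: (x \in _); rewrite ?mulr1 ?mulr0.
Qed.

Let mulE (m n : signed_measure) : m * n = smeas_mul m n. Proof. by []. Qed.

Lemma smeas_restr_mul m n : smeas_restr m = m -> smeas_restr n = n ->
  smeas_restr (m * n) = m * n.
Proof.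
move=> mN nN; apply: smeas_ext => f bf; rewrite smeas_restrE// mulE !smeas_mulE//; last exact: bm_nonpos.
rewrite -mN !smeas_restrE; [|exact: smeas_bm_shift|exact: (smeas_bm_shift _ (bm_nonpos bf))].
congr (smeas_val m); apply/funext => x /=; rewrite !indicE.
have [|] := boolP (x \in nonpos); rewrite ?mulr0// inE /nonpos/= => x0.
rewrite -nN !smeas_restrE; [|exact: bm_shift|exact: (bm_shift x (bm_nonpos bf))].
congr (_ * _); congr (smeas_val n); apply/funext => y /=; rewrite !indicE.
have [|] := boolP (y \in nonpos); rewrite ?mulr0// inE /nonpos/= => y0.
by rewrite mem_set ?mulr1//=; lra.
Qed.

Lemma smeas_restr_eq0 m f : smeas_restr m = 0 -> bounded_measurable f ->
  m f = m (fun x => (1 - \1_nonpos x) * f x).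
Proof.
move=> m0 bf; have bfN := bm_nonpos bf.
have bb : bounded_measurable (fun x => (1 - \1_nonpos x) * f x).
  apply: bmM bf; rewrite (_ : (fun x => _) = cst 1 \+ (cst (-1) \* \1_nonpos)).
    by apply: bmD; [exact: bm_cst|apply: bmM; [exact: bm_cst|exact: bm_indic]].
  by apply/funext => x /=; rewrite mulN1r.
have -> : f = (fun x => (1 - \1_nonpos x) * f x) \+ (f \* \1_nonpos).
  by apply/funext => x /=; ring.
rewrite smeasD// [X in _ + X](_ : _ = 0) ?addr0.
  congr (smeas_val m); apply/funext => x /=.
  by rewrite indicE; case: (x \in _); ring.
by rewrite -smeas_restrE// m0.
Qed.

Lemma smeas_restr0_mul m n : smeas_restr m = 0 -> smeas_restr n = 0 ->
  smeas_restr (m * n) = 0.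
Proof.
move=> m0 n0; apply: smeas_ext => f bf.
rewrite smeas_restrE// mulE smeas_mulE; last exact: bm_nonpos.
rewrite (smeas_restr_eq0 m0); last exact: (smeas_bm_shift _ (bm_nonpos bf)).
transitivity (m (cst 0)); last by rewrite smeas_cst mul0r.
congr (smeas_val m); apply/funext => x /=; rewrite !indicE.
have [|] := boolP (x \in nonpos); rewrite ?subrr ?mul0r// notin_setE /nonpos/= => /negP.
rewrite -ltNge => x0.
rewrite (smeas_restr_eq0 n0); last exact: (bm_shift x (bm_nonpos bf)).
rewrite [X in _ * X](_ : _ = n (cst 0)); first by rewrite smeas_cst mul0r mulr0.
congr (smeas_val n); apply/funext => y /=; rewrite !indicE.
have [|] := boolP (y \in nonpos); rewrite ?subrr ?mul0r// notin_setE /nonpos/= => /negP.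
rewrite -ltNge => y0; rewrite memNset ?mulr0//=.
by apply/negP; rewrite -ltNge addr_gt0.
Qed.

Definition mass m : R := m (cst 1).

Lemma massM m n : mass (m * n) = mass m * mass n.
Proof.
rewrite /mass mulE smeas_mulE; last exact: bm_cst.
by rewrite (smeas_cst m (n (cst 1))) mulrC.
Qed.

Lemma mass1 : mass 1 = 1.
Proof.
rewrite /mass (_ : 1 = smeas_one)// smeas_oneE//; exact: bm_cst.
Qed.

Lemma massMn m k : mass (m *+ k) = mass m *+ k.
Proof. by elim: k => [//|k ih]; rewrite !mulrS -ih. Qed.

Lemma mass_sum I (r : seq I) (P : pred I) (F : I -> signed_measure) :
  mass (\sum_(i <- r | P i) F i) = \sum_(i <- r | P i) mass (F i).
Proof. exact: (big_morph mass (id1 := 0) (op1 := +%R)). Qed.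

Theorem spitzer_mass (m : signed_measure) (n : nat) :
  mass (killed smeas_restr m n) *+ n = \sum_(k < n)
    (m ^+ k.+1) \1_nonpos * mass (killed smeas_restr m (n - k.+1)%N).
Proof.
rewrite -massMn (spitzer smeas_restr1 smeas_restr_idem smeas_restr_mul smeas_restr0_mul).
rewrite mass_sum; apply: eq_bigr => k _; rewrite massM; congr (_ * _).
rewrite /mass smeas_restrE; last exact: bm_cst.
by congr (smeas_val _); apply/funext => x /=; rewrite mul1r.
Qed.
End signed_functionals.

(** * The exponential formula for nonnegative power series *)

Section exponential_formula.
Variable R : realType.
Implicit Types x y g : fps R.

Lemma fps_ge0M x y : (forall n, 0 <= x n) -> (forall n, 0 <= y n) ->
  forall n, 0 <= (x * y) n.
Proof. by move=> x0 y0 n; apply: sumr_ge0 => i _; exact: mulr_ge0. Qed.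

Lemma fps_ge0X x k : (forall n, 0 <= x n) -> forall n, 0 <= (x ^+ k) n.
Proof.
move=> x0; elim: k => [|k ih] n; first by rewrite expr0 fps_coef1 ler0n.
by rewrite exprS; exact: fps_ge0M.
Qed.

Lemma fps_mul_widen x y M n : (n < M)%N ->
  (x * y) n = \sum_(i < M) \sum_(j < M | (i + j == n)%N) x i * y j.
Proof.
move=> nM; rewrite fps_coefM (big_ord_widen_cond _ xpredT (fun i => x i * y (n - i)%N) nM).
rewrite big_mkcond/=; apply: eq_bigr => i _; case: ifPn => [iM|].
  have jM : (n - i < M)%N by exact: leq_ltn_trans (leq_subr _ _) nM.
  rewrite (big_pred1 (Ordinal jM))// => j /=.
  by rewrite -val_eqE/= -[RHS](eqn_add2l i) subnKC.
rewrite -leqNgt => ni; rewrite big_pred0// => j.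
by apply/negbTE; rewrite gtn_eqF// (leq_trans ni)// leq_addr.
Qed.

(** The partial sums of a product are sums over the triangle [i + j < L]. The
    triangle lies in the square of side [L], and the one of side [M + K] contains
    the rectangle [M x K]; for nonnegative coefficients this squeezes the partial
    sums of products, hence of powers, between products of partial sums. *)
Lemma fps_sumM x y L :
  \sum_(n < L) (x * y) n =
  \sum_(i < L) \sum_(j < L | (i + j < L)%N) x i * y j.
Proof.
under eq_bigr => n _ do rewrite (fps_mul_widen _ _ (ltn_ord n)).
rewrite exchange_big/=; apply: eq_bigr => i _.
rewrite (exchange_big_dep xpredT)//= [RHS]big_mkcond/=; apply: eq_bigr => j _.
have [ijM|Mij] := ltnP (i + j) L.
  by rewrite (big_pred1 (Ordinal ijM))// => k; rewrite -val_eqE/= eq_sym.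
rewrite big_pred0// => k; apply/negbTE.
by rewrite gtn_eqF// (leq_trans _ Mij).
Qed.

Lemma fps_sum_mul_le x y M : (forall n, 0 <= x n) -> (forall n, 0 <= y n) ->
  \sum_(n < M) (x * y) n <= (\sum_(n < M) x n) * (\sum_(n < M) y n).
Proof.
move=> x0 y0; rewrite fps_sumM mulr_suml; apply: ler_sum => i _.
rewrite mulr_sumr big_mkcond/=; apply: ler_sum => j _.
by case: ifP => // _; exact: mulr_ge0.
Qed.

Lemma fps_sum_mul_ge x y M K : (forall n, 0 <= x n) -> (forall n, 0 <= y n) ->
  (\sum_(n < M) x n) * (\sum_(n < K) y n) <= \sum_(n < M + K) (x * y) n.
Proof.
move=> x0 y0; rewrite fps_sumM (big_ord_widen _ x (leq_addr K M)).
rewrite (big_ord_widen _ y (leq_addl M K)) mulr_suml big_mkcond/=.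
apply: ler_sum => i _; case: ifPn => [iM|_]; last first.
  by apply: sumr_ge0 => j _; exact: mulr_ge0.
rewrite mulr_sumr [leLHS]big_mkcond/= [leRHS]big_mkcond/=; apply: ler_sum => j _.
case: ifPn => [jK|_]; last by case: ifP => // _; exact: mulr_ge0.
by rewrite (leq_trans (n := M + j))// ?ltn_add2r// leq_add2l ltnW.
Qed.

Lemma fps_sum_exp_le x k M : (forall n, 0 <= x n) ->
  \sum_(n < M) (x ^+ k) n <= (\sum_(n < M) x n) ^+ k.
Proof.
move=> x0; elim: k => [|k ih].
  rewrite !expr0; case: M => [|M]; first by rewrite big_ord0.
  by rewrite big_ord_recl/= big1 ?addr0.
rewrite exprS (le_trans (fps_sum_mul_le _ x0 (fps_ge0X _ x0)))// exprS.
by rewrite ler_wpM2l// sumr_ge0.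
Qed.

Lemma fps_sum_exp_ge x k M : (forall n, 0 <= x n) ->
  (\sum_(n < M) x n) ^+ k <= \sum_(n < (k * M).+1) (x ^+ k) n.
Proof.
move=> x0; elim: k => [|k ih]; first by rewrite !expr0 mul0n big_ord1.
rewrite !exprS mulSn -addnS.
apply: le_trans (fps_sum_mul_ge _ _ x0 (fps_ge0X _ x0)).
by rewrite ler_wpM2l// sumr_ge0.
Qed.

Lemma fps_eulerX x k : fps_euler (x ^+ k.+1) = (fps_euler x * x ^+ k) *+ k.+1.
Proof.
elim: k => [|k ih]; first by rewrite expr1 expr0 mulr1 mulr1n.
rewrite exprS fps_eulerM ih [RHS]mulrS exprS; congr (_ + _).
by rewrite mulrnAr mulrCA.
Qed.

(** The exponential of a series without constant term, so that only the powers
    [k <= n] contribute in degree [n]. *)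
Definition fps_exp x : fps R := fun n => \sum_(k < n.+1) k`!%:R^-1 * (x ^+ k) n.

Lemma fps_exp_widen x n m : x 0%N = 0 -> (n < m)%N ->
  fps_exp x n = \sum_(k < m) k`!%:R^-1 * (x ^+ k) n.
Proof.
move=> x0 nm; rewrite /fps_exp (big_ord_widen _ (fun k => k`!%:R^-1 * (x ^+ k) n) nm).
rewrite big_mkcond/=; apply: eq_bigr => k _; case: ifPn => //.
by rewrite -ltnNge ltnS => nk; rewrite fps_expn_low// mulr0.
Qed.

Lemma fps_euler_exp x : x 0%N = 0 ->
  fps_euler (fps_exp x) = fps_euler x * fps_exp x.
Proof.
move=> x0; apply/funext => n; rewrite fps_coefM {1}/fps_euler.
rewrite (fps_exp_widen x0 (ltnW (ltnSn n.+1))) -sumrMnl.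
rewrite big_ord_recl/= expr0 fps_coef1.
rewrite [X in X + _](_ : _ = 0); last by case: n => [|n]; rewrite ?mulr0n//= mulr0 mul0rn.
rewrite add0r.
under [RHS]eq_bigr => i _.
  rewrite (fps_exp_widen x0 (_ : _ < n.+1)%N); last by rewrite ltnS leq_subr.
  rewrite mulr_sumr; over.
rewrite exchange_big/=; apply: eq_bigr => k _.
transitivity ((k.+1)`!%:R^-1 * fps_euler (x ^+ k.+1) n).
  by rewrite /fps_euler mulrnAr.
rewrite fps_eulerX.
have -> (z : fps R) : (z *+ k.+1) n = z n *+ k.+1.
  by elim: k.+1 => [//|j ih]; rewrite !mulrS fps_coefD ih.
rewrite fps_coefM factS natrM invfM -[(\sum_(_ < _) _) *+ _]mulr_natl mulrA.
rewrite [X in X * _](_ : _ = k`!%:R^-1); last first.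
  by rewrite mulrC mulrA divff ?mul1r// pnatr_eq0.
by rewrite mulr_sumr; apply: eq_bigr => i _; rewrite mulrCA.
Qed.

(** The recursion says that [a] solves the differential equation [D a = (D x) a] with
    [D] the Euler operator, like [exp x]; it determines [a n] from the previous
    coefficients. *)
Lemma fps_exp_unique (a c : nat -> R) : a 0%N = 1 ->
  (forall n, a n *+ n = \sum_(k < n) c k.+1 * a (n - k.+1)%N) ->
  a = fps_exp (fun n => c n / n%:R).
Proof.
move=> a0 aE; set x : fps R := fun n => _.
have x0 : x 0%N = 0 by rewrite /x invr0 mulr0.
have DxE n : fps_euler x n.+1 = c n.+1.
  by rewrite /fps_euler /x -[LHS]mulr_natr divfK// pnatr_eq0.
apply/funext => n; elim/ltn_ind: n => -[_|n ih].
  by rewrite a0 /fps_exp big_ord1 expr0 fps_coef1 fact0 invr1 mulr1.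
apply: (@mulIf _ n.+1%:R); first by rewrite pnatr_eq0.
rewrite !mulr_natr aE -/(fps_euler (fps_exp x) n.+1) fps_euler_exp// fps_coefM.
rewrite [RHS]big_ord_recl [X in _ = X + _](_ : _ = 0) ?add0r; last first.
  by rewrite /fps_euler mulr0n mul0r.
rewrite /=.
apply: eq_bigr => k _; rewrite DxE ih//.
by rewrite ltn_subLR// addSn ltnS leq_addl.
Qed.

(** Formally [sum a = exp (sum c_n / n)] by [fps_exp_unique]. All coefficients are
    nonnegative, so the partial sums of [a] are bounded by those of
    [sum_k g^k / k!], and conversely dominate each finite part of that sum once
    enough terms are taken. *)
Theorem exponential_formula (a c : nat -> R) (g : R) : a 0%N = 1 ->
  (forall n, 0 <= c n) ->
  (forall n, a n *+ n = \sum_(k < n) c k.+1 * a (n - k.+1)%N) ->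
  series (fun n => c n / n%:R) @ \oo --> g ->
  series a @ \oo --> expR g.
Proof.
move=> a0 c0 aE; set x : fps R := fun n => _ => xg.
have aexp : a = fps_exp x by exact: fps_exp_unique.
have x00 : x 0%N = 0 by rewrite /x invr0 mulr0.
have x0 n : 0 <= x n by rewrite divr_ge0.
have ap n : 0 <= a n.
  rewrite aexp; apply: sumr_ge0 => k _.
  by rewrite mulr_ge0 ?invr_ge0//; exact: fps_ge0X.
have nd_sum (f : nat -> R) : (forall n, 0 <= f n) ->
    nondecreasing_seq (series f).
  by move=> f0; apply/nondecreasing_series => n _ _.
have xM M : \sum_(n < M) x n <= g.
  rewrite -(big_mkord xpredT) -(cvg_lim _ xg)//.
  by apply: nondecreasing_cvgn_le; [exact: nd_sum|apply/cvg_ex; exists g].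
have g0 : 0 <= g by apply: le_trans (xM 0%N); rewrite big_ord0.
have exp_ub J : \sum_(k < J) k`!%:R^-1 * g ^+ k <= expR g.
  rewrite -(big_mkord xpredT (fun k => k`!%:R^-1 * g ^+ k)).
  rewrite (eq_bigr (exp_coeff g)); last by move=> k _; rewrite /exp_coeff mulrC.
  apply: (@nondecreasing_cvgn_le _ (series (exp_coeff g))).
    by apply: nd_sum => n; rewrite exp_coeff_ge0.
  exact: is_cvg_series_exp_coeff.
have sumaE M : series a M =
    \sum_(k < M) k`!%:R^-1 * \sum_(n < M) (x ^+ k) n.
  rewrite /series/= big_mkord.
  transitivity (\sum_(n < M) \sum_(k < M) k`!%:R^-1 * (x ^+ k) n).
    by apply: eq_bigr => n _; rewrite aexp; exact: fps_exp_widen x00 (ltn_ord n).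
  by rewrite exchange_big/=; apply: eq_bigr => k _; rewrite mulr_sumr.
have aub M : series a M <= expR g.
  rewrite sumaE; apply: le_trans (exp_ub M); apply: ler_sum => k _.
  rewrite ler_wpM2l ?invr_ge0//; apply: le_trans (fps_sum_exp_le _ _ x0) _.
  by rewrite lerXn2r// nnegrE sumr_ge0.
have acvg : cvgn (series a).
  by apply: nondecreasing_is_cvgn; [exact: nd_sum|exists (expR g) => _ [M _ <-]; exact: aub].
suff -> : expR g = limn (series a) by [].
apply/eqP; rewrite eq_le; apply/andP; split; last first.
  by apply: limr_le => //; apply: nearW => M; exact: aub.
apply: limr_le; first exact: is_cvg_series_exp_coeff.
apply: nearW => J.
have -> : series (exp_coeff g) J = \sum_(k < J) k`!%:R^-1 * g ^+ k.
  by rewrite /series/= big_mkord; apply: eq_bigr => k _; rewrite /exp_coeff mulrC.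
(* let M tend to infinity for a fixed number J of terms of the exponential *)
have cvJ : (fun M => \sum_(k < J) k`!%:R^-1 * (series x M) ^+ k) @ \oo -->
    \sum_(k < J) k`!%:R^-1 * g ^+ k.
  elim: J => [|J ih].
    by rewrite big_ord0; under eq_fun do rewrite big_ord0; exact: cvg_cst.
  rewrite big_ord_recr/=; under eq_fun do rewrite big_ord_recr/=.
  apply: cvgD; first exact: ih.
  apply: cvgM; first exact: cvg_cst.
  elim: (J) => [|j ihj]; first by under eq_fun do rewrite expr0; exact: cvg_cst.
  by rewrite exprS; under eq_fun do rewrite exprS; exact: cvgM.
rewrite -(cvg_lim _ cvJ)//; apply: limr_le; first by apply/cvg_ex; eexists; exact: cvJ.
apply: nearW => M.
apply: le_trans (nondecreasing_cvgn_le (nd_sum _ ap) acvg (J * M + J)%N).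
rewrite sumaE (big_ord_widen (J * M + J)%N (fun k => k`!%:R^-1 * series x M ^+ k)) ?leq_addl//.
rewrite [leLHS]big_mkcond/=; apply: ler_sum => k _.
case: ifPn => [kJ|_]; last first.
  by rewrite mulr_ge0 ?invr_ge0// sumr_ge0// => n _; exact: fps_ge0X.
rewrite ler_wpM2l ?invr_ge0// /series/= big_mkord.
apply: le_trans (fps_sum_exp_ge k M x0) _.
(* degree J M + J suffices for all powers k < J of a partial sum of length M *)
have le1 : ((k * M).+1 <= J * M + J)%N.
  by rewrite -addn1 leq_add ?leq_mul2r ?(ltnW kJ) ?orbT// (leq_trans _ kJ).
rewrite (big_ord_widen _ (x ^+ k) le1) big_mkcond/=; apply: ler_sum => n _.
by case: ifP => // _; exact: fps_ge0X.
Qed.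
End exponential_formula.

(** * Uniqueness of Laplace transforms of right-continuous functions *)

Section annihilator.
Variable R : realType.
Notation mu := (@lebesgue_measure R).
Variables (D : set R) (mD : measurable D) (h : R -> R).
Hypothesis ih : mu.-integrable D (EFin \o h).

(** The functions [w] orthogonal to [h]. They form a space stable under linear
    combinations and bounded pointwise limits, which is used to pass from the
    exponentials to indicators of intervals. *)
Definition annihilates (w : R -> R) :=
  mu.-integrable D (fun t => (h t * w t)%:E) /\
  (\int[mu]_(t in D) (h t * w t)%:E = 0)%E.

Lemma annihilates_lincomb (w : nat -> R -> R) (c : nat -> R) K :
  (forall k, annihilates (w k)) -> annihilates (fun t => \sum_(k < K) c k * w k t).
Proof.
move=> aw; elim: K => [|K [ihi ih0]].
  split.
    by under eq_fun do rewrite big_ord0 mulr0; exact: integrable0.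
  by under eq_integral do rewrite big_ord0 mulr0; exact: integral0.
have [wi w0] := aw K.
have ci : mu.-integrable D (fun t => ((c K)%:E * (h t * w K t)%:E)%E).
  exact: integrableZl.
split.
  under eq_fun do rewrite big_ord_recr/= mulrDr EFinD mulrCA [(c K * _)%:E]EFinM.
  exact: integrableD.
under eq_integral do rewrite big_ord_recr/= mulrDr EFinD mulrCA [(c K * _)%:E]EFinM.
by rewrite integralD// ih0 add0e integralZl// w0 mule0.
Qed.

Lemma annihilates_lim (w_ : nat -> R -> R) (w : R -> R) C :
  (forall n, annihilates (w_ n)) ->
  (forall n t, D t -> `|w_ n t| <= C) ->
  (forall t, D t -> w_ n t @[n --> \oo] --> w t) ->
  annihilates w.
Proof.
move=> aw wC ww.
have mhw n : measurable_fun D (fun t => (h t * w_ n t)%:E).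
  by have [/measurable_int] := aw n.
have hww t : D t -> (h t * w_ n t)%:E @[n --> \oo] --> (h t * w t)%:E.
  by move=> Dt; apply: cvg_EFin; [exact: nearW|apply: cvgM; [exact: cvg_cst|exact: ww]].
have ig : mu.-integrable D (fun t => (C%:E * (`|h t|)%:E)%E).
  by apply: integrableZl => //; exact: integrable_norm.
have [] := @dominated_convergence _ _ _ mu D mD (fun n t => (h t * w_ n t)%:E)
    (fun t => (h t * w t)%:E) _ mhw _ _ ig.
- exact: emeasurable_fun_cvg mhw hww.
- by apply: aeW => t Dt; exact: hww.
- apply: aeW => t n Dt /=; rewrite -EFinM lee_fin normrM mulrC ler_wpM2r//.
  exact: wC.
move=> hwi _ lim0; split => //.
have : [sequence (\int[mu]_(x in D) (h x * w_ n x)%:E)%E]_n = (fun=> 0%E).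
  by apply/funext => n /=; have [] := aw n.
by move=> E; move: lim0; rewrite E => /(cvg_lim _) <-//; rewrite lim_cst.
Qed.

Lemma annihilatesB (w v : R -> R) : annihilates w -> annihilates v ->
  annihilates (fun t => w t - v t).
Proof.
move=> aw av.
have := @annihilates_lincomb (fun k => if k == 0 then w else v)
  (fun k => if k == 0 then 1 else -1) 2.
rewrite (_ : (fun t => _) = (fun t => w t - v t)); last first.
  by apply/funext => t; rewrite big_ord_recr/= big_ord1/= mul1r mulN1r.
by apply => -[|k].
Qed.
End annihilator.

Section laplace_uniqueness.
Variable R : realType.
Notation mu := (@lebesgue_measure R).
Implicit Type f : R -> R.

Let D : set R := `[0, +oo[%classic.

(** Pointwise limit of [exp (- exp (n (x - t)))] as [n] grows. The value at [t = x] is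
    kept exact so that the convergence holds everywhere. *)
Let jump (x t : R) : R := if t < x then 0 else if t == x then expR (-1) else 1.

Let cvg_jump x t : expR (- expR (n%:R * (x - t))) @[n --> \oo] --> jump x t.
Proof.
rewrite /jump; have [tx|xt|->] := ltgtP t x.
- apply: (@squeeze_cvgr _ _ _ _ (fun=> 0) (fun n : nat => expR (t - x) ^+ n)).
  + apply: nearW => n; rewrite expR_ge0/= -expRM_natl ler_expR.
    rewrite lerNl -mulrN opprB (le_trans _ (expR_ge1Dx _))// ler_wpDl//.
  + exact: cvg_cst.
  + by apply: cvg_expr; rewrite ger0_norm ?expR_ge0// expR_lt1 subr_lt0.
- have E : expR (x - t) ^+ n @[n --> \oo] --> (0 : R).
    by apply: cvg_expr; rewrite ger0_norm ?expR_ge0// expR_lt1 subr_lt0.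
  have {}E : expR (n%:R * (x - t)) @[n --> \oo] --> (0 : R).
    by under eq_fun do rewrite expRM_natl.
  rewrite -[X in _ --> X]expR0 -[X in _ --> expR X]oppr0.
  by apply: continuous_cvg; [exact: continuous_expR|exact: cvgN].
- under eq_fun do rewrite subrr mulr0 expR0; exact: cvg_cst.
Qed.

(** If [f x > 0], right continuity gives [f >= f x / 2] on some interval from [x] to
    [y]. All exponentials annihilate [f]; hence so do
    [exp (- exp (n (x - t)))], whose exponential series in [c exp (- n t)] is
    bounded for [t >= 0], then their limits [jump x] and [jump y], and finally
    the difference of these two, against which [f] integrates to a positive
    number. *)
Lemma laplace_unique_le f :
  (forall t, 0 <= t -> f u @[u --> t^'+] --> f t) ->
  (forall q, 0 < q -> mu.-integrable D (fun t => (expR (- (q * t)) * f t)%:E)) ->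
  (forall q, 0 < q -> (\int[mu]_(t in D) (expR (- (q * t)) * f t)%:E = 0)%E) ->
  forall t, 0 <= t -> f t <= 0.
Proof.
move=> fr fi f0 x x0; rewrite leNgt; apply/negP => fx0.
have mD : measurable D by exact: measurable_itv.
(* the factor exp (- t) makes f integrable, at the cost of shifting q by 1 *)
pose h t := expR (- t) * f t.
have hi : mu.-integrable D (EFin \o h).
  have := fi 1 ltr01; apply: eq_integrable => // t _ /=.
  by rewrite mul1r.
have aexp (q : R) : 0 <= q -> annihilates D h (fun t => expR (- (q * t))).
  move=> q0; have q1 : 0 < q + 1 by lra.
  have E t : h t * expR (- (q * t)) = expR (- ((q + 1) * t)) * f t.
    by rewrite /h mulrAC -expRD; congr (expR _ * _); ring.
  split; first by under eq_fun do rewrite E; exact: fi.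
  by under eq_integral do rewrite E; exact: f0.
have adexp (n : nat) y : annihilates D h (fun t => expR (- expR (n%:R * (y - t)))).
  pose c := expR (n%:R * y); pose z t := - (c * expR (- (n%:R * t))).
  have zE t : - expR (n%:R * (y - t)) = z t.
    by rewrite /z /c -expRD; congr (- expR _); ring.
  under eq_fun do rewrite zE.
  apply: (@annihilates_lim R D mD h hi
    (fun K t => series (exp_coeff (z t)) K) _ (expR c)).
  - move=> K; have := @annihilates_lincomb R D mD h
      (fun k t => expR (- ((k%:R * n%:R) * t))) (fun k => (- c) ^+ k / k`!%:R) K.
    rewrite (_ : (fun t => _) = (fun t => series (exp_coeff (z t)) K)).
      by apply => k; apply: aexp; rewrite mulr_ge0.
    apply/funext => t; rewrite /series/= big_mkord; apply: eq_bigr => k _.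
    rewrite /exp_coeff /z /= -[- (c * _)]mulNr exprMn -expRM_natl mulrAC; congr (_ * expR _ / _).
    by ring.
  - move=> K t; rewrite /D/= in_itv/= andbT => t0.
    have zc : `|z t| <= c.
      rewrite normrN ger0_norm ?mulr_ge0 ?expR_ge0// ler_piMr ?expR_ge0//.
      by rewrite expR_le1 oppr_le0 mulr_ge0.
    apply: le_trans (ler_norm_sum _ _ _) _.
    apply: (@le_trans _ _ (series (exp_coeff c) K)).
      rewrite /series/=; apply: ler_sum => k _; rewrite /exp_coeff normrM normrX.
      rewrite [X in _ * X]ger0_norm// ler_wpM2r//.
      by apply: lerXn2r; rewrite ?nnegrE ?expR_ge0.
    apply: nondecreasing_cvgn_le; last exact: is_cvg_series_exp_coeff.
    by apply/nondecreasing_series => k _ _; rewrite exp_coeff_ge0// expR_ge0.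
  - by move=> t _; exact: is_cvg_series_exp_coeff.
have ajump y : annihilates D h (jump y).
  apply: (@annihilates_lim R D mD h hi
    (fun n t => expR (- expR (n%:R * (y - t)))) _ 1).
  - by move=> n; exact: adexp.
  - move=> n t _; rewrite ger0_norm ?expR_ge0// expR_le1 oppr_le0 expR_ge0.
  - by move=> t _; exact: cvg_jump.
have [y xy fy] : exists2 y, x < y & forall t, x <= t -> t <= y -> f x / 2 <= f t.
  have : \forall u \near x^'+, f x / 2 <= f u.
    by apply: (cvgr_ge _ (fr x x0)); lra.
  case=> e /= e0 ue; exists (x + e / 2); first lra.
  move=> t; rewrite le_eqVlt => /predU1P[<-|xt] ty; first lra.
  apply: ue => //=; rewrite ltr0_norm; lra.
have [wi w0] := annihilatesB mD (ajump x) (ajump y).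
pose m := expR (- y) * (f x / 2).
have m0 : 0 < m by rewrite mulr_gt0 ?expR_gt0//; lra.
pose I : set R := `]x, y[%classic.
have mI : measurable I by exact: measurable_itv.
have Ifin : mu.-integrable D (fun t => (m * \1_I t)%:E).
  under eq_fun do rewrite EFinM; apply: integrableZl => //.
  by apply: integrableS (@integrable_indic_itv R x y false true).
suff : ((m * (y - x))%:E <= 0 :> \bar R)%E.
  by rewrite lee_fin leNgt mulr_gt0// subr_gt0.
rewrite -w0 (_ : (m * (y - x))%:E = (\int[mu]_(t in D) (m * \1_I t)%:E)%E).
  apply: le_integral => // t; rewrite inE /D/= in_itv/= andbT => t0.
  rewrite lee_fin /I indicE /jump.
  have [tI|] := boolP (t \in _).
    move: tI; rewrite inE/= in_itv/= => /andP[xt ty].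
    rewrite ltNge (ltW xt)/= gt_eqF// ty subr0 !mulr1 /m /h.
    apply: ler_pM; rewrite ?expR_ge0 ?ler_expR ?lerN2//; [lra|exact: ltW|].
    exact: fy (ltW xt) (ltW ty).
  rewrite notin_setE/= in_itv/= => /negP tI; rewrite mulr0.
  have e1 : expR (-1) <= 1 :> R by rewrite expR_le1; lra.
  have hpos : x <= t -> t <= y -> 0 <= h t.
    by move=> xt ty; rewrite mulr_ge0 ?expR_ge0//; have := fy t xt ty; lra.
  have [tx|xt|tx] := ltgtP t x.
  - by rewrite (lt_trans tx xy) subrr mulr0.
  - have yt : y <= t by move: tI; rewrite xt/= -leNgt.
    rewrite ltNge yt/=; case: eqP => [ty|_]; last by rewrite subrr mulr0.
    by rewrite mulr_ge0 ?subr_ge0// hpos// ?ty// ltW.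
  - rewrite tx xy subr0 mulr_ge0 ?expR_ge0//.
    by rewrite -tx hpos ?tx// ltW.
under eq_integral do rewrite EFinM.
rewrite integralZl//; last first.
  by apply: integrableS (@integrable_indic_itv R x y false true).
rewrite integral_indic// setIidl; last first.
  move=> t; rewrite /I /D/= !in_itv/= => /andP[xt _].
  by rewrite andbT; lra.
have muI : mu I = (y - x)%:E by rewrite /I lebesgue_measure_itv/= lte_fin xy EFinB.
by rewrite [X in (_ = _ * X)%E]muI.
Qed.

Theorem laplace_unique f :
  (forall t, 0 <= t -> f u @[u --> t^'+] --> f t) ->
  (forall q, 0 < q -> mu.-integrable D (fun t => (expR (- (q * t)) * f t)%:E)) ->
  (forall q, 0 < q -> (\int[mu]_(t in D) (expR (- (q * t)) * f t)%:E = 0)%E) ->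
  forall t, 0 <= t -> f t = 0.
Proof.
move=> fr fi f0 t t0; apply/eqP; rewrite eq_le laplace_unique_le//=.
rewrite -oppr_le0; apply: (@laplace_unique_le (fun t => - f t)) => //.
- by move=> u u0; apply: cvgN; exact: fr.
- move=> q q0; under eq_fun do rewrite mulrN EFinN.
  by apply: integrableN; exact: fi.
- move=> q q0; under eq_integral do rewrite mulrN -mulN1r EFinM.
  by rewrite integralZl ?f0 ?mule0//; [exact: measurable_itv|exact: fi].
Qed.
End laplace_uniqueness.

(** * The exponential of a running integral *)

Section integral_exponential.
Variable R : realType.
Notation mu := (@lebesgue_measure R).

Lemma integrable_bounded_itv (f : R -> R) (C a b : R) (x y : bool) :
  measurable_fun setT f ->
  (forall t, t \in [set` Interval (BSide x a) (BSide y b)] -> `|f t| <= C) ->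
  mu.-integrable [set` Interval (BSide x a) (BSide y b)] (EFin \o f).
Proof.
move=> mf fC; apply: measurable_bounded_integrable => //.
- rewrite [X in (X < _)%E]lebesgue_measure_itv/=; case: ifP => _ //.
  by rewrite -EFinB ltry.
- exact: measurable_funTS.
- exists C; split; first by rewrite num_real.
  by move=> M CM t tI; apply: le_trans (ltW CM); apply: fC; rewrite inE.
Qed.

Variable g : R -> R.
Hypothesis mg : measurable_fun setT g.
Hypothesis g01 : forall t, 0 <= g t <= 1.

Definition antideriv (t : R) : R := \int[mu]_(s in `[0, t]) g s.
Notation F := antideriv.

Let g_int a b x y : mu.-integrable [set` Interval (BSide x a) (BSide y b)] (EFin \o g).
Proof.
apply: (@integrable_bounded_itv _ 1) => // t _.
by have /andP[g0 g1] := g01 t; rewrite ger0_norm.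
Qed.

Lemma antiderivB s t : 0 <= s -> s <= t -> F t - F s = \int[mu]_(u in `]s, t]) g u.
Proof.
by move=> s0 st; rewrite /F Rintegral_itvB//; rewrite bnd_simp.
Qed.

Let measure_itvoc s t : s <= t -> fine (mu `]s, t]%classic) = t - s.
Proof.
move=> st; rewrite lebesgue_measure_itv/= lte_fin.
by case: ltgtP st => [//|//|->] _ /=; rewrite subrr.
Qed.

Lemma antideriv_lip s t : 0 <= s -> s <= t -> 0 <= F t - F s <= t - s.
Proof.
move=> s0 st; rewrite antiderivB//; apply/andP; split.
  by apply: Rintegral_ge0 => u _; have /andP[] := g01 u.
rewrite -(measure_itvoc st) -[leRHS]mul1r -Rintegral_cst//.
apply: le_Rintegral => //.
- by apply: (@integrable_bounded_itv _ 1) => // u _; rewrite normr1.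
- by move=> u _; have /andP[] := g01 u.
Qed.

Lemma antideriv_neg t : t < 0 -> F t = 0.
Proof. by move=> t0; rewrite /F set_itv_ge ?Rintegral_set0// bnd_simp -ltNge. Qed.

Lemma antideriv0 : F 0 = 0.
Proof. by rewrite /F set_itv1 Rintegral_set1. Qed.

Lemma antideriv_ge0 t : 0 <= F t.
Proof. by apply: Rintegral_ge0 => u _; have /andP[] := g01 u. Qed.

Lemma antideriv_homo : {homo F : s t / s <= t}.
Proof.
move=> s t st; have [s0|s0] := ltP s 0; first by rewrite antideriv_neg ?antideriv_ge0.
by have /andP[+ _] := antideriv_lip s0 st; rewrite subr_ge0.
Qed.

Lemma antideriv_le t : 0 <= t -> F t <= t.
Proof.
by move=> t0; have /andP[_] := antideriv_lip (lexx 0) t0; rewrite antideriv0 !subr0.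
Qed.

Lemma measurable_antideriv : measurable_fun setT F.
Proof.
by apply: nondecreasing_measurable => //; exact: antideriv_homo.
Qed.

Variable lambda : R.
Hypothesis lambda0 : 0 <= lambda.

Let e t := expR (lambda * F t).

Let e_homo s t : s <= t -> e s <= e t.
Proof. by move=> st; rewrite ler_expR ler_wpM2l// antideriv_homo. Qed.

Let me_ : measurable_fun setT e.
Proof.
apply: measurableT_comp => //; apply: measurable_funM => //.
exact: measurable_antideriv.
Qed.

Let ge_int a b x y : mu.-integrable [set` Interval (BSide x a) (BSide y b)]
  (EFin \o (fun s => g s * e s)).
Proof.
apply: (@integrable_bounded_itv _ (e b)); first exact: measurable_funM.
move=> t; rewrite inE/= => tI; have /andP[g0 g1] := g01 t.
have tb : t <= b by move: tI; rewrite in_itv; case: y => /= /andP[_ // /ltW].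
have e0 : 0 <= e t by exact: expR_ge0.
rewrite ger0_norm; last exact: mulr_ge0.
rewrite -[leRHS]mul1r; exact: (ler_pM g0 e0 g1 (e_homo tb)).
Qed.

Let K t := \int[mu]_(s in `[0, t]) (g s * e s).

Let KB s t : 0 <= s -> s <= t -> K t - K s = \int[mu]_(u in `]s, t]) (g u * e u).
Proof.
move=> s0 st; rewrite /K Rintegral_itvB//.
Qed.

(* a = exp (lambda F s) for the first bound, exp (lambda F t) for the second *)
Let exp_bounds (a x : R) : 0 <= a ->
  x * a <= a * expR x - a /\ a - a * expR (- x) <= x * a.
Proof.
move=> a0; have := expR_ge1Dx x; have := expR_ge1Dx (- x).
move: (expR x) (expR (- x)) => E E' E'ge Ege; split.
  by have := ler_wpM2l a0 Ege; rewrite mulrDr mulr1 mulrC; lra.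
by have := ler_wpM2l a0 E'ge; rewrite mulrDr mulr1 mulrN mulrC; lra.
Qed.

Let sandwich (l D k a dt es et : R) : 0 <= l -> 0 <= D -> D <= dt -> 0 <= et - es ->
  l * D * es <= a -> a <= l * D * et -> a = et - es ->
  D * es <= k -> k <= D * et -> `|a - l * k| <= l * dt * (et - es).
Proof.
move=> l0 D0 Ddt ee h1 h2 aE k1 k2.
have h3 : l * D * es <= l * k by rewrite -mulrA ler_wpM2l.
have h4 : l * k <= l * D * et by rewrite -mulrA ler_wpM2l.
have h5 : l * D * (et - es) <= l * dt * (et - es) by rewrite ler_wpM2r// ler_wpM2l.
apply: le_trans h5; rewrite mulrBr.
by rewrite ler_norml; apply/andP; split; lra.
Qed.

(** [K] is the candidate integral. On a short interval both [exp (lambda F)] and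
    [lambda K] increase by an amount between [lambda (F t - F s) exp (lambda F s)]
    and [lambda (F t - F s) exp (lambda F t)], so their increments differ by at
    most [lambda (t - s)] times the increment of [exp (lambda F)]. *)
Let increment s t : 0 <= s -> s <= t ->
  `|(e t - lambda * K t) - (e s - lambda * K s)| <= lambda * (t - s) * (e t - e s).
Proof.
move=> s0 st; pose dl := F t - F s.
have /andP[dl0 dlts] := antideriv_lip s0 st; rewrite -/dl in dl0 dlts.
have est : e t = e s * expR (lambda * dl).
  by rewrite /e -expRD -mulrDr /dl addrC subrK.
have ets : e s = e t * expR (- (lambda * dl)).
  by rewrite /e -expRD -mulrBr /dl opprB addrC subrK.
have dlE : dl = \int[mu]_(u in `]s, t]) g u by exact: antiderivB.
have mI : measurable (`]s, t]%classic : set (measurableTypeR R)) by exact: measurable_itv.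
have gI := g_int s t false false; have geI := ge_int s t false false.
have constI c : mu.-integrable `]s, t] (EFin \o (fun u => g u * c)).
  have := integrableZl mI c gI; apply: eq_integrable => // u _.
  by rewrite /= EFinM muleC.
have lo2 : dl * e s <= K t - K s.
  rewrite (KB s0 st) dlE -(@RintegralZr _ _ _ mu _ g (e s) mI gI); apply: (@le_Rintegral _ _ _ _ _ _ _ mI (constI _) geI).
  move=> u; rewrite /= in_itv/= => /andP[su _]; have /andP[g0 _] := g01 u.
  exact: (ler_wpM2l g0 (e_homo (ltW su))).
have hi2 : K t - K s <= dl * e t.
  rewrite (KB s0 st) dlE -(@RintegralZr _ _ _ mu _ g (e t) mI gI); apply: (@le_Rintegral _ _ _ _ _ _ _ mI geI (constI _)).
  move=> u; rewrite /= in_itv/= => /andP[_ ut]; have /andP[g0 _] := g01 u.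
  exact: (ler_wpM2l g0 (e_homo ut)).
have [lo1 _] := exp_bounds (lambda * dl) (expR_ge0 (lambda * F s) : 0 <= e s).
have [_ hi1] := exp_bounds (lambda * dl) (expR_ge0 (lambda * F t) : 0 <= e t).
rewrite -est in lo1; rewrite -ets in hi1.
have -> : (e t - lambda * K t) - (e s - lambda * K s) =
    (e t - e s) - lambda * (K t - K s).
  by move: (e t) (e s) (K t) (K s) => *; ring.
by apply: sandwich lo2 hi2 => //; rewrite subr_ge0 e_homo.
Qed.

(** The chain rule for [exp (lambda F)], with [F] the integral of a merely measurable
    function. Instead of differentiating almost everywhere, the errors of
    [increment] are summed over a subdivision of mesh [t / n]: since [exp (lambda
    F)] is nondecreasing they telescope to a multiple of [1 / n]. *)
Theorem integral_exponential t : 0 <= t ->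
  expR (lambda * F t) = 1 + lambda * \int[mu]_(s in `[0, t]) (g s * expR (lambda * F s)).
Proof.
move=> t0; pose D s := e s - lambda * K s.
have D0 : D 0 = 1.
  by rewrite /D /K set_itv1 Rintegral_set1 mulr0 subr0 /e antideriv0 mulr0 expR0.
suff : D t = D 0 by rewrite D0 /D => /eqP; rewrite subr_eq => /eqP.
apply/eqP; rewrite -subr_eq0 -normr_le0; apply/ler_addgt0Pl => eps eps0.
rewrite addr0; pose C := lambda * t * (e t - 1).
have C0 : 0 <= C.
  by rewrite !mulr_ge0// subr_ge0 -expR0 ler_expR mulr_ge0// antideriv_ge0.
have [n Cn] : exists n : nat, C / n.+1%:R <= eps.
  exists (Num.truncn (C / eps)); rewrite ler_pdivrMr// mulrC -ler_pdivrMr//.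
  exact/ltW/Num.Theory.truncnS_gt.
apply: le_trans Cn.
pose p i : R := i%:R * (t / n.+1%:R).
have pS i : p i.+1 - p i = t / n.+1%:R by rewrite /p -natr1; ring.
have p0 i : 0 <= p i by rewrite mulr_ge0// divr_ge0.
have pn : p n.+1 = t by rewrite /p mulrC divfK// pnatr_eq0.
have p00 : p 0%N = 0 by rewrite /p mul0r.
have -> : D t - D 0 = \sum_(0 <= i < n.+1) (D (p i.+1) - D (p i)).
  by rewrite telescope_sumr// pn p00.
apply: le_trans (ler_norm_sum _ _ _) _.
apply: (@le_trans _ _ (\sum_(0 <= i < n.+1) lambda * (t / n.+1%:R) * (e (p i.+1) - e (p i)))).
  apply: ler_sum => i _; rewrite -(pS i); apply: increment => //.
  by rewrite -subr_ge0 pS divr_ge0.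
rewrite -mulr_sumr telescope_sumr// pn p00 /C.
have -> : e 0 = 1 by rewrite /e antideriv0 mulr0 expR0.
by rewrite mulrA mulrAC.
Qed.
End integral_exponential.

(** * Joint measurability of right-continuous processes *)

Section right_continuous_joint.
Context d (S : measurableType d) (R : realType).
Variables (x : R -> S -> R) (W : set S) (b : R).
Hypothesis mx : forall t, 0 <= t <= b -> measurable_fun setT (x t).
Hypothesis x_right : forall w, W w -> forall t, 0 <= t -> t < b ->
  x u w @[u --> t^'+] --> x t w.
Notation Rm := (measurableTypeR R).

Let grid (n k : nat) : R := Num.min b (k.+1%:R / n.+1%:R).
Let cell (n k : nat) : set Rm := `[k%:R / n.+1%:R, k.+1%:R / n.+1%:R[%classic.
Let z (n : nat) (u : Rm * S) : R :=
  \sum_(k < (Num.truncn (n.+1%:R * b)).+1) \1_(cell n k) u.1 * x (grid n k) u.2.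

Let grid_itv n k : 0 <= b -> 0 <= grid n k <= b.
Proof.
by move=> b0; rewrite /grid le_min ge_min b0 divr_ge0//= lexx.
Qed.

Let mz n : 0 <= b -> measurable_fun setT (z n).
Proof.
move=> b0; apply: measurable_sum => k; apply: measurable_funM.
- have mI : measurable_fun setT (\1_(cell n k) : Rm -> R).
    by apply: measurable_indic; exact: measurable_itv.
  exact: measurableT_comp mI measurable_fst.
- have mG : measurable_fun setT (x (grid n k)) by apply: mx; exact: grid_itv.
  exact: measurableT_comp mG measurable_snd.
Qed.

Let zE n t w : 0 <= t <= b -> z n (t, w) = x (grid n (Num.truncn (n.+1%:R * t))) w.
Proof.
move=> /andP[t0 tb]; set k0 := Num.truncn _.
have nt0 : 0 <= n.+1%:R * t by rewrite mulr_ge0.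
have k0lt : (k0 < (Num.truncn (n.+1%:R * b)).+1)%N.
  rewrite ltnS /k0; apply: le_truncn.
  by rewrite ler_wpM2l.
have in_cell k : ((t : Rm) \in cell n k) = (k == k0).
  rewrite eq_sym /k0 truncn_eq// /cell mem_setE in_itv/=.
  by rewrite ler_pdivrMr// ltr_pdivlMr// mulrC.
rewrite /z (bigD1 (Ordinal k0lt))//= big1 ?addr0; last first.
  move=> k kk0; rewrite indicE in_cell (_ : (nat_of_ord k == k0) = false) ?mul0r//.
  exact/negbTE.
by rewrite indicE in_cell eqxx mul1r.
Qed.

Let z_cvg t w : W w -> 0 <= t <= b -> z n (t, w) @[n --> \oo] --> x t w.
Proof.
move=> Ww t0b; have /andP[t0 tb] := t0b.
under eq_fun do rewrite zE//.
have trunc_itv n : t < (Num.truncn (n.+1%:R * t)).+1%:R / n.+1%:R <= t + n.+1%:R^-1.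
  have /andP[h1 h2] : (Num.truncn (n.+1%:R * t))%:R <= n.+1%:R * t < (Num.truncn (n.+1%:R * t)).+1%:R.
    by rewrite truncn_itv// mulr_ge0.
  rewrite ltr_pdivlMr// mulrC h2/= ler_pdivrMr// mulrDl mulVf ?pnatr_eq0//.
  by rewrite -[X in X <= _]natr1 lerD2r [t * _]mulrC.
move: tb; rewrite le_eqVlt => /predU1P[tb|tb].
  have -> : (fun n => x (grid n (Num.truncn (n.+1%:R * t))) w) = (fun=> x t w).
    apply/funext => n; congr (x _ w); rewrite /grid -tb; apply/min_idPl.
    by have /andP[/ltW] := trunc_itv n.
  exact: cvg_cst.
apply/cvgrPdist_lt => eps eps0.
have /cvgrPdist_lt /(_ eps eps0) [e /= e0 he] := x_right Ww t0 tb.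
near=> n; apply: he.
  have /andP[h1 h2] := trunc_itv n.
  have hn : n.+1%:R^-1 < e by near: n; exact: near_infty_natSinv_lt (PosNum e0).
  rewrite /= ltr0_norm; last by rewrite subr_lt0 /grid lt_min tb h1.
  rewrite opprB ltrBlDr /grid; apply: le_lt_trans (_ : t + n.+1%:R^-1 < _).
    by rewrite ge_min h2 orbT.
  by rewrite addrC ltrD2r.
have /andP[h1 _] := trunc_itv n.
by rewrite /grid lt_min tb h1.
Unshelve. all: by end_near. Qed.

(** At time [t] the discretisation [z n] reads the process at the next point of the
    grid of mesh [1 / (n + 1)], capped by [b]. This point decreases to [t], so
    right continuity gives convergence on [W]; off [W] the upper limit keeps the
    limit measurable. The cap matters: only times in [0, b] are read, so the
    result holds in the sigma-algebra of the past at time [b]. *)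
Lemma right_continuous_joint : 0 <= b -> exists y : Rm * S -> R,
  measurable_fun setT y /\ forall t w, W w -> 0 <= t <= b -> y (t, w) = x t w.
Proof.
move=> b0; exists (fun u => fine (limn_esup (fun n => (z n u)%:E))); split.
  apply: (measurableT_comp (fine_measurable measurableT)).
  by apply: measurable_fun_limn_esup => n; apply/measurable_EFinP; exact: mz.
move=> t w Ww tb.
have /cvg_limn_einf_sup[_ ->//] : (z n (t, w))%:E @[n --> \oo] --> (x t w)%:E.
by apply: cvg_EFin; [exact: nearW|exact: z_cvg].
Qed.
End right_continuous_joint.

Local Open Scope ereal_scope.

(** * Null sets, and two elementary computations *)

Section almost_everywhere.
Context d (T : measurableType d) (R : realType) (m : {measure set T -> \bar R}).

Lemma ge0_integral_le_nonmeasurable (f g : T -> \bar R) :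
  (forall x, 0 <= f x) -> (forall x, f x <= g x) ->
  \int[m]_x f x <= \int[m]_x g x.
Proof.
move=> f0 fg; have g0 x : 0 <= g x by exact: le_trans (fg x).
rewrite !ge0_integralTE//; apply: ereal_sup_le => _ [h hf <-].
by exists h => // x; exact: le_trans (fg x).
Qed.

(** Applied to path functionals such as the sojourn time, for which measurability
    is only known after a change on a null set; hence no measurability is asked of
    [f]. The function [f] lies between the modifications of [g] by [0] and by [+oo]
    on [N], and these have the integral of [g]. *)
Lemma ge0_integral_null_change (N : set T) (f g : T -> \bar R) :
  measurable N -> m N = 0 -> (forall x, ~ N x -> f x = g x) ->
  measurable_fun setT g -> (forall x, 0 <= f x) -> (forall x, 0 <= g x) ->
  \int[m]_x f x = \int[m]_x g x.
Proof.
move=> mN N0 fg mg f0 g0.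
have patch c : 0 <= c -> \int[m]_x (if x \in N then c else g x) = \int[m]_x g x.
  move=> c0; apply: ge0_ae_eq_integral => //.
  - apply: measurable_fun_ifT => //; apply: (@measurable_fun_bool _ _ _ _ true).
    by rewrite setTI (_ : _ @^-1` _ = N)//; apply/seteqP; split => w /=; [exact: set_mem|exact: mem_set].
  - by move=> x _; case: ifP.
  - exists N; split => // x /= /not_implyP[_ h]; apply: contrapT => nx; apply: h.
    by rewrite memNset.
apply/eqP; rewrite eq_le; apply/andP; split.
  rewrite -(patch +oo)//; apply: ge0_integral_le_nonmeasurable => // x.
  case: ifPn => [_|/negP xN]; first exact: leey.
  by rewrite fg// => Nx; apply: xN; rewrite inE.
rewrite -(patch 0)//; apply: ge0_integral_le_nonmeasurable => x.
  by case: ifP.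
case: ifPn => [_|/negP xN]; first exact: f0.
by rewrite fg// => Nx; apply: xN; rewrite inE.
Qed.
End almost_everywhere.

Section elementary.
Variable R : realType.
Notation mu := (@lebesgue_measure R).

Lemma integral_monomial (k : nat) (t : R) : (0 <= t)%R ->
  \int[mu]_(s in `[0%R, t]) (s ^+ k)%:E = (t ^+ k.+1 / k.+1%:R)%:E.
Proof.
rewrite le_eqVlt => /predU1P[<-|t0].
  by rewrite set_itv1 integral_set1 expr0n/= mul0r.
rewrite (@continuous_FTC2 _ _ (fun x : R => x ^+ k.+1 * k.+1%:R^-1)%R)//=.
- by rewrite expr0n/= mul0r sube0.
- by apply: continuous_in_subspaceT => x _; exact: exprn_continuous.
- split.
  + by move=> y _; apply: derivableM => //; exact: exprn_derivable.
  + by apply: cvg_at_right_filter; apply: cvgM; [exact: exprn_continuous|exact: cvg_cst].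
  + by apply: cvg_at_left_filter; apply: cvgM; [exact: exprn_continuous|exact: cvg_cst].
- move=> x _; rewrite derive1Mr//; last exact: exprn_derivable.
  by rewrite derive1E exp_derive scaler1/= mulrAC divff ?mul1r// pnatr_eq0.
Qed.

(** The exponential series of [l t] integrated once in [l]: with [c] the rate of the
    clock, the terms are those that arise when the gamma densities are summed with
    weights [r^k / k]. *)
Lemma nneseries_exp_quotient (l t c : R) : (0 < l)%R -> (0 < t)%R -> (0 < c)%R ->
  \sum_(0 <= k <oo) ((l / c) ^+ k.+1 / k.+1%:R * ((c * t) ^+ k / k`!%:R))%:E =
  (c^-1 * ((expR (l * t) - 1) / t))%:E.
Proof.
move=> l0 t0 c0.
have termE k : ((l / c) ^+ k.+1 / k.+1%:R * ((c * t) ^+ k / k`!%:R) =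
    (c * t)^-1 * exp_coeff (l * t) k.+1)%R.
  rewrite /exp_coeff /= factS natrM !exprS !exprMn exprVn.
  have ck : (c ^+ k != 0)%R by rewrite expf_neq0// gt_eqF.
  have kf : k`!%:R != 0%R :> R by rewrite pnatr_eq0 -lt0n fact_gt0.
  have k1 : k.+1%:R != 0%R :> R by rewrite pnatr_eq0.
  have c1 : c != 0%R by rewrite gt_eqF.
  have t1 : t != 0%R by rewrite gt_eqF.
  by field; rewrite kf nat1r k1 t1 c1 ck.
apply: cvg_lim => //.
have sumE n : \sum_(0 <= k < n) ((l / c) ^+ k.+1 / k.+1%:R * ((c * t) ^+ k / k`!%:R))%:E =
    ((c * t)^-1 * (series (exp_coeff (l * t)) n.+1 - 1))%:E.
  rewrite sumEFin; congr EFin.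
  under eq_bigr do rewrite termE.
  rewrite -mulr_sumr; congr (_ * _)%R.
  have e0 : exp_coeff (l * t)%R 0%N = 1%R by rewrite /exp_coeff /= expr0 fact0 divr1.
  by rewrite /series/= big_nat_recl//= e0 [RHS]addrC addKr.
under eq_fun do rewrite sumE.
have -> : (c^-1 * ((expR (l * t) - 1) / t) = (c * t)^-1 * (expR (l * t) - 1))%R.
  by rewrite invfM; ring.
apply: cvg_EFin; first exact: nearW.
apply: cvgM; first exact: cvg_cst.
apply: cvgB; last exact: cvg_cst.
by rewrite (cvg_shiftS (series (exp_coeff (l * t)))); exact: is_cvg_series_exp_coeff.
Qed.
End elementary.

(** * Exponential times *)

Section translation.
Variable R : realType.
Notation mu := (@lebesgue_measure R).

Lemma measurable_triangle : measurable [set z : measurableTypeR R * measurableTypeR R | (0 <= z.1 <= z.2)%R].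
Proof.
rewrite (_ : [set z | _] = (fst @^-1` `[0%R, +oo[%classic) `&`
    ((fun z : measurableTypeR R * measurableTypeR R => (z.2 - z.1)%R) @^-1` `[0%R, +oo[%classic)).
  apply: measurableI.
    by rewrite -[X in measurable X]setTI; apply: measurable_fst.
  by rewrite -[X in measurable X]setTI; apply: measurable_funB.
apply/seteqP; split => -[s t] /=; rewrite !in_itv/= !andbT subr_ge0.
  by move=> /andP.
by move=> [s0 st]; apply/andP.
Qed.

Lemma measurable_addl (x : R) :
  measurable_fun setT (fun u : measurableTypeR R => (x + u)%R : measurableTypeR R).
Proof. by apply: measurable_funD. Qed.

Lemma lebesgue_measure_shift (x : R) (A : set R) : measurable A ->
  pushforward mu (fun u : measurableTypeR R => (x + u)%R : measurableTypeR R) A = mu A.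
Proof.
move=> mA.
pose m0 : {measure set (measurableTypeR R) -> \bar R} :=
  pushforward mu (fun u : measurableTypeR R => (x + u)%R : measurableTypeR R).
apply/esym/(lebesgue_measure_unique (mu := m0 (measurable_addl x))) => //= _ [[a b]] _ <-.
rewrite /pushforward (_ : _ @^-1` _ = `](a - x)%R, (b - x)%R]%classic); last first.
  by apply/seteqP; split => u /=; rewrite !in_itv/= ltrBlDl lerBrDl.
rewrite !lebesgue_measure_itv/= !lte_fin ltrD2r.
by case: ifP => // _; rewrite -!EFinB; congr EFin; ring.
Qed.

Lemma ge0_integral_shift (f : R -> \bar R) (x : R) : measurable_fun setT f ->
  (forall t, 0 <= f t) -> \int[mu]_t f (x + t)%R = \int[mu]_t f t.
Proof.
move=> mf f0.
transitivity (\int[pushforward mu (fun u : measurableTypeR R => (x + u)%R : measurableTypeR R)]_t f t).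
  exact/esym/(ge0_integral_pushforward (measurable_addl x) mu measurableT mf).
by apply: eq_measure_integral => [|? A mA _]; [exact: measurable_addl|exact: lebesgue_measure_shift].
Qed.
End translation.

Definition exponential_clock (R : realType) (p : R) (p0 : (0 < p)%R) :
  probability (measurableTypeR R) R.
Proof. unshelve refine (exponential_prob p : probability _ _); exact: p0. Defined.

Arguments exponential_clock : simpl never.

Section exponential_clock.
Variables (R : realType) (p : R) (p0 : (0 < p)%R).
Notation mu := (@lebesgue_measure R).
Notation nu := (exponential_clock p0).

(** For indicators this is the definition of the law by its density; linearity and
    monotone convergence do the rest. *)
Lemma integral_exponential_prob (f : measurableTypeR R -> \bar R) :
  measurable_fun setT f -> (forall t, 0 <= f t) ->
  \int[nu]_t f t = \int[mu]_(t in `[0%R, +oo[) ((p * expR (- (p * t)))%:E * f t).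
Proof.
move=> mf f0; have pdf0 t : (0 <= exponential_pdf p t)%R.
  by apply: exponential_pdf_ge0; exact: ltW.
have mpdf : measurable_fun setT (exponential_pdf p) by exact: measurable_exponential_pdf.
transitivity (\int[mu]_t ((exponential_pdf p t)%:E * f t)); last first.
  rewrite [RHS]integral_mkcond; apply: eq_integral => t _.
  rewrite /exponential_pdf !patchE; case: ifPn => _; last by rewrite mul0e.
  by congr ((_ * expR _)%R%:E * _); rewrite mulNr.
pose f_ := nnsfun_approx measurableT mf.
have fcvg t : (f_ n t)%:E @[n --> \oo] --> f t by exact: cvg_nnsfun_approx.
have simple n : \int[nu]_t (f_ n t)%:E =
    \int[mu]_t ((exponential_pdf p t)%:E * (f_ n t)%:E).
  under [LHS]eq_integral do rewrite fimfunE -fsumEFin//.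
  rewrite [LHS]ge0_integral_fsum//; last 2 first.
    - move=> r; apply/measurable_EFinP; apply: measurable_funM => //; exact: measurable_indic.
    - by move=> r x _; rewrite EFinM nnfun_muleindic_ge0.
  under [RHS]eq_integral.
    move=> x xD; rewrite fimfunE -fsumEFin// ge0_mule_fsumr; last first.
      by move=> r; rewrite EFinM nnfun_muleindic_ge0.
    over.
  rewrite [RHS]ge0_integral_fsum//; last 2 first.
    - move=> r; apply: emeasurable_funM; first exact/measurable_EFinP.
      apply/measurable_EFinP; apply: measurable_funM => //; exact: measurable_indic.
    - by move=> r x _; apply: mule_ge0; [rewrite lee_fin|rewrite EFinM nnfun_muleindic_ge0].
  apply: eq_fsbigr => r _.
  rewrite integralZl_indic_nnsfun//= integral_indic// setIT.
  have [r0|r0] := ltP r 0%R.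
    rewrite preimage_nnfun0// measure0 mule0; apply/esym/integral0_eq => x _.
    by rewrite indic0 /cst mulr0 mule0.
  have mpre : measurable (f_ n @^-1` [set r]) by [].
  transitivity (r%:E * \int[mu]_t ((exponential_pdf p t)%:E * (\1_(f_ n @^-1` [set r]) t)%:E)).
    congr (_ * _).
    rewrite -[LHS]/(\int[mu]_(t in f_ n @^-1` [set r]) (exponential_pdf p t)%:E).
    rewrite [LHS]integral_mkcond.
    apply: eq_integral => t _; rewrite patchE indicE.
    by case: ifPn; rewrite ?mule1 ?mule0.
  rewrite -ge0_integralZl//; last 2 first.
  - apply: emeasurable_funM; exact/measurable_EFinP.
  - by move=> t _; rewrite mule_ge0 ?lee_fin.
  by apply: eq_integral => t _; rewrite EFinM muleCA.
transitivity (lim (\int[nu]_x (f_ n x)%:E @[n --> \oo])).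
  rewrite -monotone_convergence//.
  - by apply: eq_integral => t _; apply/esym/cvg_lim.
  - by move=> n; exact/measurable_EFinP/measurable_funTS.
  - by move=> n t _; rewrite lee_fin.
  - by move=> t _ m n mn; rewrite lee_fin; exact/lefP/nd_nnsfun_approx.
under eq_fun do rewrite simple.
rewrite -monotone_convergence//.
- apply: eq_integral => t _; apply/cvg_lim => //.
  by apply: cvgeZl => //; exact: fcvg.
- move=> n; apply: emeasurable_funM; first exact/measurable_EFinP.
  exact/measurable_EFinP/measurable_funTS.
- by move=> n t _; rewrite mule_ge0 ?lee_fin.
- move=> t _ m n mn; rewrite lee_wpmul2l ?lee_fin//; exact/lefP/nd_nnsfun_approx.
Qed.

(** The clock is carried by nonnegative times, the only ones at which the process
    is controlled. *)
Lemma eq_exponential_clock (f g : measurableTypeR R -> \bar R) :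
  measurable_fun setT f -> measurable_fun setT g ->
  (forall t, 0 <= f t) -> (forall t, 0 <= g t) ->
  (forall t, (0 <= t)%R -> f t = g t) ->
  \int[nu]_t f t = \int[nu]_t g t.
Proof.
move=> mf mg f0 g0 fg; rewrite !integral_exponential_prob//.
by apply: eq_integral => t; rewrite inE/= in_itv/= andbT => t0; rewrite fg.
Qed.

(** Lack of memory: given [s <= tau], the residual time [tau - s] is again
    exponential, and the remaining weight [exp (- p s) ds] is [p^-1] times the law
    of the clock. *)
Lemma triangle_exponential (G : measurableTypeR R * measurableTypeR R -> \bar R) :
  measurable_fun setT G -> (forall z, 0 <= G z) ->
  \int[nu]_t \int[mu]_(s in `[0%R, t]) G (s, t) =
  p^-1%:E * \int[nu]_s \int[nu]_u G (s, s + u)%R.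
Proof.
move=> mG G0.
pose k (z : measurableTypeR R * measurableTypeR R) := ((p * expR (- (p * z.2)))%:E * G z).
pose D : set (measurableTypeR R * measurableTypeR R) := [set z | 0 <= z.1 <= z.2]%R.
have mD : measurable D by exact: measurable_triangle.
have mk : measurable_fun setT k.
  apply: emeasurable_funM => //; apply/measurable_EFinP.
  apply: measurable_funM => //; apply: measurableT_comp => //.
  apply: measurable_funN => //; exact: measurable_funM.
have k0 z : 0 <= k z by rewrite mule_ge0// lee_fin mulr_ge0 ?expR_ge0// ltW.
have mkD : measurable_fun setT (k \_ D).
  by apply/(measurable_restrictT _ mD); exact: measurable_funTS.
have kD0 z : 0 <= (k \_ D) z by rewrite patchE; case: ifP.
have swap := fubini_tonelli (k \_ D) mkD kD0.
have mGD : measurable_fun setT (G \_ D).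
  by apply/(measurable_restrictT _ mD); exact: measurable_funTS.
have GD0 z : 0 <= (G \_ D) z by rewrite patchE; case: ifP.
have inD s t : ((s, t) \in D) = (0 <= s <= t)%R.
  by apply/idP/idP => [/[!inE]//|h]; rewrite inE.
have IE t : \int[mu]_(s in `[0%R, t]) G (s, t) = \int[mu]_s (G \_ D) (s, t).
  rewrite integral_mkcond; apply: eq_integral => s _.
  by rewrite !patchE inD mem_setE in_itv.
transitivity (\int[mu]_t \int[mu]_s (k \_ D) (s, t)).
  rewrite integral_exponential_prob; first last.
  - by move=> t; exact: integral_ge0.
  - under eq_fun do rewrite IE.
    exact: measurable_fun_fubini_tonelli_G mGD GD0.
  rewrite integral_mkcond; apply: eq_integral => t _.
  rewrite patchE mem_setE in_itv/= andbT; case: ifPn => t0; last first.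
    apply/esym/integral0_eq => s _; rewrite patchE inD; case: ifPn => // /andP[s0 st].
    by rewrite (le_trans s0 st) in t0.
  rewrite IE -ge0_integralZl//; last 2 first.
  - exact: measurableT_comp mGD (pair2_measurable t).
  - by rewrite lee_fin mulr_ge0 ?expR_ge0// ltW.
  by apply: eq_integral => s _; rewrite !patchE; case: ifP => _; rewrite ?mule0.
rewrite -swap.
pose H s := \int[nu]_u G (s, s + u)%R.
have mGs : measurable_fun setT (fun z : measurableTypeR R * measurableTypeR R => G (z.1, (z.1 + z.2)%R)).
  apply: measurableT_comp mG _.
  by apply: measurable_fun_pair => //; exact: measurable_funD.
have mH : measurable_fun setT H.
  exact: (measurable_fun_fubini_tonelli_F (m2 := nu) _ mGs (fun z => G0 _)).
have H0 s : 0 <= H s by exact: integral_ge0.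
rewrite integral_exponential_prob// -ge0_integralZl//; last 3 first.
- apply: emeasurable_funM; last exact: measurable_funTS.
  apply/measurable_EFinP/measurable_funTS; apply: measurable_funM => //.
  apply: measurableT_comp => //; apply: measurable_funN; exact: measurable_funM.
- move=> s _; apply: mule_ge0; last exact: H0.
  by rewrite lee_fin mulr_ge0 ?expR_ge0// ltW.
- by rewrite lee_fin invr_ge0 ltW.
rewrite [RHS]integral_mkcond; apply: eq_integral => s _.
rewrite patchE mem_setE in_itv/= andbT; case: ifPn => s0; last first.
  by apply: integral0_eq => t _; rewrite patchE inD (negbTE s0).
pose kk t := if (s <= t)%R then (p * expR (- (p * (t - s))))%:E * G (s, t) else 0.
have mkk : measurable_fun setT kk.
  apply: measurable_fun_ifT => //.
  - by apply: measurable_fun_ler.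
  - apply: emeasurable_funM; last exact: measurableT_comp mG (pair1_measurable s).
    apply/measurable_EFinP; apply: measurable_funM => //.
    apply: measurableT_comp => //; apply: measurable_funN; apply: measurable_funM => //.
    exact: measurable_funB.
have kk0 t : 0 <= kk t.
  by rewrite /kk; case: ifP => // _; rewrite mule_ge0// lee_fin mulr_ge0 ?expR_ge0// ltW.
rewrite -/(H s); have -> : H s = \int[mu]_t kk t.
  rewrite -(ge0_integral_shift s mkk kk0) /H integral_exponential_prob//; last first.
    by apply: measurableT_comp mG _; apply: measurable_fun_pair => //; exact: measurable_addl.
  rewrite integral_mkcond; apply: eq_integral => u _.
  rewrite patchE mem_setE in_itv/= andbT /kk lerDl; case: ifP => // _.
  by rewrite [(s + u - s)%R]addrC addKr.
rewrite muleA -EFinM mulrA mulVf ?gt_eqF// mul1r -ge0_integralZl//.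
apply: eq_integral => t _; rewrite patchE inD s0/= /kk; case: ifP => _; last by rewrite mule0.
rewrite /k/= muleA -EFinM; congr (_%:E * _).
by rewrite mulrCA -expRD; congr (_ * expR _)%R; ring.
Qed.
End exponential_clock.

(** * A regular version of the process, and its past *)

Section levy_version.
Context (d : measure_display) (T : measurableType d) (R : realType)
  (P : probability T R) (X : R -> {RV P >-> R}).
Hypothesis levyX : levy_process X.
Notation Rm := (measurableTypeR R).

Variable N : set T.
Hypothesis mN : measurable N.
Hypothesis X_right : forall w, ~ N w -> forall t, (0 <= t)%R ->
  X u w @[u --> t^'+] --> X t w.

Let X0 (t : R) (w : T) : R := if w \in N then 0%R else X t w.

Let mX0 t : measurable_fun setT (X0 t).
Proof.
apply: measurable_fun_ifT => //.
apply: (@measurable_fun_bool _ _ _ _ true).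
by rewrite setTI (_ : _ @^-1` _ = N)//; apply/seteqP; split => w /=; [exact: set_mem|exact: mem_set].
Qed.

(** The process set to [0] on the exceptional null set and at negative times: all
    its paths are then right-continuous and it is jointly measurable. *)
Definition version (t : R) (w : T) : R := if (t < 0)%R then 0%R else X0 t w.
Notation Y := version.

Lemma version_right w t : (0 <= t)%R -> Y u w @[u --> t^'+] --> Y t w.
Proof.
move=> t0; rewrite /Y ltNge t0/= /X0.
case: (boolP (w \in N)) => [wN|wN].
  by apply: cvg_near_cst; near=> u; rewrite if_same.
have nw : ~ N w by move: wN; rewrite notin_setE.
apply: cvg_trans (X_right nw t0); apply: near_eq_cvg; near=> u.
by rewrite ltNge (le_trans t0)//=; near: u; exact: nbhs_right_ge.
Unshelve. all: by end_near. Qed.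

Lemma measurable_version : measurable_fun setT (fun z : Rm * T => Y z.1 z.2).
Proof.
have joint n : exists y : Rm * T -> R, measurable_fun setT y /\
    forall t w, (0 <= t <= n%:R)%R -> y (t, w) = X0 t w.
  have [|//|y [my yE]] := @right_continuous_joint _ T R X0 setT n%:R _ _ (ler0n _ n).
  - by move=> t _; exact: mX0.
  - move=> w _ t t0 _; have := @version_right w t t0; rewrite /Y ltNge t0/=.
    apply: cvg_trans; apply: near_eq_cvg; near=> u.
    by rewrite ltNge (le_trans t0)//=; near: u; exact: nbhs_right_ge.
  by exists y; split => // t w; exact: yE.
pose y n := projT1 (cid (joint n)).
have my n : measurable_fun setT (y n) by rewrite /y; case: cid => ? [].
have yE n t w : (0 <= t <= n%:R)%R -> y n (t, w) = X0 t w.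
  by rewrite /y; case: cid => ? [? H]; exact: H.
apply: (@measurable_fun_cvg _ _ _ _
  (fun n z => (\1_(`[0%R, n%:R]%classic : set Rm) z.1 * y n z)%R)).
  move=> n; apply: measurable_funM => //.
  have mI : measurable_fun setT (\1_(`[0%R, n%:R]%classic) : Rm -> R).
    by apply: measurable_indic; exact: measurable_itv.
  exact: measurableT_comp mI measurable_fst.
move=> [t w] _ /=; rewrite /Y; case: ltP => t0.
  apply: cvg_near_cst; near=> n; rewrite indicE memNset ?mul0r//=.
  by rewrite in_itv/= leNgt t0.
apply: cvg_near_cst; near=> n.
have tn : (0 <= t <= n%:R)%R by rewrite t0/=; near: n; exact: nbhs_infty_ger.
by rewrite indicE mem_set ?mul1r ?yE//= in_itv/=.
Unshelve. all: by end_near. Qed.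

Lemma measurable_version_time w : measurable_fun setT (fun t : Rm => Y t w).
Proof. exact: measurableT_comp measurable_version (pair2_measurable w). Qed.

Lemma measurable_version_space t : measurable_fun setT (Y t).
Proof. exact: measurableT_comp measurable_version (pair1_measurable t). Qed.

Lemma versionE t w : (0 <= t)%R -> ~ N w -> Y t w = X t w.
Proof. by move=> t0 nw; rewrite /Y ltNge t0/= /X0 memNset. Qed.

(** The family generating [past X s], named so that the space with the
    sigma-algebra of the past is itself a measurable type. *)
Definition past_generators (s : R) : set (set T) :=
  \bigcup_(u in `[0%R, s]) g_sigma_algebra_preimage (X u).
Notation S s := (g_sigma_algebraType (past_generators s)).

(** Measurability with respect to the past, up to the null set [N]: the past is not
    completed, and the exceptional set need not belong to it. *)
Definition adapted (s : R) (W : T -> \bar R) := exists W0 : S s -> \bar R,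
  measurable_fun setT W0 /\ forall w, ~ N w -> W w = W0 w.

Lemma measurable_past s : measurable_fun setT (id : T -> S s).
Proof.
move=> _ A mA; rewrite setTI.
have sub : <<s past_generators s >> `<=` (@measurable _ T).
  apply: smallest_sub; first exact: sigma_algebra_measurable.
  by move=> B [u /= _ [C mC <-]]; exact: (measurable_funP (X u)).
exact: (sub A mA).
Qed.

Lemma past_measurable s u : (0 <= u <= s)%R ->
  measurable_fun setT (X u : S s -> R).
Proof.
move=> us _ A mA; apply: sub_sigma_algebra; exists u; first by rewrite /= in_itv.
by exists A.
Qed.

Let mXm t : measurable_fun setT (X t : T -> Rm).
Proof. exact: (measurable_funP (X t)). Qed.
(** Packed as a probability, so that product measures can be formed with it. *)
Definition marginal (t : R) : probability Rm R := distribution P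
  (HB.pack_for {RV P >-> Rm} (X t : T -> Rm) (isMeasurableFun.Build _ _ _ _ _ (@mXm t))).

Section markov.
Variables (s t : R).
Hypotheses (s0 : (0 <= s)%R) (st : (s <= t)%R).
Notation law := (marginal (t - s)%R).

Let J (w : T) : S s * Rm := (w, (X t w - X s w)%R).
Let mJ : measurable_fun setT J.
Proof.
apply: measurable_fun_pair; first exact: measurable_past.
by apply: measurable_funB; exact: measurable_funP.
Qed.

(** Independence and stationarity say that the increment from [s] to [t] and the past
    at [s], taken as a random element of the space with the smaller
    sigma-algebra, have the product of their laws as joint law: the two agree on
    rectangles. *)
Lemma increment_joint_law (F : S s * Rm -> \bar R) : measurable_fun setT F ->
  (forall z, 0 <= F z) ->
  \int[P]_w F (w, (X t w - X s w)%R) = \int[P]_w \int[law]_y F (w, y).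
Proof.
move=> mF F0.
pose idS : {RV P >-> S s} :=
  HB.pack (id : T -> S s) (isMeasurableFun.Build _ _ _ _ _ (@measurable_past s)).
pose JS : {RV P >-> (S s * Rm)%type} := HB.pack J (isMeasurableFun.Build _ _ _ _ _ mJ).
have jointE A : measurable A ->
    (distribution P idS \x law) A = distribution P JS A.
  move=> mA; have := @product_measure_unique _ _ (S s) Rm R (distribution P idS) law
    (distribution P JS) _ A mA; apply => B C mB mC.
  rewrite /distribution /pushforward /=.
  have := levy_independent levyX s0 st (A := (fun w => X t w - X s w)%R @^-1` C) (B := B).
  rewrite (levy_stationary levyX s0 st mC) muleC => <-.
  - by congr (P _); apply/seteqP; split => w /= [].
  - by exists C => //; rewrite setTI.
  - exact: mB.
transitivity (\int[distribution P JS]_z F z).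
  by rewrite ge0_integral_distribution.
transitivity (\int[distribution P idS \x law]_z F z).
  by apply: eq_measure_integral => A mA _; exact/esym/jointE.
rewrite fubini_tonelli1// ge0_integral_distribution//.
- exact: measurable_fun_fubini_tonelli_F.
- by move=> w; exact: integral_ge0.
Qed.
End markov.
End levy_version.

(** * The Markov property and renewal at an exponential time *)

Section levy_renewal.
Context (d : measure_display) (T : measurableType d) (R : realType)
  (P : probability T R) (X : R -> {RV P >-> R}).
Hypothesis levyX : levy_process X.
Notation Rm := (measurableTypeR R).
Notation mu := (@lebesgue_measure R).

Variable N : set T.
Hypothesis mN : measurable N.
Hypothesis PN : P N = 0.
Hypothesis X_right : forall w, ~ N w -> forall t, (0 <= t)%R ->
  X u w @[u --> t^'+] --> X t w.
Notation Y := (version X N).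

Let mY : measurable_fun setT (fun z : Rm * T => Y z.1 z.2).
Proof. exact: measurable_version. Qed.

Let mYt t : measurable_fun setT (Y t : T -> Rm).
Proof. exact: measurable_version_space. Qed.

Lemma integral_marginal (g : Rm -> \bar R) (u : R) : (0 <= u)%R ->
  measurable_fun setT g -> (forall x, 0 <= g x) ->
  \int[marginal X u]_y g y = \int[P]_v g (Y u v).
Proof.
move=> u0 mg g0; rewrite ge0_integral_distribution//=.
apply: (ge0_integral_null_change mN PN) => //.
- by move=> w nw; rewrite versionE.
- exact: measurableT_comp mg (mYt u).
Qed.

(** [increment_joint_law] for [W] times [f] of the sum of [X s] and the increment. The
    null set is crossed twice, since [W] is a function of the past only off [N]. *)
Lemma markov_property (s t : R) (W : T -> \bar R) (f : Rm -> \bar R) :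
  (0 <= s)%R -> (s <= t)%R ->
  measurable_fun setT W -> (forall w, 0 <= W w) -> adapted X N s W ->
  measurable_fun setT f -> (forall x, 0 <= f x) ->
  \int[P]_w (W w * f (Y t w)) =
  \int[P]_w (W w * \int[P]_v f (Y s w + Y (t - s) v)%R).
Proof.
move=> s0 st mW W0 [V [mV WV]] mf f0.
have t0 : (0 <= t)%R by exact: le_trans st.
have ts0 : (0 <= t - s)%R by rewrite subr_ge0.
pose F (z : g_sigma_algebraType (past_generators X s) * Rm) :=
  `|V z.1| * f (X s z.1 + z.2)%R.
have mXs : measurable_fun setT (X s : g_sigma_algebraType (past_generators X s) -> Rm).
  by apply: past_measurable; rewrite s0/=.
have mfX : measurable_fun setT
    (fun z : g_sigma_algebraType (past_generators X s) * Rm => f (X s z.1 + z.2)%R).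
  apply: measurableT_comp mf _; apply: measurable_funD.
    exact: measurableT_comp mXs measurable_fst.
  exact: measurable_snd.
have mVa : measurable_fun setT (fun z : g_sigma_algebraType (past_generators X s) * Rm => `|V z.1|).
  by apply: measurableT_comp => //; exact: measurableT_comp mV measurable_fst.
have mF : measurable_fun setT F by exact: emeasurable_funM.
have F0 z : 0 <= F z by rewrite mule_ge0.
have mVT : measurable_fun setT (fun w : T => `|V w|).
  by apply: measurableT_comp => //; exact: measurableT_comp mV (@measurable_past _ _ _ P X s).
have mfx x : measurable_fun setT (fun y : Rm => f (x + y)%R).
  exact: measurableT_comp mf (measurable_addl x).
have mG : measurable_fun setT (fun x : Rm => \int[P]_v f (x + Y (t - s) v)%R).
  apply: (measurable_fun_fubini_tonelli_F (m2 := P)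
    (fun z : Rm * T => f (z.1 + Y (t - s) z.2)%R)) => //.
  apply: measurableT_comp mf _; apply: measurable_funD => //.
  exact: measurableT_comp (mYt _) measurable_snd.
transitivity (\int[P]_w F (w, (X t w - X s w)%R)).
  apply: (ge0_integral_null_change mN PN).
  - move=> w nw; rewrite /F/= versionE// addrC subrK WV// gee0_abs//.
    by rewrite -WV.
  - rewrite /F/=; apply: emeasurable_funM => //.
    apply: measurableT_comp mf _; apply: measurable_funD; first exact: measurable_funP.
    by apply: measurable_funB; exact: measurable_funP.
  - by move=> w; rewrite mule_ge0.
  - by move=> w; exact: F0.
rewrite (increment_joint_law levyX s0 st mF F0).
have innerE w : \int[marginal X (t - s)]_y F (w, y) =
    `|V w| * \int[P]_v f (X s w + Y (t - s) v)%R.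
  rewrite /F/= ge0_integralZl//.
  by rewrite (integral_marginal ts0 (mfx (X s w))).
under eq_integral do rewrite innerE.
apply/esym/(ge0_integral_null_change mN PN).
- move=> w nw; rewrite versionE// WV// gee0_abs//; by rewrite -WV.
- by apply: emeasurable_funM => //; exact: measurableT_comp mG (measurable_funP (X s)).
- by move=> w; rewrite mule_ge0//; exact: integral_ge0.
- by move=> w; rewrite mule_ge0//; exact: integral_ge0.
Qed.

Variables (p : R) (p0 : (0 < p)%R).
Notation nu := (exponential_clock p0).

Let Ym (z : Rm * T) : Rm := Y z.1 z.2.
Let mYm : measurable_fun setT Ym. Proof. exact: mY. Qed.
Let Yrv : {mfun (Rm * T)%type >-> Rm} :=
  HB.pack Ym (isMeasurableFun.Build _ _ _ _ _ mYm).
(** The step law of the random walk obtained by watching the process at the points of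
    a Poisson process of rate [p]. *)
Definition clock_law : probability Rm R := distribution (nu \x P) Yrv.
Notation rho := clock_law.

Lemma integral_clock_law (g : Rm -> \bar R) : measurable_fun setT g ->
  (forall x, 0 <= g x) -> \int[rho]_x g x = \int[nu]_u \int[P]_v g (Y u v).
Proof.
move=> mg g0; rewrite ge0_integral_distribution//.
by rewrite fubini_tonelli1//; [exact: (measurableT_comp mg mYm)|move=> z; exact: g0].
Qed.

(** Split the time [t] of the clock at [s]: by lack of memory the residual clock is
    a fresh one, and by the Markov property the displacement of the process over
    it is a fresh variable of law [rho], independent of the past weight. *)
Lemma renewal (W : Rm * T -> \bar R) (f : Rm -> \bar R) :
  measurable_fun setT W -> (forall z, 0 <= W z) ->
  (forall s, (0 <= s)%R -> adapted X N s (fun w => W (s, w))) ->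
  measurable_fun setT f -> (forall x, 0 <= f x) ->
  \int[nu]_t \int[P]_w ((\int[mu]_(s in `[0%R, t]) W (s, w)) * f (Y t w)) =
  p^-1%:E * \int[nu]_s \int[P]_w (W (s, w) * \int[rho]_y f (Y s w + y)%R).
Proof.
move=> mW W0 Wad mf f0.
pose H (z : (Rm * Rm) * T) := W (z.1.1, z.2) * f (Y z.1.2 z.2).
have mH : measurable_fun setT H.
  apply: emeasurable_funM.
    apply: measurableT_comp mW _; apply: measurable_fun_pair => //.
    exact: measurableT_comp measurable_fst measurable_fst.
  apply: measurableT_comp mf _.
  have mpr : measurable_fun setT (fun z : (Rm * Rm) * T => (z.1.2, z.2)).
    apply: measurable_fun_pair => //.
    exact: measurableT_comp measurable_snd measurable_fst.
  exact: measurableT_comp mY mpr.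
have H0 z : 0 <= H z by rewrite mule_ge0.
pose G (z : Rm * Rm) := \int[P]_w H (z, w).
have mG : measurable_fun setT G by exact: measurable_fun_fubini_tonelli_F.
have G0 z : 0 <= G z by exact: integral_ge0.
transitivity (\int[nu]_t \int[mu]_(s in `[0%R, t]) G (s, t)).
  apply: eq_integral => t _.
  pose I : set Rm := `[0%R, t]%classic.
  pose HI (z : Rm * T) := (\1_I z.1)%:E * H ((z.1, t), z.2).
  have mI : measurable_fun setT (\1_I : Rm -> R).
    by apply: measurable_indic; exact: measurable_itv.
  have mHI : measurable_fun setT HI.
    apply: emeasurable_funM.
      by apply/measurable_EFinP; exact: measurableT_comp mI measurable_fst.
    apply: measurableT_comp mH _; apply: measurable_fun_pair => //.
    by apply: measurable_fun_pair.
  have HI0 z : 0 <= HI z by rewrite mule_ge0// lee_fin.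
  have mI' : measurable I by exact: measurable_itv.
  have restrE (g : Rm -> \bar R) : \int[mu]_(s in `[0%R, t]) g s = \int[mu]_s ((\1_I s)%:E * g s).
    rewrite integral_mkcond; apply: eq_integral => s _.
    by rewrite patchE indicE; case: ifP => _; rewrite ?mul1e ?mul0e.
  have mWs w : measurable_fun setT (fun s : Rm => W (s, w)).
    exact: measurableT_comp mW (pair2_measurable w).
  transitivity (\int[P]_w \int[mu]_s HI (s, w)).
    apply: eq_integral => w _; rewrite restrE muleC -ge0_integralZl//; last 2 first.
    - by apply: emeasurable_funM => //; exact/measurable_EFinP.
    - by move=> s _; rewrite mule_ge0// lee_fin.
    by apply: eq_integral => s _; rewrite /HI /H/= muleCA [f _ * _]muleC.
  rewrite -(fubini_tonelli HI mHI HI0) restrE; apply: eq_integral => s _.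
  rewrite /HI/= ge0_integralZl// ?lee_fin//.
  exact: measurableT_comp mH (pair1_measurable (s, t)).
rewrite (triangle_exponential p0 mG G0); congr (_ * _).
pose E (z : Rm * Rm) := \int[P]_v f (z.1 + Y z.2 v)%R.
have mfY : measurable_fun setT (fun z : (Rm * Rm) * T => f (z.1.1 + Y z.1.2 z.2)%R).
  apply: measurableT_comp mf _; apply: measurable_funD.
    exact: measurableT_comp measurable_fst measurable_fst.
  have mpr : measurable_fun setT (fun z : (Rm * Rm) * T => (z.1.2, z.2)).
    apply: measurable_fun_pair => //.
    exact: measurableT_comp measurable_snd measurable_fst.
  exact: measurableT_comp mY mpr.
have mE : measurable_fun setT E by exact: (measurable_fun_fubini_tonelli_F (m2 := P) _ mfY).
have E0 z : 0 <= E z by exact: integral_ge0.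
have rhoE x : \int[rho]_y f (x + y)%R = \int[nu]_u E (x, u).
  rewrite integral_clock_law//.
  exact: measurableT_comp mf (measurable_addl x).
have mGu s : measurable_fun setT (fun u : Rm => G (s, s + u)%R).
  apply: measurableT_comp mG _; apply: measurable_fun_pair => //.
  exact: measurable_addl.
have mWE s : measurable_fun setT (fun z : Rm * T => W (s, z.2) * E (Y s z.2, z.1)).
  apply: emeasurable_funM.
    exact: measurableT_comp (measurableT_comp mW (pair1_measurable s)) measurable_snd.
  apply: measurableT_comp mE _; apply: measurable_fun_pair => //.
  exact: measurableT_comp (mYt s) measurable_snd.
have mrho : measurable_fun setT (fun x : Rm => \int[rho]_y f (x + y)%R).
  under eq_fun do rewrite rhoE.
  exact: (measurable_fun_fubini_tonelli_F (m2 := nu) _ mE).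
apply: eq_exponential_clock.
- have mGs : measurable_fun setT (fun z : Rm * Rm => G (z.1, (z.1 + z.2)%R)).
    by apply: measurableT_comp mG _; apply: measurable_fun_pair => //; exact: measurable_funD.
  exact: (measurable_fun_fubini_tonelli_F (m2 := nu) _ mGs).
- have mWr : measurable_fun setT (fun z : Rm * T => W z * \int[rho]_y f (Y z.1 z.2 + y)%R).
    by apply: emeasurable_funM => //; exact: measurableT_comp mrho mY.
  apply: (measurable_fun_fubini_tonelli_F (m2 := P) _ mWr).
  by move=> z; rewrite mule_ge0//; exact: integral_ge0.
- by move=> s; exact: integral_ge0.
- by move=> s; apply: integral_ge0 => w _; rewrite mule_ge0//; exact: integral_ge0.
move=> s s0.
transitivity (\int[nu]_u \int[P]_w (W (s, w) * E (Y s w, u))).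
  apply: eq_exponential_clock => //.
  - apply: (measurable_fun_fubini_tonelli_F (m2 := P) _ (mWE s)).
    by move=> z; rewrite mule_ge0.
  - by move=> u; apply: integral_ge0 => w _; rewrite mule_ge0.
  move=> u u0; rewrite /G/H/=.
  have su : (s <= s + u)%R by rewrite lerDl.
  have mWs : measurable_fun setT (fun w => W (s, w)).
    exact: measurableT_comp mW (pair1_measurable s).
  rewrite (markov_property s0 su mWs (fun w => W0 (s, w)) (Wad s s0) mf f0).
  by apply: eq_integral => w _; rewrite /E/= [(s + u)%R]addrC addrK.
rewrite (fubini_tonelli (fun z : Rm * T => W (s, z.2) * E (Y s z.2, z.1)))//; last first.
  by move=> z; rewrite mule_ge0.
apply: eq_integral => w _; rewrite rhoE -ge0_integralZl//.
exact: measurableT_comp mE (pair1_measurable _).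
Qed.
End levy_renewal.

(** * Time spent in the nonpositive half line *)

Section running_integral.
Context d (S : measurableType d) (R : realType).
Notation Rm := (measurableTypeR R).
Notation mu := (@lebesgue_measure R).

(** Tonelli's theorem for the restriction of [k] to the triangle [0 <= s <= t]. *)
Lemma measurable_running_integral (k : Rm * S -> \bar R) :
  measurable_fun setT k -> (forall z, 0 <= k z) ->
  measurable_fun setT (fun z : Rm * S => \int[mu]_(s in `[0%R, z.1]) k (s, z.2)).
Proof.
move=> mk k0; pose D := [set z : Rm * Rm | (0 <= z.1 <= z.2)%R].
pose h (z : (Rm * S) * Rm) := (\1_D (z.2, z.1.1))%:E * k (z.2, z.1.2).
have mh : measurable_fun setT h.
  apply: emeasurable_funM.
    apply/measurable_EFinP.
    have mI : measurable_fun setT (\1_D : Rm * Rm -> R).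
      by apply: measurable_indic; exact: measurable_triangle.
    apply: measurableT_comp mI _; apply: measurable_fun_pair => //.
    exact: measurableT_comp measurable_fst measurable_fst.
  apply: measurableT_comp mk _; apply: measurable_fun_pair => //.
  exact: measurableT_comp measurable_snd measurable_fst.
have h0 z : 0 <= h z by rewrite mule_ge0// lee_fin.
apply: eq_measurable_fun (measurable_fun_fubini_tonelli_F (m2 := mu) h mh h0).
move=> [t w] _ /=; rewrite /fubini_F [RHS]integral_mkcond.
apply: eq_integral => s _; rewrite /h/= patchE indicE.
have -> : (s \in [set` `[0%R, t]]) = (0 <= s <= t)%R by rewrite mem_setE in_itv.
have -> : ((s, t) \in D) = (0 <= s <= t)%R.
  by apply/idP/idP => [/[!inE]//|h']; rewrite inE.
by case: ifP => _; rewrite ?mul1e ?mul0e.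
Qed.
End running_integral.

Section levy_sojourn.
Context (d : measure_display) (T : measurableType d) (R : realType)
  (P : probability T R) (X : R -> {RV P >-> R}).
Notation Rm := (measurableTypeR R).
Notation mu := (@lebesgue_measure R).

Variable N : set T.
Hypothesis mN : measurable N.
Hypothesis X_right : forall w, ~ N w -> forall t, (0 <= t)%R ->
  X u w @[u --> t^'+] --> X t w.
Notation Y := (version X N).
Notation nonpos := ([set x : Rm | (x <= 0)%R]).

Let mY : measurable_fun setT (fun z : Rm * T => Y z.1 z.2 : Rm).
Proof. exact: measurable_version. Qed.
Let mYw w : measurable_fun setT (fun t : Rm => Y t w : Rm).
Proof. exact: measurable_version_time. Qed.

Lemma measurable_nonpos : measurable (nonpos : set Rm).
Proof.
rewrite (_ : nonpos = `]-oo, 0%R]%classic); first exact: measurable_itv.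
by apply/seteqP; split=> x; rewrite /= in_itv.
Qed.

Let mI : measurable_fun setT (\1_nonpos : Rm -> R).
Proof. exact: measurable_indic measurable_nonpos. Qed.

Lemma indic_itv01 (A : set Rm) x : (0 <= (\1_A x : R) <= 1)%R.
Proof. by rewrite indicE; case: (x \in A); rewrite ?lexx ler01. Qed.

Definition nonpos_time (t : R) (w : T) : R :=
  antideriv (fun s => \1_nonpos (Y s w)) t.

Let mIY w : measurable_fun setT (fun s : R => \1_nonpos (Y s w) : R).
Proof. exact: (measurableT_comp mI (mYw w)). Qed.

Let IY01 w s : (0 <= (\1_nonpos (Y s w) : R) <= 1)%R. Proof. exact: indic_itv01. Qed.

Lemma measurable_nonpos_time :
  measurable_fun setT (fun z : Rm * T => nonpos_time z.1 z.2).
Proof.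
have mk : measurable_fun setT (fun z : Rm * T => (\1_nonpos (Y z.1 z.2) : R)%:E).
  by apply/measurable_EFinP; exact: measurableT_comp mI mY.
have k0 (z : Rm * T) : 0 <= (\1_nonpos (Y z.1 z.2) : R)%:E by rewrite lee_fin.
have H := measurable_running_integral mk k0.
exact: (measurableT_comp (fine_measurable measurableT) H).
Qed.

Variables (lambda : R) (l0 : (0 < lambda)%R).

Definition growth (t : R) (w : T) : R := expR (lambda * nonpos_time t w).
Notation Z := growth.

Lemma measurable_growth : measurable_fun setT (fun z : Rm * T => Z z.1 z.2).
Proof.
apply: measurableT_comp => //; apply: measurable_funM => //.
exact: measurable_nonpos_time.
Qed.

(** The derivative of [exp (lambda H t)] in [t], see [growth_integral]. *)
Definition weight (z : Rm * T) : \bar R :=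
  (lambda * (\1_nonpos (Y z.1 z.2) * Z z.1 z.2))%:E.

Lemma measurable_weight : measurable_fun setT weight.
Proof.
apply/measurable_EFinP; apply: measurable_funM => //; apply: measurable_funM.
  exact: measurableT_comp mI mY.
exact: measurable_growth.
Qed.

Lemma weight_ge0 z : 0 <= weight z.
Proof. by rewrite lee_fin !mulr_ge0 ?expR_ge0// ltW. Qed.

(** The process up to time [s] has a jointly measurable version with respect to the
    past at [s]; integrating its occupation indicator over [0, s] gives a function
    of the past that agrees with the time [H s] off the null set. *)
Lemma adapted_weight s : (0 <= s)%R -> adapted X N s (fun w => weight (s, w)).
Proof.
move=> s0; pose S := g_sigma_algebraType (past_generators X s).
have [||y [my yE]] := @right_continuous_joint _ S R (fun t w => X t w) (~` N) s _ _ s0.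
- by move=> t ts; exact: past_measurable.
- by move=> w nw t t0 _; exact: X_right.
have mXs : measurable_fun setT (X s : S -> Rm) by apply: past_measurable; rewrite s0/=.
have my' : measurable_fun setT (y : Rm * S -> Rm) by exact: my.
pose F (w : S) := fine (\int[mu]_(u in `[0%R, s]) (\1_nonpos (y (u, w)) : R)%:E).
exists (fun w => (lambda * (\1_nonpos (X s w) * expR (lambda * F w)))%:E); split.
  apply/measurable_EFinP; apply: measurable_funM => //; apply: measurable_funM.
    exact: measurableT_comp mI mXs.
  apply: measurableT_comp => //; apply: measurable_funM => //.
  apply: (measurableT_comp (fine_measurable measurableT)).
  have mk : measurable_fun setT (fun z : Rm * S => (\1_nonpos (y z) : R)%:E).
    by apply/measurable_EFinP; exact: measurableT_comp mI my'.
  have k0 (z : Rm * S) : 0 <= (\1_nonpos (y z) : R)%:E by rewrite lee_fin.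
  exact: measurableT_comp (measurable_running_integral mk k0) (pair1_measurable (s : Rm)).
move=> w nw; rewrite /weight/= versionE//; congr (lambda * (_ * expR (lambda * _)))%R%:E.
rewrite /nonpos_time /antideriv /F /Rintegral; congr fine; apply: eq_integral => u.
rewrite inE/= in_itv/= => us; rewrite yE// versionE//.
by case/andP: us.
Qed.

Lemma growth_integral t w : (0 <= t)%R ->
  (Z t w)%:E = 1 + \int[mu]_(s in `[0%R, t]) weight (s, w).
Proof.
move=> t0; rewrite /Z /nonpos_time (integral_exponential (mIY w) (IY01 w) (ltW l0) t0).
rewrite EFinD; congr (_ + _).
have mZw : measurable_fun setT (fun s : Rm => Z s w).
  exact: measurableT_comp measurable_growth (pair2_measurable w).
have int_gZ : mu.-integrable `[0%R, t] (EFin \o (fun s => \1_nonpos (Y s w) * Z s w)%R).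
  apply: (@integrable_bounded_itv _ _ (expR (lambda * t))).
    by apply: measurable_funM => //; exact: mIY.
  move=> s; rewrite inE/= in_itv/= => /andP[s0 st].
  have /andP[i0 i1] := IY01 w s; have z0 : (0 <= Z s w)%R by exact: expR_ge0.
  rewrite ger0_norm ?mulr_ge0// -[leRHS]mul1r ler_pM//.
  rewrite ler_expR ler_wpM2l ?(ltW l0)//.
  exact: le_trans (antideriv_le (mIY w) (IY01 w) s0) st.
rewrite EFinM /Rintegral fineK; last exact: integrable_fin_num.
by rewrite -integralZl//; apply: eq_integral => s _; rewrite /weight/= EFinM.
Qed.
End levy_sojourn.

(** * Reduction to a random walk *)

Section feynman_kac.
Context (d : measure_display) (T : measurableType d) (R : realType)
  (P : probability T R) (X : R -> {RV P >-> R}).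
Hypothesis levyX : levy_process X.
Notation Rm := (measurableTypeR R).
Notation mu := (@lebesgue_measure R).

Variable N : set T.
Hypothesis mN : measurable N.
Hypothesis PN : P N = 0.
Hypothesis X_right : forall w, ~ N w -> forall t, (0 <= t)%R ->
  X u w @[u --> t^'+] --> X t w.
Notation Y := (version X N).
Notation nonpos := ([set x : Rm | (x <= 0)%R]).

Variables (q lambda : R) (q0 : (0 < q)%R) (l0 : (0 < lambda)%R).
Notation p := (q + lambda)%R.
Variable p0 : (0 < p)%R.
Notation nu := (exponential_clock p0).
Notation rho := (clock_law mN X_right p0).
Notation Z := (growth X N lambda).
Notation W := (weight X N lambda).

Let mY : measurable_fun setT (fun z : Rm * T => Y z.1 z.2 : Rm).
Proof. exact: measurable_version. Qed.
Let mZ : measurable_fun setT (fun z : Rm * T => (Z z.1 z.2)%:E).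
Proof. by apply/measurable_EFinP; exact: measurable_growth. Qed.
Let mW : measurable_fun setT W. Proof. exact: measurable_weight. Qed.
Let W0 z : 0 <= W z. Proof. exact: weight_ge0. Qed.
Let Z0 t w : 0 <= (Z t w)%:E. Proof. by rewrite lee_fin expR_ge0. Qed.

(** Kac's functional, up to the factor [p]: the [q]-resolvent of the process killed
    at rate [lambda] while it is positive. *)
Definition discounted (f : Rm -> \bar R) : \bar R :=
  \int[nu]_t \int[P]_w ((Z t w)%:E * f (Y t w)).
Notation V := discounted.

Let mtime (h : Rm * T -> \bar R) : measurable_fun setT h -> (forall z, 0 <= h z) ->
  measurable_fun setT (fun t : Rm => \int[P]_w h (t, w)).
Proof. by move=> mh h0; exact: (measurable_fun_fubini_tonelli_F (m2 := P) _ mh h0). Qed.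

(** Insert [exp (lambda H t) = 1 + int_0^t weight s ds]. The constant gives the law of
    [X tau]; the integral is a renewal at the time [s], where the weight is
    [lambda 1{X s <= 0} exp (lambda H s)]. *)
Lemma feynman_kac (f : Rm -> \bar R) : measurable_fun setT f -> (forall x, 0 <= f x) ->
  V f = \int[rho]_x f x +
    (lambda / p)%:E * V (fun x => (\1_nonpos x)%:E * \int[rho]_y f (x + y)%R).
Proof.
move=> mf f0.
have mfY : measurable_fun setT (fun z : Rm * T => f (Y z.1 z.2)).
  exact: measurableT_comp mf mY.
pose A (z : Rm * T) := \int[mu]_(s in `[0%R, z.1]) W (s, z.2).
have mA : measurable_fun setT A by exact: measurable_running_integral.
have A0 z : 0 <= A z by apply: integral_ge0 => s _.
have mAf : measurable_fun setT (fun z : Rm * T => A z * f (Y z.1 z.2)) by exact: emeasurable_funM.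
transitivity (\int[nu]_t (\int[P]_w f (Y t w) + \int[P]_w (A (t, w) * f (Y t w)))).
  apply: eq_exponential_clock.
  - apply: (mtime (h := fun z => (Z z.1 z.2)%:E * f (Y z.1 z.2))).
      exact: emeasurable_funM.
    by move=> z; rewrite mule_ge0.
  - apply: emeasurable_funD; first exact: (mtime mfY).
    by apply: (mtime mAf) => z; rewrite mule_ge0.
  - by move=> t; apply: integral_ge0 => w _; rewrite mule_ge0.
  - move=> t; apply: adde_ge0; apply: integral_ge0 => w _ //.
    by rewrite mule_ge0.
  move=> t t0; rewrite -ge0_integralD//; last 3 first.
  - exact: measurableT_comp mfY (pair1_measurable (t : Rm)).
  - by move=> w _; rewrite mule_ge0.
  - exact: measurableT_comp mAf (pair1_measurable (t : Rm)).
  apply: eq_integral => w _.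
  by rewrite (growth_integral mN X_right l0)// ge0_muleDl ?mul1e//; exact: A0 (t, w).
rewrite ge0_integralD//; last 4 first.
- by move=> t _; exact: integral_ge0.
- exact: (mtime mfY).
- by move=> t _; apply: integral_ge0 => w _; rewrite mule_ge0.
- by apply: (mtime mAf) => z; rewrite mule_ge0.
rewrite integral_clock_law//; congr (_ + _).
have ad s : (0 <= s)%R -> adapted X N s (fun w => W (s, w)).
  by move=> s0; exact: adapted_weight.
rewrite (renewal levyX mN PN X_right p0 mW W0 ad mf f0).
rewrite EFinM [lambda%:E * _]muleC -muleA; congr (_ * _).
pose K (x : Rm) := \int[rho]_y f (x + y)%R.
have K0 x : 0 <= K x by exact: integral_ge0.
have mK : measurable_fun setT K.
  apply: (measurable_fun_fubini_tonelli_F (m2 := rho) (fun z : Rm * Rm => f (z.1 + z.2)%R)) => //.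
  by apply: measurableT_comp mf _; exact: measurable_funD.
have m1 : measurable_fun setT (fun x : Rm => (\1_nonpos x : R)%:E).
  by apply/measurable_EFinP; apply: measurable_indic; exact: measurable_nonpos.
have mh : measurable_fun setT (fun z : Rm * T => (Z z.1 z.2)%:E * ((\1_nonpos (Y z.1 z.2))%:E * K (Y z.1 z.2))).
  apply: emeasurable_funM => //; apply: emeasurable_funM.
    exact: measurableT_comp m1 mY.
  exact: measurableT_comp mK mY.
have h0 z : 0 <= (Z z.1 z.2)%:E * ((\1_nonpos (Y z.1 z.2))%:E * K (Y z.1 z.2)).
  by rewrite !mule_ge0// lee_fin.
rewrite /V -ge0_integralZl//; last 3 first.
- exact: (mtime mh).
- by move=> t _; apply: integral_ge0 => w _; exact: (h0 (t, w)).
- by rewrite lee_fin ltW.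
apply: eq_integral => s _; rewrite -ge0_integralZl//; last 3 first.
- exact: measurableT_comp mh (pair1_measurable (s : Rm)).
- by move=> w _; exact: (h0 (s, w)).
- by rewrite lee_fin ltW.
apply: eq_integral => w _; rewrite /weight/= !EFinM -/(K _) !muleA.
by congr (_ * _); rewrite -!muleA; congr (_ * _); rewrite muleC.
Qed.

Lemma discounted_le (f g : Rm -> \bar R) : measurable_fun setT f -> measurable_fun setT g ->
  (forall x, 0 <= f x) -> (forall x, f x <= g x) -> V f <= V g.
Proof.
move=> mf mg f0 fg; have g0 x : 0 <= g x by exact: le_trans (fg x).
have mm h : measurable_fun setT h -> measurable_fun setT (fun z : Rm * T => (Z z.1 z.2)%:E * h (Y z.1 z.2)).
  by move=> mh; apply: emeasurable_funM => //; exact: measurableT_comp mh mY.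
have pos h : (forall x, 0 <= h x) -> forall z : Rm * T, 0 <= (Z z.1 z.2)%:E * h (Y z.1 z.2).
  by move=> h0 z; rewrite mule_ge0.
apply: ge0_le_integral => //.
- by move=> t _; apply: integral_ge0 => w _; exact: (pos f f0 (t, w)).
- by apply: (mtime (mm f mf)); exact: pos.
- by apply: (mtime (mm g mg)); exact: pos.
move=> t _; apply: ge0_le_integral => //.
- by move=> w _; exact: (pos f f0 (t, w)).
- exact: measurableT_comp (mm f mf) (pair1_measurable (t : Rm)).
- exact: measurableT_comp (mm g mg) (pair1_measurable (t : Rm)).
- by move=> w _; rewrite lee_wpmul2l.
Qed.

Lemma growth_le t w : (0 <= t)%R -> (Z t w <= expR (lambda * t))%R.
Proof.
move=> t0; rewrite /growth ler_expR ler_wpM2l ?(ltW l0)//.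
apply: antideriv_le => // [|s]; last exact: indic_itv01.
have mI : measurable_fun setT (\1_nonpos : Rm -> R).
  by apply: measurable_indic; exact: measurable_nonpos.
exact: measurableT_comp mI (measurable_version_time mN X_right w).
Qed.

(** [H t <= t], so the clock of rate [p = q + lambda] loses at most the rate
    [lambda]. Finiteness allows the recursion for [V] to be solved in the reals. *)
Lemma discounted1_le : V (fun=> 1) <= (p / q)%:E.
Proof.
have q0' : (0 <= q)%R by exact: ltW.
have clock1 : \int[exponential_clock q0]_t (p / q)%:E = (p / q)%:E.
  rewrite integral_cst// -[RHS]mule1; congr (_ * _).
  exact: (probability_setT (exponential_clock q0)).
rewrite -clock1 integral_exponential_prob//; last first.
  by move=> t; rewrite lee_fin divr_ge0// ltW.
have mh : measurable_fun setT (fun t : Rm => \int[P]_w ((Z t w)%:E * 1)).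
  apply: (mtime (h := fun z => (Z z.1 z.2)%:E * 1)); first exact: emeasurable_funM.
  by move=> z; rewrite mule_ge0.
rewrite /V integral_exponential_prob//; last first.
  by move=> t; apply: integral_ge0 => w _; rewrite mule_ge0.
have mexp (c : R) : measurable_fun setT (fun t : Rm => (c * expR (- (c * t)))%:E).
  apply/measurable_EFinP; apply: measurable_funM => //.
  by apply: measurableT_comp => //; apply: measurable_funN; exact: measurable_funM.
apply: ge0_le_integral => //.
- move=> t _; rewrite mule_ge0//; first by rewrite lee_fin mulr_ge0 ?expR_ge0// ltW.
  by apply: integral_ge0 => w _; rewrite mule_ge0.
- by apply: measurable_funTS; apply: emeasurable_funM.
- by apply: measurable_funTS; apply: emeasurable_funM.
move=> t; rewrite /= in_itv/= andbT => t0.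
have bound : \int[P]_w ((Z t w)%:E * 1) <= (expR (lambda * t))%:E.
  have : \int[P]_w (expR (lambda * t))%:E = (expR (lambda * t))%:E.
    rewrite integral_cst// -[RHS]mule1; congr (_ * _); exact: probability_setT.
  move=> <-; apply: ge0_le_integral => //.
  - by move=> w _; rewrite mule1.
  - apply: emeasurable_funM => //.
    exact: measurableT_comp mZ (pair1_measurable (t : Rm)).
  - by move=> w _; rewrite mule1 lee_fin growth_le.
apply: le_trans (_ : (p * expR (- (p * t)))%:E * (expR (lambda * t))%:E <= _).
  by rewrite lee_wpmul2l// lee_fin mulr_ge0 ?expR_ge0// ltW.
have E : (q * expR (- (q * t)) * (p / q) = p * expR (- (q * t)))%R.
  by rewrite mulrC mulrA divfK ?gt_eqF.
rewrite -!EFinM lee_fin E -mulrA -expRD (_ : - (p * t) + lambda * t = - (q * t))%R//.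
by ring.
Qed.

Lemma discounted_fin f : measurable_fun setT f -> (forall x, 0 <= f x) ->
  (forall x, f x <= 1) -> V f \is a fin_num.
Proof.
move=> mf f0 f1; rewrite ge0_fin_numE.
  apply: le_lt_trans (ltry (p / q)); apply: le_trans discounted1_le.
  exact: discounted_le.
by apply: integral_ge0 => t _; apply: integral_ge0 => w _; rewrite mule_ge0.
Qed.

(** The probability that [x, x + xi_1, ..., x + xi_1 + ... + xi_(n-1)] are all
    nonpositive, for independent [xi_i] of law [rho]: exactly [n] positions are
    tested, the starting point included. *)
Fixpoint survival (n : nat) (x : Rm) : R :=
  if n is n'.+1 then (\1_nonpos x * \int[rho]_y survival n' (x + y))%R else 1%R.

Lemma bm_survival n : bounded_measurable (survival n).
Proof.
elim: n => [|n ih]; first exact: bm_cst.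
apply: bmM; first by apply: bm_indic; exact: measurable_nonpos.
exact: (bm_Rintegral2 rho rho (bm_addx ih)).
Qed.

Lemma survival01 n x : (0 <= survival n x <= 1)%R.
Proof.
elim: n x => [x|n ih x]; first by rewrite /= ler01 lexx.
have bs : bounded_measurable (fun y : Rm => survival n (x + y)%R).
  exact: (bm_section2 (bm_addx (bm_survival n)) x).
have I0 : (0 <= \int[rho]_y survival n (x + y))%R.
  by apply: Rintegral_ge0 => y _; have /andP[] := ih (x + y)%R.
have I1 : (\int[rho]_y survival n (x + y) <= 1)%R.
  have <- : (\int[rho]_(_ in setT) 1 = 1)%R.
    by rewrite Rintegral_cst// mul1r [X in fine X]probability_setT.
  apply: le_Rintegral => //; first exact: (bm_integrable rho bs).
    exact: (bm_integrable rho (bm_cst _ 1%R)).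
  by move=> y _; have /andP[] := ih (x + y)%R.
have /andP[i0 i1] := indic_itv01 nonpos x.
by rewrite /= mulr_ge0//= mulr_ile1.
Qed.

Let v n : R := fine (V (fun x => (survival n x)%:E)).

Let v_fin n : V (fun x => (survival n x)%:E) = (v n)%:E.
Proof.
rewrite /v fineK//; apply: discounted_fin.
- by apply/measurable_EFinP; have [] := bm_survival n.
- by move=> x; rewrite lee_fin; have /andP[] := survival01 n x.
- by move=> x; rewrite lee_fin; have /andP[] := survival01 n x.
Qed.

(** The Feynman-Kac recursion applied to the functions [survival n], which the kernel
    of that recursion maps to one another. *)
Let v_rec n : v n = (\int[rho]_x survival n x + lambda / p * v n.+1)%R.
Proof.
apply: EFin_inj; rewrite EFinD EFinM -!v_fin feynman_kac; first last.
- by move=> x; rewrite lee_fin; have /andP[] := survival01 n x.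
- by apply/measurable_EFinP; have [] := bm_survival n.
rewrite (EFin_bm_Rintegral rho (bm_survival n)); congr (_ + _ * V _).
apply/funext => x; rewrite /= EFinM (EFin_bm_Rintegral rho)//.
exact: (bm_section2 (bm_addx (bm_survival n)) x).
Qed.

(** Unfolding the recursion [n] times leaves the remainder [r^n v n], which vanishes
    since [r < 1] and [v n <= v 0]. *)
Theorem discounted_series :
  series (fun n => (lambda / p) ^+ n * \int[rho]_x survival n x)%R @ \oo -->
  fine (V (fun=> 1)).
Proof.
set r := (lambda / p)%R; set a := fun n => (\int[rho]_x survival n x)%R.
have r0 : (0 <= r)%R by rewrite divr_ge0// ltW.
have r1 : (r < 1)%R by rewrite /r ltr_pdivrMr// mul1r ltrDr.
have sumE n : series (fun n => r ^+ n * a n)%R n = (v 0 - r ^+ n * v n)%R.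
  elim: n => [|n ih]; first by rewrite /series/= big_geq// expr0 mul1r subrr.
  rewrite seriesSr ih exprSr [v n]v_rec -/r -/(a n).
  by generalize (v 0) (v n.+1) (a n) (r ^+ n)%R r => A B C D E; ring.
have v01 n : (0 <= v n <= v 0)%R.
  have pos k x : 0 <= (survival k x)%:E by rewrite lee_fin; have /andP[] := survival01 k x.
  have ms k : measurable_fun setT (fun x => (survival k x)%:E).
    by apply/measurable_EFinP; have [] := bm_survival k.
  rewrite -!lee_fin -!v_fin; apply/andP; split.
    by apply: integral_ge0 => t _; apply: integral_ge0 => w _; rewrite mule_ge0.
  by apply: discounted_le => // x; rewrite lee_fin; have /andP[] := survival01 n x.
rewrite (_ : series _ = (fun n => v 0 - r ^+ n * v n)%R); last exact/funext.
rewrite -[X in _ --> X](subr0 (v 0)); apply: cvgB; first exact: cvg_cst.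
apply: (@squeeze_cvgr _ _ _ _ (fun=> 0%R) (fun n => r ^+ n * v 0)%R).
- apply: nearW => n; have /andP[h1 h2] := v01 n.
  by rewrite mulr_ge0 ?exprn_ge0//= ler_wpM2l ?exprn_ge0.
- exact: cvg_cst.
- rewrite -(mul0r (v 0)); apply: cvgM; last exact: cvg_cst.
  by apply: cvg_expr; rewrite ger0_norm.
Qed.
End feynman_kac.

(** * The random walk in the convolution ring *)

Section step_law.
Context (d : measure_display) (T : measurableType d) (R : realType)
  (P : probability T R) (X : R -> {RV P >-> R}).
Hypothesis levyX : levy_process X.
Notation Rm := (measurableTypeR R).
Notation mu := (@lebesgue_measure R).

Variable N : set T.
Hypothesis mN : measurable N.
Hypothesis PN : P N = 0.
Hypothesis X_right : forall w, ~ N w -> forall t, (0 <= t)%R ->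
  X u w @[u --> t^'+] --> X t w.
Notation Y := (version X N).

Variables (q lambda : R).
Notation p := (q + lambda)%R.
Variable p0 : (0 < p)%R.
Notation nu := (exponential_clock p0).
Notation rho := (clock_law mN X_right p0).
Notation survival := (survival mN X_right p0).

Let mY : measurable_fun setT (fun z : Rm * T => Y z.1 z.2 : Rm).
Proof. exact: measurable_version. Qed.

Definition step : signed_measure R := smeas_measure 1 rho.
Notation u := step.

Lemma stepE f : bounded_measurable f -> u f = (\int[rho]_x f x)%R.
Proof. by move=> bf; rewrite smeas_measureE// mul1r. Qed.

Lemma smeas_mul_stepE (m : signed_measure R) f : bounded_measurable f ->
  ((m * u)%R : signed_measure R) f = m (fun x => \int[rho]_y f (x + y))%R.
Proof.
move=> bf; rewrite [LHS](smeas_mulE m u bf); congr (smeas_val m).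
by apply/funext => x; rewrite stepE//; exact: bm_shift.
Qed.

Lemma mass_step : mass u = 1%R.
Proof.
rewrite /mass stepE; last exact: bm_cst.
by rewrite Rintegral_cst// mul1r [X in fine X]probability_setT.
Qed.

(** Moving one step from the survival function to the killed law: killing before the
    step in [survival] and after the step in [killed] both test the same
    position. *)
Lemma survival_killed i j :
  killed (@smeas_restr R) u j (fun x => \int[rho]_y survival i (x + y))%R =
  mass (killed (@smeas_restr R) u (i + j)).
Proof.
elim: i j => [|i ih] j.
  rewrite add0n; congr (smeas_val _); apply/funext => x /=.
  by rewrite Rintegral_cst// mul1r [X in fine X]probability_setT.
have bs k : bounded_measurable (survival k) by exact: bm_survival.
rewrite -smeas_mul_stepE// addSnnS -ih.
have -> : killed (@smeas_restr R) u j.+1 = smeas_restr (killed (@smeas_restr R) u j * u)%R by [].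
rewrite [RHS]smeas_restrE; last first.
  exact: (bm_Rintegral2 rho rho (bm_addx (bs i))).
by congr (smeas_val _); apply/funext => x /=; rewrite mulrC.
Qed.

Lemma mass_survival n :
  (\int[rho]_x survival n x)%R = mass (killed (@smeas_restr R) u n).
Proof.
rewrite -[n in RHS]addn0 -survival_killed /=.
have bs : bounded_measurable (fun x : Rm => \int[rho]_y survival n (x + y))%R.
  exact: (bm_Rintegral2 rho rho (bm_addx (bm_survival mN X_right p0 n))).
rewrite [RHS](smeas_oneE bs).
by apply: eq_Rintegral => y _; rewrite add0r.
Qed.

(** Powers of the step law are laws of the process at independent gamma times. The
    induction is a renewal with the deterministic weight
    [p (p s)^k / k!], whose integral over [0, t] is [(p t)^(k+1) / (k+1)!]. The
    maximum with [0] keeps the weight nonnegative at negative times. *)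
Lemma step_power k (g : Rm -> R) : bounded_measurable g -> (forall x, (0 <= g x)%R) ->
  ((u ^+ k.+1)%R g)%:E =
  \int[nu]_t (((p * Num.max t 0) ^+ k / k`!%:R)%:E * \int[P]_w (g (Y t w))%:E).
Proof.
have mgY (h : Rm -> R) : bounded_measurable h ->
    measurable_fun setT (fun z : Rm * T => (h (Y z.1 z.2))%:E).
  by move=> [mh _]; apply/measurable_EFinP; exact: measurableT_comp mh mY.
elim: k g => [|k ih] g bg g0.
  have mg : measurable_fun setT (fun x => (g x)%:E) by case: bg => mg _; exact/measurable_EFinP.
  have gE x : 0 <= (g x)%:E by rewrite lee_fin.
  rewrite expr1 stepE// EFin_bm_Rintegral// (integral_clock_law mN X_right p0 mg gE).
  by apply: eq_integral => t _; rewrite expr0 fact0 divr1 mul1e.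
have bKg : bounded_measurable (fun x : Rm => \int[rho]_y g (x + y))%R.
  exact: (bm_Rintegral2 rho rho (bm_addx bg)).
rewrite exprSr smeas_mul_stepE// ih//; last first.
  by move=> x; apply: Rintegral_ge0 => y _.
pose W (z : Rm * T) : \bar R := (p * ((p * Num.max z.1 0) ^+ k / k`!%:R))%:E.
have c0 (t : R) j : (0 <= (p * Num.max t 0) ^+ j / j`!%:R)%R.
  by rewrite divr_ge0// exprn_ge0// mulr_ge0 ?(ltW p0)// le_max lexx orbT.
have mpow j : measurable_fun setT (fun t : Rm => (p * Num.max t 0) ^+ j / j`!%:R)%R.
  apply: measurable_funM => //; apply: measurable_funX; apply: measurable_funM => //.
  exact: measurable_maxr.
have mW : measurable_fun setT W.
  apply/measurable_EFinP; apply: measurable_funM => //.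
  exact: measurableT_comp (mpow k) measurable_fst.
have W0 z : 0 <= W z by rewrite lee_fin mulr_ge0// ltW.
have Wad s : (0 <= s)%R -> adapted X N s (fun w => W (s, w)).
  by move=> _; exists (fun=> (p * ((p * Num.max s 0) ^+ k / k`!%:R))%:E).
have mg : measurable_fun setT (EFin \o g) by case: bg => mg _; exact/measurable_EFinP.
have g0E x : 0 <= (EFin \o g) x by rewrite lee_fin.
have := renewal levyX mN PN X_right p0 mW W0 Wad mg g0E => ren.
have innerE t : (0 <= t)%R ->
    \int[P]_w ((\int[mu]_(s in `[0%R, t]) W (s, w)) * (g (Y t w))%:E) =
    ((p * Num.max t 0) ^+ k.+1 / k.+1`!%:R)%:E * \int[P]_w (g (Y t w))%:E.
  move=> t0; rewrite -ge0_integralZl//; first last.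
  - by rewrite lee_fin.
  - by move=> w _; rewrite lee_fin.
  - exact: measurableT_comp (mgY g bg) (pair1_measurable (t : Rm)).
  apply: eq_integral => w _; congr (_ * _).
  rewrite /W/= (eq_integral (fun s : Rm => (p ^+ k.+1 / k`!%:R)%:E * (s ^+ k)%:E)); last first.
    move=> s; rewrite inE/= in_itv/= => /andP[s0 _].
    rewrite (max_l s0) -EFinM exprMn exprS; congr EFin.
    by rewrite -!mulrA [(s ^+ k * _)%R]mulrC.
  rewrite integralZl//; last first.
    apply: (@integrable_bounded_itv _ (fun s : R => s ^+ k)%R (t ^+ k)%R) => // s.
    rewrite inE/= in_itv/= => /andP[s0 st].
    by rewrite ger0_norm ?exprn_ge0//; apply: lerXn2r.
  rewrite (integral_monomial k t0) -EFinM (max_l t0) exprMn factS natrM invfM.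
  by congr EFin; rewrite mulrACA [(k`!%:R^-1 * _)%R]mulrC.
rewrite -(@eq_exponential_clock _ _ p0 _ _ _ _ _ _ innerE); first last.
- move=> t; rewrite mule_ge0// ?lee_fin//; apply: integral_ge0 => w _.
  by rewrite lee_fin.
- by move=> t; apply: integral_ge0 => w _; rewrite mule_ge0 ?lee_fin//; exact: integral_ge0.
- apply: emeasurable_funM; first exact/measurable_EFinP.
  apply: (measurable_fun_fubini_tonelli_F (m2 := P) _ (mgY g bg)) => z.
  by rewrite lee_fin.
- have mA : measurable_fun setT (fun z : Rm * T =>
      (\int[mu]_(s in `[0%R, z.1]) W (s, z.2)) * (g (Y z.1 z.2))%:E).
    by apply: emeasurable_funM; [exact: measurable_running_integral|exact: mgY].
  apply: (measurable_fun_fubini_tonelli_F (m2 := P) _ mA) => z.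
  by rewrite mule_ge0 ?lee_fin//; exact: integral_ge0.
rewrite ren.
have mgs : measurable_fun setT (fun z : Rm * T => (\int[rho]_y g (Y z.1 z.2 + y))%:E).
  exact: (mgY _ bKg).
have K0 z : 0 <= (\int[rho]_y g (Y z.1 z.2 + y))%:E.
  by rewrite lee_fin; apply: Rintegral_ge0 => y _.
have KE (t : R) w : \int[rho]_y (g (Y t w + y)%R)%:E = (\int[rho]_y g (Y t w + y))%:E.
  by rewrite (EFin_bm_Rintegral rho)//; exact: bm_shift.
rewrite -ge0_integralZl//; last 3 first.
- have mWK : measurable_fun setT (fun z : Rm * T => W z * (\int[rho]_y g (Y z.1 z.2 + y))%:E).
    exact: emeasurable_funM.
  under eq_fun do under eq_integral do rewrite KE.
  apply: (measurable_fun_fubini_tonelli_F (m2 := P) _ mWK) => z.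
  by rewrite mule_ge0.
- by move=> t _; apply: integral_ge0 => w _; rewrite mule_ge0//; exact: integral_ge0.
- by rewrite lee_fin invr_ge0 ltW.
apply: eq_integral => t _.
under [in RHS]eq_integral do rewrite KE.
rewrite /W/= ge0_integralZl//.
- rewrite muleA -EFinM mulKf ?gt_eqF//; congr (_ * _).
- exact: measurableT_comp mgs (pair1_measurable (t : Rm)).
- by move=> w _; exact: (K0 (t, w)).
- by rewrite lee_fin mulr_ge0// ltW.
Qed.
End step_law.

(** * The exponent as a series *)

Section exponent.
Context (d : measure_display) (T : measurableType d) (R : realType)
  (P : probability T R) (X : R -> {RV P >-> R}).
Hypothesis levyX : levy_process X.
Notation Rm := (measurableTypeR R).
Notation mu := (@lebesgue_measure R).

Variable N : set T.
Hypothesis mN : measurable N.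
Hypothesis PN : P N = 0.
Hypothesis X_right : forall w, ~ N w -> forall t, (0 <= t)%R ->
  X u w @[u --> t^'+] --> X t w.
Notation Y := (version X N).

Variables (q lambda : R) (l0 : (0 < lambda)%R).
Notation p := (q + lambda)%R.
Variable p0 : (0 < p)%R.
Notation u := (step mN X_right p0).
Notation r := (lambda / p)%R.

Let mY : measurable_fun setT (fun z : Rm * T => Y z.1 z.2 : Rm).
Proof. exact: measurable_version. Qed.

(** For [B] the half line [x > 0], the exponent in the formula to be proved. It is
    studied for general [B] because its value for the whole line is explicit. *)
Definition exponent (B : set Rm) : \bar R := \int[mu]_(t in `]0%R, +oo[)
  ((expR (- (q * t)) * t^-1)%:E * (\int[P]_w (\1_B (Y t w))%:E)
    * (1 - expR (- (lambda * t)))%:E).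

Let c (k : nat) (t : R) : R := ((p * Num.max t 0) ^+ k / k`!%:R)%R.

Let c_ge0 k t : (0 <= c k t)%R.
Proof. by rewrite divr_ge0// exprn_ge0// mulr_ge0 ?(ltW p0)// le_max lexx orbT. Qed.

Let mc k : measurable_fun setT (c k : Rm -> R).
Proof.
apply: measurable_funM => //; apply: measurable_funX; apply: measurable_funM => //.
exact: measurable_maxr.
Qed.

Let r_gt0 : (0 < r)%R. Proof. exact: divr_gt0. Qed.

(** Write each power of the step law by [step_power] and sum under the integral:
    [p exp (- p t) sum_k r^(k+1) / (k+1) (p t)^k / k!] is
    [exp (- p t) (exp (lambda t) - 1) / t], which is
    [exp (- q t) (1 - exp (- lambda t)) / t] since [p = q + lambda]. *)
Lemma exponent_series (B : set Rm) : measurable B ->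
  \sum_(0 <= k <oo) (r ^+ k.+1 / k.+1%:R * ((u ^+ k.+1)%R (\1_B)))%:E = exponent B.
Proof.
move=> mB; pose D : set Rm := `]0%R, +oo[%classic.
pose h (t : Rm) := \int[P]_w (\1_B (Y t w) : R)%:E.
have mI : measurable_fun setT (fun z : Rm * T => (\1_B (Y z.1 z.2) : R)%:E).
  have m1 : measurable_fun setT (\1_B : Rm -> R) by exact: measurable_indic.
  by apply/measurable_EFinP; exact: measurableT_comp m1 mY.
have mh : measurable_fun setT h.
  by apply: (measurable_fun_fubini_tonelli_F (m2 := P) _ mI) => z; rewrite lee_fin.
have h0 t : 0 <= h t by apply: integral_ge0 => w _; rewrite lee_fin.
pose e (t : Rm) : R := (p * expR (- (p * t)))%R.
have e0 t : (0 <= e t)%R by rewrite mulr_ge0 ?expR_ge0// ltW.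
have me : measurable_fun setT e.
  apply: measurable_funM => //.
  by apply: measurableT_comp => //; apply: measurable_funN; exact: measurable_funM.
pose a k : R := (r ^+ k.+1 / k.+1%:R)%R.
have a0 k : (0 <= a k)%R by rewrite divr_ge0// exprn_ge0// ltW.
pose F k (t : Rm) := (e t * (a k * c k t))%:E * h t.
have mF k : measurable_fun setT (F k).
  apply: emeasurable_funM => //; apply/measurable_EFinP; apply: measurable_funM => //.
  by apply: measurable_funM => //; exact: mc.
have F0 k t : 0 <= F k t.
  apply: mule_ge0; last exact: h0.
  by rewrite lee_fin mulr_ge0 ?e0// mulr_ge0 ?a0 ?c_ge0.
have termE k : (a k * ((u ^+ k.+1)%R (\1_B)))%:E = \int[mu]_(t in D) F k t.
  rewrite EFinM step_power//; last exact: bm_indic.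
  rewrite integral_exponential_prob; first last.
  - by move=> t; apply: mule_ge0; [rewrite lee_fin; exact: c_ge0|exact: h0].
  - by apply: emeasurable_funM => //; apply/measurable_EFinP; exact: mc.
  rewrite -ge0_integralZl//; last 3 first.
  - apply: measurable_funTS; apply: emeasurable_funM; first exact/measurable_EFinP.
    by apply: emeasurable_funM => //; apply/measurable_EFinP; exact: mc.
  - move=> t _; apply: mule_ge0; first by rewrite lee_fin; exact: e0.
    by apply: mule_ge0; [rewrite lee_fin; exact: c_ge0|exact: h0].
  - by rewrite lee_fin.
  rewrite -(@integral_itv_obnd_cbnd R 0%R +oo%O).
    apply: eq_integral => t _; rewrite /F !muleA -!EFinM; congr (_%:E * _).
    by rewrite -/(e t) -/(c k t) [RHS]mulrCA mulrA.
  apply: measurable_funTS; apply: emeasurable_funM => //; apply: emeasurable_funM; first exact/measurable_EFinP.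
  by apply: emeasurable_funM => //; apply/measurable_EFinP; exact: mc.
have mFD k : measurable_fun D (F k) by exact: measurable_funTS.
have mD : measurable D by exact: measurable_itv.
rewrite (eq_eseriesr (fun k _ => termE k)).
rewrite -(@integral_nneseries _ _ _ mu D mD F mFD (fun k t _ => F0 k t)).
apply: eq_integral => t; rewrite inE /D/= in_itv/= andbT => t0.
have hfin : h t \is a fin_num.
  rewrite ge0_fin_numE//; apply: le_lt_trans (ltry 1).
  have <- : \int[P]_w (1%R)%:E = 1%:E :> \bar R.
    by rewrite integral_cst// mul1e; exact: probability_setT.
  apply: ge0_le_integral => //.
  - exact: measurableT_comp mI (pair1_measurable (t : Rm)).
  - by move=> w _; rewrite lee_fin indicE; case: (_ \in _).
rewrite -/(h t) -(fineK hfin); set eta := fine (h t).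
have FE k : F k t = (e t * eta)%:E * (a k * ((p * t) ^+ k / k`!%:R))%:E.
  rewrite /F /c (max_l (ltW t0)) -(fineK hfin) -/eta -!EFinM; congr EFin.
  by rewrite mulrAC.
rewrite (eq_eseriesr (fun k _ => FE k)) nneseriesZl//; last first.
  by move=> k _; rewrite lee_fin mulr_ge0// divr_ge0// exprn_ge0// mulr_ge0// ltW.
rewrite (nneseries_exp_quotient l0 t0 p0) -!EFinM; congr EFin.
rewrite mulrAC [RHS]mulrAC; congr (_ * _)%R.
have E1 : expR (- (q * t)) = (expR (- (p * t)) * expR (lambda * t))%R.
  by rewrite -expRD; congr expR; ring.
have E2 : (expR (lambda * t) * expR (- (lambda * t)) = 1)%R by rewrite expRxMexpNx_1.
rewrite /e E1.
have -> : (p * expR (- (p * t)) * (p^-1 * ((expR (lambda * t) - 1) / t)) =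
  expR (- (p * t)) * ((expR (lambda * t) - 1) / t))%R.
  by rewrite mulrACA divff ?gt_eqF// mul1r.
move: E2; generalize (expR (- (p * t))) (expR (lambda * t)) (expR (- (lambda * t))) (t^-1)%R.
move=> x y z i yz.
have -> : (x * y * i * (1 - z) = x * i * (y - y * z))%R by ring.
by rewrite yz; ring.
Qed.
End exponent.

(** * Closed form at an exponential time *)

Section closed_form.
Local Open Scope ring_scope.
Context (d : measure_display) (T : measurableType d) (R : realType)
  (P : probability T R) (X : R -> {RV P >-> R}).
Hypothesis levyX : levy_process X.
Notation Rm := (measurableTypeR R).

Variable N : set T.
Hypothesis mN : measurable N.
Hypothesis PN : P N = 0%E.
Hypothesis X_right : forall w, ~ N w -> forall t, 0 <= t ->
  X u w @[u --> t^'+] --> X t w.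
Notation nonpos := ([set x : Rm | x <= 0]).
Notation pos := ([set x : Rm | 0 < x]).

Variables (q lambda : R) (q0 : 0 < q) (l0 : 0 < lambda).
Notation p := (q + lambda).
Variable p0 : 0 < p.
Notation u := (step mN X_right p0).
Notation r := (lambda / p).
Notation V := (discounted X N p0).

Let r_gt0 : 0 < r. Proof. exact: divr_gt0. Qed.
Let r_lt1 : r < 1. Proof. by rewrite ltr_pdivrMr// mul1r ltrDr. Qed.

(** The term at [n = 0] is [0], inversion being total. *)
Let x (B : set Rm) (n : nat) : R := r ^+ n * ((u ^+ n) (\1_B)) / n%:R.

Lemma exponentE (B : set Rm) g : measurable B -> series (x B) @ \oo --> g ->
  exponent X N q lambda B = g%:E.
Proof.
move=> mB xg; rewrite -(exponent_series levyX mN PN X_right l0 p0 mB).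
apply: cvg_lim => //.
have sumE n : (\sum_(0 <= k < n) (r ^+ k.+1 / k.+1%:R * ((u ^+ k.+1) (\1_B)))%:E)%E =
    (series (x B) n.+1)%:E.
  rewrite sumEFin; congr EFin; rewrite /series/= big_nat_recl//= {1}/x invr0 mulr0 add0r.
  by apply: eq_bigr => k _; rewrite /x mulrAC.
under eq_fun do rewrite sumE.
apply: cvg_EFin; first exact: nearW.
by rewrite (cvg_shiftS (series (x B))).
Qed.

Lemma step_power_ge0 n (B : set Rm) : measurable B -> 0 <= (u ^+ n) (\1_B).
Proof.
move=> mB; case: n => [|n].
  by rewrite expr0 [leRHS](smeas_oneE (bm_indic _ mB)).
rewrite -lee_fin (step_power levyX mN PN X_right p0); last 2 first.
- exact: bm_indic.
- by move=> y.
apply: integral_ge0 => t _; apply: mule_ge0.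
  by rewrite lee_fin divr_ge0// exprn_ge0// mulr_ge0 ?(ltW p0)// le_max lexx orbT.
by apply: integral_ge0 => w _; rewrite lee_fin.
Qed.

Lemma step_power_setT n : (u ^+ n) (\1_setT) = 1.
Proof.
have -> : \1_(setT : set Rm) = cst 1 :> (Rm -> R) by rewrite indicT.
rewrite -[LHS]/(mass (u ^+ n)); elim: n => [|n ih]; first by rewrite expr0 mass1.
by rewrite exprS massM ih mulr1 mass_step.
Qed.

Lemma measurable_pos : measurable (pos : set Rm).
Proof.
rewrite (_ : pos = `]0, +oo[%classic); first exact: measurable_itv.
by apply/seteqP; split=> y; rewrite /= in_itv/= andbT.
Qed.

Lemma step_power_pos n : (u ^+ n) (\1_pos) = 1 - (u ^+ n) (\1_nonpos).
Proof.
apply/eqP; rewrite eq_sym subr_eq eq_sym -(step_power_setT n) -smeasD; last 2 first.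
- by apply: bm_indic; exact: measurable_pos.
- by apply: bm_indic; exact: measurable_nonpos.
apply/eqP; congr (smeas_val _); apply/funext => y; rewrite /= indicT !indicE.
have [y0|y0] := ltP 0 y.
  by rewrite mem_set// memNset ?addr0//= => /(lt_le_trans y0); rewrite ltxx.
by rewrite memNset ?mem_set ?add0r//= => y1; move: (lt_le_trans y1 y0); rewrite ltxx.
Qed.

(** Spitzer's identity and the exponential formula give [V 1 = exp g], with [g] the
    series of the exponent for [x <= 0]. The series for the whole line is [gT] with
    [exp gT = 1 / (1 - r) = p / q]; this also follows from the exponential formula,
    applied to the geometric series. The exponent for [x > 0] is the difference
    [gT - g], both series being convergent. *)
Lemma discounted_formula :
  ((p^-1)%:E * V (fun=> 1) = (q^-1)%:E * expeR (- exponent X N q lambda pos))%E.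
Proof.
have r_norm : `|r| < 1 by rewrite ger0_norm// ltW.
have x_ge0 B n : measurable B -> 0 <= x B n.
  by move=> mB; rewrite /x !mulr_ge0 ?invr_ge0// ?exprn_ge0 ?step_power_ge0// ltW.
have geo : series (fun n => r ^+ n) @ \oo --> (1 - r)^-1.
  have := @cvg_geometric_series R 1 r r_norm; rewrite mul1r.
  by rewrite (_ : geometric 1 r = (fun n => r ^+ n))//; apply/funext => n; rewrite /geometric/= mul1r.
have x_setT n : x setT n = r ^+ n / n%:R by rewrite /x step_power_setT mulr1.
have cvT : cvgn (series (x setT)).
  apply: (@series_le_cvg _ _ (fun n => r ^+ n)).
  - by move=> n; exact: x_ge0.
  - by move=> n; rewrite exprn_ge0// ltW.
  - move=> n; rewrite x_setT; case: n => [|n]; first by rewrite invr0 mulr0 exprn_ge0// ltW.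
    by rewrite ler_pdivrMr// ler_peMr ?exprn_ge0 ?(ltW r_gt0)// ler1n.
  - by apply/cvg_ex; eexists; exact: geo.
have le_npT n : x nonpos n <= x setT n.
  rewrite /x ler_wpM2r ?invr_ge0// ler_wpM2l ?exprn_ge0 ?(ltW r_gt0)//.
  rewrite step_power_setT -subr_ge0 -step_power_pos; apply: step_power_ge0.
  exact: measurable_pos.
have cvnp : cvgn (series (x nonpos)).
  apply: series_le_cvg cvT => // n; apply: x_ge0 => //; exact: measurable_nonpos.
move/cvg_ex : cvT => [gT /= cvT]; move/cvg_ex : cvnp => [g /= cvnp].
have expT : expR gT = (1 - r)^-1.
  have eT : series (fun n => r ^+ n) @ \oo --> expR gT.
    apply: (@exponential_formula _ _ (fun n => r ^+ n)) => //.
    - by move=> n; rewrite exprn_ge0// ltW.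
    - move=> n; under eq_bigr => k _ do rewrite -exprD subnKC//.
      by rewrite sumr_const card_ord.
    - by rewrite (_ : (fun n => _) = x setT)//; apply/funext => n; rewrite x_setT.
  by rewrite -(cvg_lim _ eT)// -(cvg_lim _ geo).
have expV : expR g = fine (V (fun=> 1%E)).
  have eV : series (fun n => r ^+ n * \int[clock_law mN X_right p0]_y
      survival mN X_right p0 n y) @ \oo --> expR g.
    apply: (@exponential_formula _ _ (fun n => r ^+ n * (u ^+ n) (\1_nonpos))) => //.
    - by rewrite expr0 mul1r mass_survival; exact: mass1.
    - move=> n; rewrite mulr_ge0 ?exprn_ge0 ?(ltW r_gt0)// step_power_ge0//.
      exact: measurable_nonpos.
    - move=> n; rewrite mass_survival -mulrnAr spitzer_mass mulr_sumr.
      apply: eq_bigr => k _; rewrite mass_survival.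
      have -> : r ^+ n = r ^+ k.+1 * r ^+ (n - k.+1)%N.
        by rewrite -exprD subnKC//; exact: ltn_ord.
      by rewrite mulrACA.
  rewrite -(cvg_lim _ eV)//.
  by apply: cvg_lim => //; exact: (discounted_series levyX mN PN X_right q0 l0).
have posE : exponent X N q lambda pos = (gT - g)%:E.
  apply: exponentE; first exact: measurable_pos.
  rewrite (_ : series (x pos) = series (x setT) \- series (x nonpos)); first exact: cvgB.
  apply/funext => n; rewrite /series/= -sumrB; apply: eq_bigr => k _.
  by rewrite /x step_power_pos step_power_setT mulrBr mulrBl.
rewrite posE /= -EFinM -(@fineK _ (V _)); last first.
  by apply: (discounted_fin mN X_right q0 l0) => //.
rewrite -expV -EFinM; congr EFin.
have p_neq0 : p != 0 by rewrite gt_eqF.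
have q_neq0 : q != 0 by rewrite gt_eqF.
rewrite opprB expRD expRN expT invrK.
have -> : 1 - r = q / p by field.
by field; rewrite p_neq0 q_neq0.
Qed.
End closed_form.

(** * The law of the positive sojourn time *)

Section sojourn.
Context (d : measure_display) (T : measurableType d) (R : realType)
  (P : probability T R) (X : R -> {RV P >-> R}).
Hypothesis levyX : levy_process X.
Notation Rm := (measurableTypeR R).
Notation mu := (@lebesgue_measure R).

Variable N : set T.
Hypothesis mN : measurable N.
Hypothesis PN : P N = 0.
Hypothesis X_right : forall w, ~ N w -> forall t, (0 <= t)%R ->
  X u w @[u --> t^'+] --> X t w.
Notation Y := (version X N).
Notation nonpos := ([set x : Rm | (x <= 0)%R]).
Notation F := (nonpos_time X N).

Let mIY w : measurable_fun setT (fun s : R => \1_nonpos (Y s w) : R).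
Proof.
have mI : measurable_fun setT (\1_nonpos : Rm -> R).
  by apply: measurable_indic; exact: measurable_nonpos.
exact: measurableT_comp mI (measurable_version_time mN X_right w).
Qed.
Let IY01 w s : (0 <= (\1_nonpos (Y s w) : R) <= 1)%R. Proof. exact: indic_itv01. Qed.

Lemma positive_sojournE t w : (0 <= t)%R -> ~ N w ->
  positive_sojourn X t w = (t - F t w)%R.
Proof.
move=> t0 nw; rewrite /positive_sojourn.
transitivity (\int[mu]_(s in `[0%R, t]) (1 - \1_nonpos (Y s w)))%R.
  apply: eq_Rintegral => s; rewrite inE/= in_itv/= => /andP[s0 _]; rewrite !indicE versionE//.
  have [Xs|Xs] := ltP 0%R (X s w).
    by rewrite mem_set// memNset ?subr0//= => /(lt_le_trans Xs); rewrite ltxx.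
  rewrite memNset ?mem_set ?subrr//= => Xs'.
  by move: (lt_le_trans Xs' Xs); rewrite ltxx.
rewrite RintegralB//.
- rewrite Rintegral_cst// mul1r; congr (_ - _)%R.
  rewrite [X in fine X](_ : _ = if (0 < t)%R then (t - 0)%R%:E else 0).
    by case: ltgtP t0 => [t0 _|//|<- _]; rewrite /= ?subr0.
  by rewrite [LHS]lebesgue_measure_itv/= lte_fin.
- by apply: (@integrable_bounded_itv _ _ 1) => // s _; rewrite normr1.
- apply: (@integrable_bounded_itv _ _ 1) => // s _.
  by have /andP[i0 i1] := IY01 w s; rewrite ger0_norm.
Qed.

Section fixed_lambda.
Variables (lambda : R) (l0 : (0 < lambda)%R).
Notation Z := (growth X N lambda).

(** [exp (- lambda A t)] for the regular version of the process. *)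
Let E (t : R) (w : T) : R := expR (- (lambda * (t - F t w))).

Let EZ q t w : (expR (- (q * t)) * E t w = expR (- ((q + lambda) * t)) * Z t w)%R.
Proof. by rewrite /E /growth -!expRD; congr expR; ring. Qed.

Let mE : measurable_fun setT (fun z : Rm * T => E z.1 z.2).
Proof.
apply: measurableT_comp => //; apply: measurable_funN; apply: measurable_funM => //.
by apply: measurable_funB; [exact: measurable_fst|exact: measurable_nonpos_time].
Qed.

Let E01 t w : (0 <= t)%R -> (0 <= E t w <= 1)%R.
Proof.
move=> t0; rewrite expR_ge0/= expR_le1 oppr_le0 mulr_ge0 ?(ltW l0)// subr_ge0.
exact: (antideriv_le (mIY w) (IY01 w) t0).
Qed.

Let mEt t : measurable_fun setT (E t).
Proof. exact: measurableT_comp mE (pair1_measurable (t : Rm)). Qed.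

Definition sojourn_laplace (t : R) : R := (\int[P]_w E t w)%R.
Notation L := sojourn_laplace.

Let bE t : (0 <= t)%R -> bounded_measurable (E t).
Proof.
move=> t0; split; first exact: mEt.
by exists 1%R => w; have /andP[e0 e1] := E01 w t0; rewrite ger0_norm.
Qed.

Lemma sojourn_laplaceE t : (0 <= t)%R ->
  'E_P[fun w => expR (- (lambda * positive_sojourn X t w))%R] = (L t)%:E.
Proof.
move=> t0; rewrite unlock (EFin_bm_Rintegral P (bE t0)).
apply: (ge0_integral_null_change mN PN).
- by move=> w nw; rewrite positive_sojournE.
- by apply/measurable_EFinP; exact: mEt.
- by move=> w; rewrite lee_fin expR_ge0.
- by move=> w; rewrite lee_fin expR_ge0.
Qed.

(** [A] is Lipschitz in [t], with constant [1], hence its Laplace transform is Lipschitz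
    with constant [lambda]. *)
Lemma sojourn_laplace_right t : (0 <= t)%R -> L v @[v --> t^'+] --> L t.
Proof.
move=> t0.
have lip v : (t <= v)%R -> (`|L t - L v| <= lambda * (v - t))%R.
  move=> tv; have v0 : (0 <= v)%R by exact: le_trans tv.
  have bB : bounded_measurable (fun w => E t w - E v w)%R.
    rewrite (_ : (fun w => _) = (E t \+ (cst (-1) \* E v))%R); last first.
      by apply/funext => w /=; rewrite mulN1r.
    by apply: bmD; [exact: bE|apply: bmM; [exact: bm_cst|exact: bE]].
  rewrite -RintegralB//; [|exact: (bm_integrable P (bE t0))|exact: (bm_integrable P (bE v0))].
  apply: le_trans (bm_normr_Rintegral_le P (M := (lambda * (v - t))%R) _ _) _.
  - by case: bB.
  - move=> w; have /andP[h1 h2] : (0 <= F v w - F t w <= v - t)%R.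
      exact: (antideriv_lip (mIY w) (IY01 w) t0 tv).
    set a := (lambda * (t - F t w))%R; set b := (lambda * (v - F v w))%R.
    have ab : (0 <= b - a <= lambda * (v - t))%R.
      rewrite /b /a -mulrBr; apply/andP; split.
        by rewrite mulr_ge0 ?(ltW l0)//; lra.
      by rewrite ler_wpM2l ?(ltW l0)//; lra.
    have Eab : E v w = (E t w * expR (- (b - a)))%R.
      by rewrite /E -expRD; congr expR; rewrite -/a -/b; ring.
    have /andP[e0 e1] := E01 w t0; have /andP[ab0 abl] := ab.
    have x1 : (expR (- (b - a)) <= 1)%R by rewrite expR_le1 oppr_le0.
    have x2 : (1 - (b - a) <= expR (- (b - a)))%R by exact: expR_ge1Dx.
    rewrite Eab -[X in (X - _)%R]mulr1 -mulrBr ger0_norm; last by rewrite mulr_ge0// subr_ge0.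
    rewrite -[leRHS]mul1r ler_pM// ?subr_ge0//.
    by apply: le_trans abl; lra.
  - by rewrite [X in fine X]probability_setT mulr1.
apply/cvgrPdist_lt => eps eps0; near=> v.
have tv : (t <= v)%R by near: v; exact: nbhs_right_ge.
apply: le_lt_trans (lip v tv) _.
rewrite mulrC -ltr_pdivlMr// ltrBlDr.
near: v; apply: nbhs_right_lt; rewrite ltrDr divr_gt0//.
Unshelve. all: by end_near. Qed.

Variables (q : R) (q0 : (0 < q)%R).
Notation p := (q + lambda)%R.
Let p0 : (0 < p)%R. Proof. exact: addr_gt0. Qed.
Notation nu := (exponential_clock p0).
Notation V := (discounted X N p0).

(** The integrand [exp (- q t) exp (- lambda A t)] of both double integrals: integrating
    it first in time gives the left-hand side of the identity, and first over the
    paths gives the Laplace transform in [t] of [sojourn_laplace]. *)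
Let h (z : Rm * T) : \bar R := (expR (- (q * z.1)) * E z.1 z.2)%:E.

Let mh : measurable_fun setT h.
Proof.
apply/measurable_EFinP; apply: measurable_funM => //.
apply: measurableT_comp => //; apply: measurable_funN; apply: measurable_funM => //.
Qed.

Let h0 z : 0 <= h z. Proof. by rewrite lee_fin mulr_ge0 ?expR_ge0. Qed.

Lemma integral_expR_halfline :
  \int[mu]_(t in `[0%R, +oo[) (expR (- (q * t)))%:E = (q^-1)%:E.
Proof.
have <- : \int[exponential_clock q0]_t (q^-1)%:E = (q^-1)%:E.
  by rewrite integral_cst// -[RHS]mule1; congr (_ * _); exact: probability_setT.
rewrite integral_exponential_prob//; last by move=> t; rewrite lee_fin invr_ge0 ltW.
by apply: eq_integral => t _; rewrite -EFinM mulrAC divff ?gt_eqF// mul1r.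
Qed.

Let h_fin w : \int[mu]_(t in `[0%R, +oo[) h (t, w) \is a fin_num.
Proof.
rewrite ge0_fin_numE; last by apply: integral_ge0 => t _.
apply: le_lt_trans (ltry q^-1); rewrite -integral_expR_halfline.
apply: ge0_le_integral => //.
- exact: measurable_funTS (measurableT_comp mh (pair2_measurable w)).
- apply: measurable_funTS; apply/measurable_EFinP.
  by apply: measurableT_comp => //; apply: measurable_funN; exact: measurable_funM.
- move=> t; rewrite /= in_itv/= andbT => t0; rewrite lee_fin ler_piMr ?expR_ge0//.
  by have /andP[] := E01 w t0.
Qed.

Let h_clock w :
  \int[mu]_(t in `[0%R, +oo[) h (t, w) = p^-1%:E * \int[nu]_t ((Z t w)%:E * 1).
Proof.
have mZw : measurable_fun setT (fun t : Rm => (Z t w)%:E * 1).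
  apply: emeasurable_funM => //; apply/measurable_EFinP.
  exact: measurableT_comp (measurable_growth mN X_right lambda) (pair2_measurable w).
have Z0 t : 0 <= (Z t w)%:E * 1 by rewrite mule1 lee_fin expR_ge0.
rewrite integral_exponential_prob// -ge0_integralZl//; last 3 first.
- apply: measurable_funTS; apply: emeasurable_funM => //; apply/measurable_EFinP.
  apply: measurable_funM => //.
  by apply: measurableT_comp => //; apply: measurable_funN; exact: measurable_funM.
- by move=> t _; rewrite mule_ge0// lee_fin mulr_ge0 ?expR_ge0// ltW.
- by rewrite lee_fin invr_ge0 ltW.
apply: eq_integral => t _; rewrite /h/= EZ mule1 -!EFinM; congr EFin.
by rewrite -[in RHS]mulrA mulKf// gt_eqF.
Qed.

Lemma positivity_formulaE :
  positivity_formula X q lambda = (p^-1)%:E * V (fun=> 1).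
Proof.
rewrite (discounted_formula levyX mN PN X_right q0 l0); congr (_ * expeR (- _)).
apply: eq_integral => t; rewrite inE/= in_itv/= andbT => t0.
congr (_ * _ * _); have mX : measurable [set w | (0 < X t w)%R].
  rewrite -[X in measurable X]setTI.
  have := measurable_funP (X t) measurableT `]0%R, +oo[%classic.
  rewrite (_ : X t @^-1` `]0%R, +oo[ = [set w | (0 < X t w)%R]); first by apply; exact: measurable_itv.
  by apply/seteqP; split => w; rewrite /= in_itv/= andbT.
rewrite -[X in P X = _]setIT -integral_indic//.
have mYt : measurable_fun setT (Y t : T -> Rm) by exact: measurable_version_space.
have mpos : measurable_fun setT (\1_[set x : Rm | (0 < x)%R] : Rm -> R).
  by apply: measurable_indic; exact: measurable_pos.
apply: (ge0_integral_null_change mN PN).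
- by move=> w nw; rewrite !indicE versionE ?(ltW t0).
- by apply/measurable_EFinP; exact: measurableT_comp mpos mYt.
- by move=> w; rewrite lee_fin.
- by move=> w; rewrite lee_fin.
Qed.

Let integral_h : \int[P]_w \int[mu]_(t in `[0%R, +oo[) h (t, w) = positivity_formula X q lambda.
Proof.
rewrite positivity_formulaE.
have mZ : measurable_fun setT (fun z : Rm * T => (Z z.1 z.2)%:E * 1).
  by apply: emeasurable_funM => //; apply/measurable_EFinP; exact: measurable_growth.
have Z0 (z : Rm * T) : 0 <= (Z z.1 z.2)%:E * 1 by rewrite mule1 lee_fin expR_ge0.
under eq_integral do rewrite h_clock.
rewrite ge0_integralZl//; last 3 first.
- exact: (measurable_fun_fubini_tonelli_G (m1 := nu) _ mZ).
- by move=> w _; apply: integral_ge0 => t _; exact: (Z0 (t, w)).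
- by rewrite lee_fin invr_ge0 ltW.
by rewrite -(fubini_tonelli (m1 := nu) _ mZ Z0).
Qed.

Theorem sojourn_double_laplaceE :
  sojourn_double_laplace X q lambda = positivity_formula X q lambda.
Proof.
rewrite -integral_h /sojourn_double_laplace unlock.
apply: (ge0_integral_null_change mN PN).
- move=> w nw; rewrite -(fineK (h_fin w)); congr EFin.
  apply: eq_Rintegral => t; rewrite inE/= in_itv/= andbT => t0.
  by rewrite positive_sojournE.
- under eq_fun do rewrite h_clock.
  have mZ : measurable_fun setT (fun z : Rm * T => (Z z.1 z.2)%:E * 1).
    by apply: emeasurable_funM => //; apply/measurable_EFinP; exact: measurable_growth.
  apply: emeasurable_funM => //.
  apply: (measurable_fun_fubini_tonelli_G (m1 := nu) _ mZ) => z.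
  by rewrite mule1 lee_fin expR_ge0.
- by move=> w; rewrite lee_fin; apply: Rintegral_ge0 => t _; rewrite mulr_ge0 ?expR_ge0.
- by move=> w; exact: integral_ge0.
Qed.

Theorem integral_sojourn_laplace :
  mu.-integrable `[0%R, +oo[ (fun t => (expR (- (q * t)) * L t)%:E) /\
  \int[mu]_(t in `[0%R, +oo[) (expR (- (q * t)) * L t)%:E = positivity_formula X q lambda.
Proof.
have LE t : (0 <= t)%R -> (expR (- (q * t)) * L t)%:E = \int[P]_w h (t, w).
  move=> t0; rewrite EFinM (EFin_bm_Rintegral P (bE t0)) -ge0_integralZl//.
  - by apply/measurable_EFinP; exact: mEt.
  - by move=> w _; rewrite lee_fin expR_ge0.
pose D : set Rm := `[0%R, +oo[%classic.
have mD : measurable D by exact: measurable_itv.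
pose hD (z : Rm * T) := (\1_D z.1)%:E * h z.
have mhD : measurable_fun setT hD.
  apply: emeasurable_funM => //; apply/measurable_EFinP.
  have mI : measurable_fun setT (\1_D : Rm -> R) by exact: measurable_indic.
  exact: measurableT_comp mI measurable_fst.
have hD0 z : 0 <= hD z by rewrite mule_ge0// lee_fin.
have swap : \int[mu]_(t in D) \int[P]_w h (t, w) = positivity_formula X q lambda.
  rewrite -integral_h.
  transitivity (\int[mu]_t \int[P]_w hD (t, w)).
    rewrite integral_mkcond; apply: eq_integral => t _; rewrite patchE /hD/= indicE.
    case: ifPn => tD; first by apply: eq_integral => w _; rewrite mul1e.
    by apply/esym/integral0_eq => w _; rewrite mul0e.
  rewrite (fubini_tonelli _ mhD hD0); apply: eq_integral => w _.
  rewrite [RHS]integral_mkcond; apply: eq_integral => t _.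
  by rewrite patchE /hD/= indicE; case: ifPn => _; rewrite ?mul1e ?mul0e.
have val : \int[mu]_(t in D) (expR (- (q * t)) * L t)%:E = positivity_formula X q lambda.
  rewrite -swap; apply: eq_integral => t; rewrite inE/D/= in_itv/= andbT => t0.
  exact: LE.
split => //; apply/integrableP; split.
  apply: (eq_measurable_fun (fun t => \int[P]_w h (t, w))).
    by move=> t; rewrite inE/= in_itv/= andbT => t0; rewrite LE.
  by apply: measurable_funTS; exact: (measurable_fun_fubini_tonelli_F (m2 := P) _ mh).
rewrite (eq_integral (fun t : Rm => (expR (- (q * t)) * L t)%:E)); last first.
  move=> t _; rewrite gee0_abs// lee_fin mulr_ge0 ?expR_ge0//.
  by apply: Rintegral_ge0 => w _; exact: expR_ge0.
rewrite val positivity_formulaE -ge0_fin_numE; last first.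
  rewrite -positivity_formulaE -swap; apply: integral_ge0 => t _.
  by apply: integral_ge0.
by rewrite fin_numM// (discounted_fin mN X_right q0 l0).
Qed.
End fixed_lambda.
End sojourn.

(** Uniqueness is read off [laplace_unique], applied for each [lambda] to the
    difference between a solution and the true transform; conversely the true
    transform is a solution since it is right-continuous and, by Tonelli, has the
    required Laplace transform in [t]. *)
Theorem proposition1 (d : measure_display) (T : measurableType d)
    (R : realType) (P : probability T R) (X : R -> {RV P >-> R})
    (levyX : levy_process X) :
  (forall q lambda : R, (0 < q)%R -> (0 < lambda)%R ->
     sojourn_double_laplace X q lambda = positivity_formula X q lambda) /\
  (forall L : R -> R -> R,
     solves_identity X L <->
     (forall lambda t : R, (0 < lambda)%R -> (0 <= t)%R ->
        'E_P[fun w => expR (- (lambda * positive_sojourn X t w))%R]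
        = (L t lambda)%:E)).
Proof.
have [N [mN PN cadlagN]] := levy_cadlag levyX.
have X_right w : ~ N w -> forall t, (0 <= t)%R -> X u w @[u --> t^'+] --> X t w.
  move=> nw; suff [] : cadlag (fun t => X t w) by [].
  by apply: contrapT => not_cadlag; apply: nw; exact: cadlagN.
split => [q lambda q0 l0|L].
  exact: (sojourn_double_laplaceE levyX mN PN X_right l0 q0).
pose ell lambda := sojourn_laplace X N lambda.
have ellE lambda t : (0 < lambda)%R -> (0 <= t)%R ->
    'E_P[fun w => expR (- (lambda * positive_sojourn X t w))%R] = (ell lambda t)%:E.
  by move=> l0 t0; exact: sojourn_laplaceE.
have ell_right lambda : (0 < lambda)%R -> forall t, (0 <= t)%R ->
    ell lambda v @[v --> t^'+] --> ell lambda t.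
  by move=> l0 t t0; exact: sojourn_laplace_right.
split => [sol lambda t l0 t0|LE lambda l0].
- rewrite ellE//; congr EFin; apply/esym/eqP; rewrite -subr_eq0; apply/eqP.
  have [L_right L_id] := sol lambda l0.
  apply: (@laplace_unique R (fun t => L t lambda - ell lambda t)%R) => //.
  + by move=> v v0; apply: cvgB; [exact: L_right|exact: ell_right].
  + move=> q q0; have [Li _] := L_id q q0.
    have [ei _] := integral_sojourn_laplace levyX mN PN X_right l0 q0.
    apply: eq_integrable (integrableB _ Li ei) => // t' _ /=.
    by rewrite mulrBr EFinB.
  + move=> q q0; have [Li LE] := L_id q q0.
    have [ei eE] := integral_sojourn_laplace levyX mN PN X_right l0 q0.
    under eq_integral => t' _ do rewrite [X in X%:E]mulrBr EFinB.
    rewrite integralB// LE eE subee//.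
    by rewrite -eE; exact: integrable_fin_num.
have LL t : (0 <= t)%R -> L t lambda = ell lambda t.
  by move=> t0; apply: EFin_inj; rewrite -LE// ellE.
split => [t t0|q q0].
  rewrite LL//; apply: cvg_trans (ell_right lambda l0 t t0).
  apply: near_eq_cvg; near=> v; rewrite LL//; apply: (le_trans t0).
  by near: v; exact: nbhs_right_ge.
have [ei eE] := integral_sojourn_laplace levyX mN PN X_right l0 q0.
have E t : t \in `[0%R, +oo[%classic ->
    (expR (- (q * t)) * ell lambda t)%:E = (expR (- (q * t)) * L t lambda)%:E.
  by rewrite inE/= in_itv/= andbT => t0; rewrite LL.
split; first by move: ei; apply: eq_integrable => //; exact: E.
by rewrite -eE; apply: eq_integral => t tD; rewrite -E.
Unshelve. all: by end_near. Qed.
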